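(* Let $\mu>0$, $\sigma>0$, and, for each $n\ge1$, let $\xi_{n,k}$, $k=1,2,\ldots$, be independent identically distributed random variables with mean $0$ and variance $1$, such that $|\xi_{n,k}|\leq C_0$ for all $n,k$ with some constant $C_0$. Set $$r_{n,k}=\frac{\mu}{n}+\frac{\sigma}{\sqrt n}\,\xi_{n,k},\qquad W^{n,f}_t=\prod_{k=1}^{\lfloor nt\rfloor}\big(1+fr_{n,k}\big),$$ with $n$ large enough that $|r_{n,k}|\leq \tfrac12$. Let $B=(B_t)_{t\ge0}$ be a standard Brownian motion and $$W^f_t=\exp\left(\left(f\mu-\frac{f^2\sigma^2}{2}\right)t+f\sigma B_t\right).$$ Then, for every $T>0$ and every $f\in[0,1]$, the sequence of processes $(W^{n,f}_t,\ t\in[0,T])$ converges in law, as $n\to\infty$, to the process $(W^f_t,\ t\in[0,T])$.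
   Context: $\lfloor x\rfloor$ is the integer part of $x$; the empty product equals $1$. Convergence in law is weak convergence in the Skorokhod space of right-continuous functions with left limits on $[0,T]$. *)

(* Defs.v *)
From HB Require Import structures.
From mathcomp Require Import all_boot all_order all_algebra finmap.
From mathcomp Require Import all_classical all_reals all_analysis.

Set Implicit Arguments.
Unset Strict Implicit.
Unset Printing Implicit Defensive.

Import Order.TTheory GRing.Theory Num.Theory.
Import numFieldNormedType.Exports.

Local Open Scope classical_set_scope.
Local Open Scope ring_scope.

Definition independent_RVs (R : realType) (d : measure_display)
    (Omega : measurableType d) (P : probability Omega R) (I : set nat)
    (X : nat -> Omega -> R) : Prop :=
  forall J : {fset nat}, [set` J] `<=` I ->
  forall A : nat -> set R, (forall i, measurable (A i)) ->
    P (\bigcap_(i in [set` J]) X i @^-1` A i) =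
    (\prod_(i <- J) P (X i @^-1` A i))%E.

(* Restricted to measurable sets: a [distribution] is a total function on
   [set R], with no meaning outside the sigma-algebra. *)
Definition same_law (R : realType) (d : measure_display)
    (Omega : measurableType d) (P : probability Omega R)
    (X Y : {RV P >-> R}) : Prop :=
  forall A : set R, measurable A -> distribution P X A = distribution P Y A.

(* The process is indexed by all of [R], only the indices [0 <= t] being
   constrained. Independence of the increments over the finite subdivisions is
   stated over infinite nondecreasing sequences of times: a finite subdivision
   extends to a stationary sequence. The second parameter of [normal_prob] is
   the standard deviation. *)
Record brownian_motion (R : realType) (d : measure_display)
    (Omega : measurableType d) (P : probability Omega R)
    (B : R -> {RV P >-> R}) : Prop := BrownianMotion {
  brownian_start : {ae P, forall w, B 0 w = 0} ;
  brownian_indep : forall t : nat -> R, 0 <= t 0%N ->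
    {homo t : i j / (i <= j)%N >-> i <= j} ->
    independent_RVs P setT (fun k => B (t k.+1) \- B (t k)) ;
  brownian_normal : forall s t : R, 0 <= s -> s < t ->
    forall A : set R, measurable A ->
    P ((B t \- B s) @^-1` A) = normal_prob 0 (Num.sqrt (t - s)) A ;
  brownian_continuous : forall w,
    {within `[0, +oo[, continuous (fun t : R => B t w)} }.
Arguments brownian_continuous {R d Omega P B} _ _ : rename.

Definition cadlag (R : realType) (T : R) (x : R -> R) : Prop :=
  (forall t : R, 0 <= t < T -> x s @[s --> t^'+] --> x t) /\
  (forall t : R, 0 < t <= T -> cvg (x s @[s --> t^'-])).

(* A function on [[0, T]] is represented by its extension by zero to [R], so
   that Leibniz equality is equality on [[0, T]]; [cadlag T] does not look
   outside [[0, T]]. *)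
Record skorokhod (R : realType) (T : R) : Type := Skorokhod {
  skorokhod_fun :> R -> R ;
  skorokhod_cadlag : cadlag T skorokhod_fun ;
  skorokhod_out : forall t : R, t \notin `[0, T] -> skorokhod_fun t = 0 }.

Definition time_change (R : realType) (T : R) (l : R -> R) : Prop :=
  [/\ {within `[0, T], continuous l},
      {in `[0, T] &, {homo l : s t / s < t}} &
      l @` `[0, T] = `[0, T]%classic].

(* The open ball of radius [e] for Skorokhod's J1 distance
     d(x, y) = inf_l max (sup_t |l t - t|, sup_t |x t - y (l t)|),
   [l] ranging over the time changes of [[0, T]] and [t] over [[0, T]]. *)
Definition skorokhod_ball (R : realType) (T : R) (x : skorokhod T) (e : R)
    (y : skorokhod T) : Prop :=
  exists2 l : R -> R, time_change T l &
  exists2 e' : R, e' < e & forall t : R, t \in `[0, T] ->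
    `|l t - t| <= e' /\ `|x t - y (l t)| <= e'.

Section skorokhod_topology.
Context {R : realType} (T : R).
Implicit Types (x y z : skorokhod T) (l : R -> R) (e : R).

Lemma time_change_itv l t : time_change T l ->
  t \in `[0, T] -> l t \in `[0, T].
Proof.
move=> [_ _ lT] tT.
suff : `[0, T]%classic (l t) by [].
by rewrite -[X in X _]lT; exists t.
Qed.

Lemma time_change_id : time_change T id.
Proof.
split=> //; last by rewrite image_id.
by apply: continuous_subspaceT => t; exact: cvg_id.
Qed.

Lemma time_changeP l :
  {in `[0, T] &, {homo l : s t / s < t}} -> l @` `[0, T] = `[0, T]%classic ->
  time_change T l.
Proof.
move=> lm lT; split=> //; have [T0|T0] := ltP T 0.
  rewrite continuous_subspace_in => t /set_mem /=; rewrite in_itv/=.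
  by move=> /andP[/le_trans] /[apply]; rewrite leNgt T0.
have lin t : t \in `[0, T] -> l t \in `[0, T].
  by move=> tT; suff : `[0, T]%classic (l t) by []; rewrite -lT; exists t.
apply: segment_inc_surj_continuous; first exact: le_mono_in.
move=> y; rewrite /= in_itv/= => /andP[l0y ylT].
have : `[0, T]%classic y.
  have := lin T; have := lin 0; rewrite !bound_itvE /= => /(_ T0) + /(_ T0).
  rewrite !in_itv/= => /andP[l00 _] /andP[_ lTT].
  by rewrite (le_trans l00 l0y) (le_trans ylT lTT).
by rewrite -lT.
Qed.

Lemma time_change_comp l m : time_change T l -> time_change T m ->
  time_change T (m \o l).
Proof.
move=> tl tm; have lT := time_change_itv tl.
move: tl tm => [_ il sl] [_ im sm]; apply: time_changeP.
- by move=> s t sT tT st /=; apply: im; [exact: lT|exact: lT|exact: il].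
- by rewrite -image_comp sl sm.
Qed.

Lemma time_change_inv l : time_change T l ->
  exists2 m, time_change T m & {in `[0, T], cancel m l}.
Proof.
move=> tl; have lT := time_change_itv tl; case: tl => _ il sl.
have /choice[m mP] : forall t, exists s, t \in `[0, T] ->
    s \in `[0, T] /\ l s = t.
  move=> t; have [tT|tT] := boolP (t \in `[0, T]); last by exists 0.
  suff [s sT <-] : (l @` `[0, T]) t by exists s.
  by rewrite sl.
have lm := le_mono_in il.
exists m => [|t /mP[]//]; apply: time_changeP.
  move=> s t /mP[msT ls] /mP[mtT lt] st; rewrite ltNge; apply/negP.
  by rewrite -lm// ls lt leNgt st.
apply/seteqP; split=> [_ [t tT <-]|t tT]; first by have [] := mP t tT.
have ltT := lT _ tT; exists (l t) => //; have [mT lmt] := mP _ ltT.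
by apply: (inc_inj_in lm).
Qed.

Lemma skorokhod_ball_center x e : 0 < e -> skorokhod_ball x e x.
Proof.
move=> e0; exists id; first exact: time_change_id.
by exists 0 => // t _; rewrite !subrr normr0.
Qed.

Lemma skorokhod_ball_sym x y e : skorokhod_ball x e y -> skorokhod_ball y e x.
Proof.
move=> [l tl [e' e'e xy]]; have [m tm lmK] := time_change_inv tl.
exists m => //; exists e' => // t tT.
have [] := xy (m t) (time_change_itv tm tT).
by rewrite lmK// distrC => mt; rewrite distrC.
Qed.

Lemma skorokhod_ball_triangle x y z e1 e2 :
  skorokhod_ball x e1 y -> skorokhod_ball y e2 z ->
  skorokhod_ball x (e1 + e2) z.
Proof.
move=> [l tl [a ae xy]] [m tm [b be yz]].
exists (m \o l); first exact: time_change_comp.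
exists (a + b) => [|t tT]; first exact: ltrD.
have [lt xlt] := xy t tT; have [mt ymt] := yz _ (time_change_itv tl tT).
split=> /=.
  by rewrite [leRHS]addrC; apply: (le_trans (ler_distD (l t) _ _)); exact: lerD.
by apply: (le_trans (ler_distD (y (l t)) _ _)); exact: lerD.
Qed.

Lemma cadlag0 : cadlag T (fun=> 0 : R).
Proof. by split=> t _; [exact: cvg_cst|exact: is_cvg_cst]. Qed.

HB.instance Definition _ := gen_eqMixin (skorokhod T).
HB.instance Definition _ := gen_choiceMixin (skorokhod T).
HB.instance Definition _ := isPointed.Build (skorokhod T)
  (Skorokhod cadlag0 (fun _ _ => erefl)).

Let ent := entourage_ (@skorokhod_ball R T).
Let nbhs x := nbhs_ ent x.
Let nbhsE : nbhs = nbhs_ ent. Proof. by []. Qed.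
Let entE : ent = entourage_ (@skorokhod_ball R T). Proof. by []. Qed.

HB.instance Definition _ := hasNbhs.Build (skorokhod T) nbhs.
HB.instance Definition _ := @Nbhs_isPseudoMetric.Build R (skorokhod T) ent nbhsE
  (@skorokhod_ball R T) skorokhod_ball_center skorokhod_ball_sym
  skorokhod_ball_triangle entE.

End skorokhod_topology.

Section skorokhod_restriction.
Context {R : realType} (T : R) (x : R -> R).

Lemma cadlag_restrict : cadlag T x -> cadlag T (x \_ `[0, T]).
Proof.
have patchT t : t \in `[0, T] -> (x \_ `[0, T]) t = x t.
  by move=> tT; rewrite patchE mem_setE tT.
move=> [xr xl]; split=> t /andP[t0 tT].
- rewrite patchT ?in_itv/= ?t0 ?ltW//.
  apply: cvg_trans (xr t _); last by rewrite t0.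
  apply: near_eq_cvg; near=> s; rewrite patchT// in_itv/=; apply/andP; split.
    by apply: ltW; apply: le_lt_trans t0 _; near: s; exact: nbhs_right_gt.
  by near: s; exact: nbhs_right_le.
- have xt : x s @[s --> t^'-] --> lim (x s @[s --> t^'-]).
    by apply: xl; rewrite t0.
  apply/cvg_ex; exists (lim (x s @[s --> t^'-])); apply: cvg_trans xt.
  apply: near_eq_cvg; near=> s; rewrite patchT// in_itv/=; apply/andP; split.
    by near: s; exact: nbhs_left_ge.
  by apply: ltW; apply: lt_le_trans tT; near: s; exact: nbhs_left_lt.
Unshelve. all: by end_near. Qed.

Lemma restrict_out t : t \notin `[0, T] -> (x \_ `[0, T]) t = 0.
Proof. by move=> tT; rewrite patchE mem_setE (negbTE tT). Qed.

Definition to_skorokhod (cx : cadlag T x) : skorokhod T :=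
  Skorokhod (cadlag_restrict cx) restrict_out.

End skorokhod_restriction.

Definition borel (S : ptopologicalType) := g_sigma_algebraType (@open S).

(* Weak convergence of the laws of Borel random elements of [S], each defined on
   its own probability space. Measurability is part of the definition, so that
   the expectations are genuine integrals. *)
Definition cvg_in_law (R : realType) (S : ptopologicalType)
    (d : nat -> measure_display) (Omega : forall n, measurableType (d n))
    (P : forall n, probability (Omega n) R) (X : forall n, Omega n -> S)
    (d' : measure_display) (Omega' : measurableType d')
    (P' : probability Omega' R) (Y : Omega' -> S) : Prop :=
  [/\ forall n, measurable_fun setT (X n : Omega n -> borel S),
      measurable_fun setT (Y : Omega' -> borel S) &
      forall g : S -> R, continuous g -> bounded_fun g ->
        ('E_(P n)[g \o X n])%E @[n --> \oo] --> ('E_P'[g \o Y])%E ].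

Definition rate (R : realType) (mu sigma : R) (n : nat) (xi : R) : R :=
  mu / n%:R + sigma / Num.sqrt n%:R * xi.

(* Defined for all [n]: the finitely many [n] for which a return exceeds 1/2 in
   absolute value do not matter for a limit as n goes to infinity. *)
Definition wealth (R : realType) (mu sigma f : R) (n : nat) (xi : nat -> R)
    (t : R) : R :=
  \prod_(1 <= k < (Num.truncn (n%:R * t)).+1) (1 + f * rate mu sigma n (xi k)).

Definition limit_wealth (R : realType) (mu sigma f : R) (b : R -> R)
    (t : R) : R :=
  expR ((f * mu - f ^+ 2 * sigma ^+ 2 / 2) * t + f * sigma * b t).

Lemma truncn_right (R : realType) (n : nat) (t : R) : 0 <= t ->
  \forall s \near t^'+, Num.truncn (n%:R * s) = Num.truncn (n%:R * t).
Proof.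
move=> t0; case: n => [|n]; first by near=> s; rewrite !mul0r.
set m := Num.truncn _.
have m_gt : t < m.+1%:R / n.+1%:R.
  by rewrite ltr_pdivlMr// mulrC truncnS_gt.
have m_le : m%:R <= n.+1%:R * t by rewrite truncn_le// mulr_ge0.
near=> s; have ts : t < s by near: s; exact: nbhs_right_gt.
have sm : s < m.+1%:R / n.+1%:R by near: s; exact: nbhs_right_lt.
apply/truncn_def; rewrite (le_trans m_le) ?ler_pM2l ?ltW//=.
by rewrite mulrC -ltr_pdivlMr.
Unshelve. all: by end_near. Qed.

Lemma truncn_left (R : realType) (n : nat) (t : R) : 0 < t ->
  exists m : nat, \forall s \near t^'-, Num.truncn (n%:R * s) = m.
Proof.
move=> t0; case: n => [|n].
  by exists 0%N; near=> s; rewrite mul0r truncn0.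
have nt0 : 0 < n.+1%:R * t by rewrite mulr_gt0.
have [m /andP[mlt tle]] : exists m : nat, m%:R < n.+1%:R * t <= m.+1%:R.
  have /andP[] := truncn_itv (ltW nt0); set k := Num.truncn _.
  rewrite le_eqVlt => /predU1P[kE _|kt tk]; last by exists k; rewrite kt ltW.
  have k0 : (0 < k)%N by rewrite -(ltr_nat R) kE.
  by exists k.-1; rewrite prednK// -kE lexx andbT ltr_nat prednK.
have ml : m%:R / n.+1%:R < t by rewrite ltr_pdivrMr// mulrC.
exists m; near=> s; have st : s < t by near: s; exact: nbhs_left_lt.
have ms : m%:R / n.+1%:R < s by near: s; exact: nbhs_left_gt.
apply/truncn_def; rewrite mulrC -ler_pdivrMr// ltW//= mulrC.
by rewrite (lt_le_trans _ tle)// ltr_pM2l.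
Unshelve. all: by end_near. Qed.

Lemma cadlag_wealth (R : realType) (T mu sigma f : R) (n : nat)
  (xi : nat -> R) : cadlag T (wealth mu sigma f n xi).
Proof.
split=> t /andP[t0 tT].
  apply: cvg_near_cst; near=> s; rewrite /wealth.
  by rewrite (near (truncn_right n t0) s).
have [m tm] := truncn_left n t0.
apply/cvg_ex; exists (\prod_(1 <= k < m.+1) (1 + f * rate mu sigma n (xi k))).
by apply: cvg_near_cst; near=> s; rewrite /wealth (near tm s).
Unshelve. all: by end_near. Qed.

Lemma cadlag_limit_wealth (R : realType) (T mu sigma f : R) (b : R -> R) :
  {within `[0, +oo[, continuous b} -> cadlag T (limit_wealth mu sigma f b).
Proof.
move=> /continuous_within_itvcyP[cb b0].
have cvg_wealth (F : set_system R) (FF : Filter F) t :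
    F --> t -> b s @[s --> F] --> b t ->
    limit_wealth mu sigma f b s @[s --> F] --> limit_wealth mu sigma f b t.
  move=> Ft bt; apply: (cvg_comp _ expR); last exact: continuous_expR.
  by apply: cvgD; apply: cvgM => //; exact: cvg_cst.
split=> t /andP[t0 _].
  apply: cvg_wealth; first exact: cvg_within.
  move: t0; rewrite le_eqVlt => /predU1P[<-//|t0].
  by apply: cvg_within_filter; apply: cb; rewrite in_itv/= t0.
apply/cvg_ex; exists (limit_wealth mu sigma f b t).
apply: cvg_wealth; first exact: cvg_within.
by apply: cvg_within_filter; apply: cb; rewrite in_itv/= t0.
Qed.

Definition wealth_process (R : realType) (d : measure_display)
    (Omega : measurableType d) (P : probability Omega R) (T mu sigma f : R)
    (n : nat) (xi : nat -> {RV P >-> R}) (w : Omega) : skorokhod T :=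
  to_skorokhod (cadlag_wealth T mu sigma f n (fun k => xi k w)).

Definition limit_process (R : realType) (d : measure_display)
    (Omega : measurableType d) (P : probability Omega R) (T mu sigma f : R)
    (B : R -> {RV P >-> R}) (hB : brownian_motion B) (w : Omega) :
    skorokhod T :=
  to_skorokhod
    (cadlag_limit_wealth T mu sigma f (brownian_continuous hB w)).

(* Main.v *)
(* The logarithm of the wealth at time [t] is the sum of the [floor (n t)] first
   logarithmic returns [ln (1 + f r)], which are independent, of mean
   [(f mu - f^2 sigma^2 / 2) / n] and variance [f^2 sigma^2 / n] up to
   [O (n^(-3/2))], and have bounded exponential moments.

   It suffices to test the convergence on bounded Lipschitz functions [g] of the
   path. Cut [[0, T]] into [N] cells, freeze the path over each cell and cap it
   at the level [M + 1]. For fixed [M] and [N] the value of [g] on the resulting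
   path is a Lipschitz function of the [N] block sums of logarithmic returns;
   such a function is approximated by combinations of products of cubic splines,
   for which Lindeberg's replacement method, applied both to the returns and to
   the increments of the Brownian motion against one binomial walk, gives the
   limit. The error made by freezing and capping is controlled uniformly in [n]
   by the maximal inequality for the exponential supermartingale
   [exp (lambda S_k - k kappa)], with [N = (M + 1)^14] and [lambda = (M + 1)^7];
   on the side of the limit it vanishes as [M] grows by continuity of the
   Brownian paths. *)

Require Import Defs.
From mathcomp Require Import all_boot all_order all_algebra.
From mathcomp Require Import all_classical all_reals all_analysis.
From mathcomp Require Import measurable_realfun finmap ring lra zify.

Set Implicit Arguments.
Unset Strict Implicit.
Unset Printing Implicit Defensive.

Import Order.TTheory GRing.Theory Num.Theory.
Import numFieldNormedType.Exports.

Local Open Scope classical_set_scope.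
Local Open Scope ring_scope.

(** * Independent sequences *)

(** The returns and the Brownian motion live on unrelated probability spaces. The binomial walk
    enters only through the deterministic operator [binomial_step] acting on test functions, so both
    sides are compared with one real number and no common space has to be built. This dictates the
    test functions: they need explicit second-order expansions with a cubic remainder, and products
    of them allow the blocks to be peeled off one at a time. Capping makes the exponential
    Lipschitz, hence a Lipschitz function of the path becomes a Lipschitz function of the block
    sums. Tightness is not proved separately: the mass of the block sums far from the origin is
    measured by window functions which are themselves sums of splines, so its smallness is inherited
    from the limit. Paths are always compared uniformly, with the identity as time change. Finally,
    the bound on the variables [xi] holds only almost surely; clamping them makes the logarithmic
    returns bounded at every point for large [n], and the change on a null set is undone at the very
    end. *)

Section bounded_integrals.
Context d (Omega : measurableType d) (R : realType) (P : probability Omega R).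
Implicit Types U V : Omega -> R.

Lemma bounded_integrable U (M : R) : measurable_fun setT U ->
  (forall w, `|U w| <= M) -> P.-integrable setT (EFin \o U).
Proof.
move=> mU UM; apply: measurable_bounded_integrable => //.
  by rewrite (le_lt_trans (probability_le1 _ _))// ltry.
exists M; split; first exact: num_real.
by move=> N MN w _; exact: le_trans (UM w) (ltW MN).
Qed.

Lemma RintegralMl_integrable U V (M : R) : measurable_fun setT U ->
  (forall w, `|U w| <= M) -> P.-integrable setT (EFin \o V) ->
  P.-integrable setT (EFin \o (fun w => U w * V w)).
Proof.
move=> mU UM iV.
have : P.-integrable setT ((EFin \o U) \* (EFin \o V))%E.
  apply: integrableMr => //; exists M; split; first exact: num_real.
  by move=> N MN w _; exact: le_trans (UM w) (ltW MN).
by apply: eq_integrable.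
Qed.

Lemma Rintegral_probability_cst (r : R) : \int[P]_w r = r.
Proof. by rewrite Rintegral_cst//= probability_setT mulr1. Qed.

Lemma le_normr_Rintegral_bound U V : P.-integrable setT (EFin \o U) ->
  P.-integrable setT (EFin \o V) -> (forall w, `|U w| <= V w) ->
  `|\int[P]_w U w| <= \int[P]_w V w.
Proof.
move=> iU iV UV; apply: (le_trans (le_normr_Rintegral _ _)) => //.
apply: le_Rintegral => //.
exact: integrable_norm.
Qed.

(** Factorization on rectangles identifies the joint law with the product of the laws, by uniqueness
    of the product measure; Fubini's theorem then splits the integral. *)
Lemma RintegralM_indep U V (M : R) : measurable_fun setT U ->
    measurable_fun setT V -> (forall w, `|U w| <= M) ->
    P.-integrable setT (EFin \o V) ->
    (forall A B, measurable A -> measurable B ->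
      P ((U @^-1` A) `&` (V @^-1` B)) = (P (U @^-1` A) * P (V @^-1` B))%E) ->
  \int[P]_w (U w * V w) = (\int[P]_w U w) * \int[P]_w V w.
Proof.
move=> mU mV UM iV UV.
pose X : {RV P >-> R} := mfun_Sub (mem_set mU).
pose Y : {RV P >-> R} := mfun_Sub (mem_set mV).
have mXY : measurable_fun setT (fun w => (X w, Y w)).
  by apply/measurable_fun_pairP; split.
pose XY : {RV P >-> (R * R)%type} := mfun_Sub (mem_set mXY).
have mE A : measurable A ->
    (distribution P X \x distribution P Y)%E A = distribution P XY A.
  by move=> mA; exact: product_measure_unique.
have iUV := RintegralMl_integrable mU UM iV.
pose mul (z : R * R) : R := z.1 * z.2.
have mmul : measurable_fun setT (EFin \o mul).
  by apply/measurable_EFinP; apply: measurable_funM.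
have imul : (distribution P X \x distribution P Y)%E.-integrable setT (EFin \o mul).
  have : (distribution P XY).-integrable setT (EFin \o mul).
    by apply: integrable_pushforward.
  move=> /integrableP[m1 m2]; apply/integrableP; split => //.
  by rewrite (eq_measure_integral (distribution P XY))// => A mA _; exact: mE.
have iU := bounded_integrable mU UM.
have EX : (\int[P]_w (U w)%:E = \int[distribution P X]_x x%:E)%E.
  rewrite integral_distribution//; exact/measurable_EFinP.
have EY : (\int[P]_w (V w)%:E = \int[distribution P Y]_x x%:E)%E.
  rewrite integral_distribution//; exact/measurable_EFinP.
have fY : (\int[P]_w (V w)%:E)%E \is a fin_num by exact: integrable_fin_num.
have fX : (\int[P]_w (U w)%:E)%E \is a fin_num by exact: integrable_fin_num.
rewrite /Rintegral -fineM//; congr fine.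
transitivity (\int[distribution P XY]_z (mul z)%:E)%E.
  by rewrite integral_distribution.
rewrite (eq_measure_integral (distribution P X \x distribution P Y)%E);
  last by move=> A mA _; exact/esym/mE.
rewrite -integral12_prod_meas1//.
transitivity (\int[distribution P X]_x (x%:E * \int[P]_w (V w)%:E))%E.
  apply: eq_integral => x _; rewrite EY /fubini_F.
  under eq_integral do rewrite /= /mul/= EFinM.
  rewrite integralZl//.
  by apply: integrable_pushforward => //; exact/measurable_EFinP.
rewrite -(fineK fY) EX integralZr//.
by apply: integrable_pushforward => //; exact/measurable_EFinP.
Qed.

End bounded_integrals.

Section independent_sequences.
Context d (Omega : measurableType d) (R : realType) (P : probability Omega R).
Implicit Types (U V : Omega -> R) (X : nat -> Omega -> R).

(** Initial segments of indices suffice: any other finite set of indices is reached by taking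
    [A i = setT] at the remaining ones. *)
Definition indep_seq X : Prop :=
  (forall k, measurable_fun setT (X k)) /\
  forall n (A : nat -> set R), (forall i, measurable (A i)) ->
    P (\bigcap_(i in `I_n) X i @^-1` A i) =
    (\prod_(i < n) P (X i @^-1` A i))%E.

Definition cylinder X n (B : set Omega) : Prop :=
  exists2 A : nat -> set R, (forall i, measurable (A i)) &
    B = \bigcap_(i in `I_n) X i @^-1` A i.

(** The sigma-algebra of [X 0], ..., [X n.-1]: the coordinate [n] is excluded, so [X n] is
    independent of it. *)
Definition past X n : set (set Omega) := <<s cylinder X n >>.

Definition adapted X n U : Prop :=
  measurable_fun setT (U : g_sigma_algebraType (cylinder X n) -> R).

Lemma cylinderS X n : cylinder X n `<=` cylinder X n.+1.
Proof.
move=> _ [A mA ->]; exists (fun i => if (i < n)%N then A i else setT).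
  by move=> i; case: ifP.
apply/seteqP; split=> [w Aw i /= iin|w Aw i /= iin].
  by case: ifPn => // lt; exact: Aw.
by have := Aw i (leq_trans iin (leqnSn n)); rewrite /= iin.
Qed.

Lemma adapted_le X m n U : (m <= n)%N -> adapted X m U -> adapted X n U.
Proof.
move=> /subnKC <-; elim: (n - m)%N => [|k IH]; first by rewrite addn0.
move=> /IH; rewrite addnS => aU _ A mA; rewrite setTI.
have := aU measurableT A mA; rewrite setTI; exact: sub_sigma_algebra2 (@cylinderS X (m + k)) _.
Qed.

Lemma adapted_coord X n : adapted X n.+1 (X n).
Proof.
move=> _ A mA; rewrite setTI; apply: sub_sigma_algebra.
exists (fun i => if i == n then A else setT) => [i|]; first by case: ifP.
apply/seteqP; split=> [w Aw i /= iin|w /(_ n (ltnSn n))]; last by rewrite /= eqxx.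
by case: ifPn => // /eqP ->.
Qed.

Lemma past_measurable X n : indep_seq X -> past X n `<=` measurable.
Proof.
move=> [mX _]; apply: smallest_sub; first exact: sigma_algebra_measurable.
move=> _ [A mA ->]; apply: bigcap_measurableType => // k _.
by rewrite -[X in measurable X]setTI; exact: mX.
Qed.

Lemma adapted_measurable X n U : indep_seq X -> adapted X n U ->
  measurable_fun setT U.
Proof. by move=> iX aU _ A mA; exact: (past_measurable iX) (aU _ _ mA). Qed.

(** As functions of [B], both sides are finite measures. They agree on cylinders, which are stable
    under intersection and generate the past. *)
Lemma past_indep X n B C : indep_seq X -> past X n B -> measurable C ->
  P (B `&` (X n @^-1` C)) = (P B * P (X n @^-1` C))%E.
Proof.
move=> iX pB mC; have [mX pX] := iX.
have mF : measurable (X n @^-1` C).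
  by rewrite -[X in measurable X]setTI; exact: mX.
have fF : P (X n @^-1` C) \is a fin_num by exact: fin_num_measure.
have F0 : 0 <= fine (P (X n @^-1` C)) by rewrite fine_ge0.
pose m1 := mrestr P mF.
pose m2 := mscale (NngNum F0) P.
suff : m1 B = m2 B by rewrite /m1 /m2 /mrestr /mscale/= fineK// muleC.
apply: (g_sigma_algebra_measure_unique (cylinder X n) _ (fun=> setT)) pB.
- by move=> A cA; apply: (@past_measurable X n iX); exact: sub_sigma_algebra.
- move=> _; exists (fun=> setT) => //; apply/seteqP; split => // w _ i _ //.
- by apply/seteqP; split => // w _; exists 0%N.
- move=> _ _ [A mA ->] [A' mA' ->]; exists (fun i => A i `&` A' i).
    by move=> i; exact: measurableI.
  apply/seteqP; split=> [w [Aw A'w] i iin|w AAw].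
    by split; [exact: Aw|exact: A'w].
  by split=> i iin; have [] := AAw i iin.
- move=> _ [A mA ->]; rewrite /= /mrestr /mscale/= fineK//.
  pose A' i := if i == n then C else A i.
  have -> : \bigcap_(i in `I_n) X i @^-1` A i `&` X n @^-1` C =
      \bigcap_(i in `I_n.+1) X i @^-1` A' i.
    apply/seteqP; split=> [w [Aw Cw] i /=|w Aw].
      rewrite ltnS leq_eqVlt /A' => /orP[/eqP ->|iin]; first by rewrite eqxx.
      by rewrite (ltn_eqF iin); exact: Aw.
    split=> [i /= iin|].
      by have := Aw i (leq_trans iin (leqnSn n)); rewrite /A' /= (ltn_eqF iin).
    by have := Aw n (ltnSn n); rewrite /A' /= eqxx.
  rewrite !pX//; last by rewrite /A' => i; case: ifP.
  rewrite big_ord_recr/= /A' eqxx muleC; congr (_ * _)%E.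
  by apply: eq_bigr => i _; rewrite (ltn_eqF (ltn_ord i)).
- by move=> _; rewrite /= /mrestr setTI (le_lt_trans (probability_le1 _ _))// ltry.
Qed.

(** The form in which independence enters both the replacement method and the maximal inequality: a
    bounded function of the past times a function of the next variable. *)
Lemma Rintegral_adaptedM X n U (psi : R -> R) (M : R) : indep_seq X ->
    adapted X n U -> (forall w, `|U w| <= M) ->
    measurable_fun setT psi -> P.-integrable setT (EFin \o (psi \o X n)) ->
  \int[P]_w (U w * psi (X n w)) = (\int[P]_w U w) * \int[P]_w psi (X n w).
Proof.
move=> iX aU UM mpsi ipsi; have [mX _] := iX.
have mpX : measurable_fun setT (psi \o X n) by exact: measurableT_comp.
apply: (RintegralM_indep _ mpX UM ipsi); first exact: adapted_measurable iX aU.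
move=> A B mA mB; rewrite comp_preimage past_indep//.
  by have := aU measurableT A mA; rewrite setTI.
by rewrite -[X in measurable X]setTI; exact: mpsi.
Qed.

Lemma indep_seq_comp X (psi : R -> R) : measurable_fun setT psi ->
  indep_seq X -> indep_seq (fun k => psi \o X k).
Proof.
move=> mpsi [mX pX]; split=> [k|n A mA]; first exact: measurableT_comp.
have := pX n (fun i => psi @^-1` A i); apply => i.
by rewrite -[X in measurable X]setTI; exact: mpsi.
Qed.

(** The reindexing [e] is the successor for the returns, numbered from 1, and the identity for the
    Brownian increments. *)
Lemma independent_RVs_indep_seq X (I : set nat) (e : nat -> nat) :
    injective e -> (forall k, I (e k)) -> (forall k, measurable_fun setT (X k)) ->
  independent_RVs P I X -> indep_seq (fun k => X (e k)).
Proof.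
move=> einj Ie mX iX; split=> // n A mA.
pose J : {fset nat} := [fset e (val i) | i in 'I_n]%fset.
pose A' m := if [pick i : 'I_n | e i == m] is Some i then A i else setT.
have A'e (i : 'I_n) : A' (e i) = A i.
  rewrite /A'; case: pickP => [j /eqP /einj /val_inj -> //|/(_ i)].
  by rewrite eqxx.
have mA' m : measurable (A' m) by rewrite /A'; case: pickP.
have JE m : reflect (exists i : 'I_n, m = e i) (m \in J).
  apply: (iffP (imfsetP _ _ _ _)) => /= [[i _ ->]|[i ->]]; first by exists i.
  by exists i.
have := iX J _ A' mA'.
have -> : \bigcap_(i in [set` J]) X i @^-1` A' i =
    \bigcap_(i in `I_n) X (e i) @^-1` A i.
  apply/seteqP; split=> [w Aw i /= iin|w Aw m /= /JE[i ->]].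
    have := Aw (e i); rewrite /= (A'e (Ordinal iin)); apply.
    by apply/JE; exists (Ordinal iin).
  by rewrite A'e; exact: (Aw i (ltn_ord i)).
move=> ->; last by move=> m /JE[i ->].
rewrite big_imfset/=; last by move=> i j _ _ /einj /val_inj.
by rewrite big_enum/=; apply: eq_bigr => i _; rewrite A'e.
Qed.

End independent_sequences.

(** * Lindeberg's replacement method *)

Section integrable_arithmetic.
Context d (Omega : measurableType d) (R : realType) (P : probability Omega R).
Implicit Types U V X : Omega -> R.

Lemma integrable_EFinD U V : P.-integrable setT (EFin \o U) ->
  P.-integrable setT (EFin \o V) ->
  P.-integrable setT (EFin \o (fun w => U w + V w)).
Proof. by move=> iU iV; have := integrableD measurableT iU iV; apply: eq_integrable. Qed.

Lemma integrable_EFinB U V : P.-integrable setT (EFin \o U) ->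
  P.-integrable setT (EFin \o V) ->
  P.-integrable setT (EFin \o (fun w => U w - V w)).
Proof. by move=> iU iV; have := integrableB measurableT iU iV; apply: eq_integrable. Qed.

Lemma integrable_EFinZ (r : R) U : P.-integrable setT (EFin \o U) ->
  P.-integrable setT (EFin \o (fun w => r * U w)).
Proof. by move=> iU; have := integrableZl measurableT r iU; apply: eq_integrable. Qed.

Lemma integrable_EFin_cst (r : R) : P.-integrable setT (EFin \o (fun=> r)).
Proof. by apply: (@bounded_integrable _ _ _ _ _ (`|r|)). Qed.

Lemma integrable_dominated U V : measurable_fun setT U ->
  (forall w, `|U w| <= V w) -> P.-integrable setT (EFin \o V) ->
  P.-integrable setT (EFin \o U).
Proof.
move=> mU UV; apply: le_integrable => //; first exact/measurable_EFinP.
by move=> w _; rewrite /= lee_fin (le_trans (UV w))// ler_norm.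
Qed.

Lemma integrable_comp_cube X (psi : R -> R) (C : R) : measurable_fun setT X ->
  measurable_fun setT psi -> (forall x, `|psi x| <= C * (1 + `|x| ^+ 3)) ->
  P.-integrable setT (EFin \o (fun w => `|X w| ^+ 3)) ->
  P.-integrable setT (EFin \o (psi \o X)).
Proof.
move=> mX mpsi psiC i3; apply: (integrable_dominated _ (fun w => psiC (X w))).
  exact: measurableT_comp.
apply: integrable_EFinZ; apply: integrable_EFinD => //.
exact: integrable_EFin_cst.
Qed.

End integrable_arithmetic.

Section lindeberg.
Context (R : realType).
Implicit Types (b p q : R -> R) (c s K : R).

(** [p] and [q] stand for the first two derivatives of [b], but only the expansion with cubic
    remainder is asked, not differentiability. A single [K] bounds everything. *)
Record taylor3 b p q K : Prop := Taylor3 {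
  taylor3_measurable : [/\ measurable_fun setT b, measurable_fun setT p &
    measurable_fun setT q] ;
  taylor3_le1 : forall x, `|b x| <= 1 ;
  taylor3_bound1 : forall x, `|p x| <= K ;
  taylor3_bound2 : forall x, `|q x| <= K ;
  taylor3_expansion : forall x y,
    `|b (x + y) - b x - p x * y - q x * (y ^+ 2 / 2)| <= K * `|y| ^+ 3 }.

(* One step of the random walk with the two equiprobable increments [c + s] and
   [c - s], whose mean is [c] and whose variance is [s ^+ 2]. *)
Definition binomial_step c s b x : R := (b (x + (c + s)) + b (x + (c - s))) / 2.

Lemma normr_div2 (x : R) : `|x / 2| = `|x| / 2.
Proof. by rewrite normrM (@ger0_norm _ 2^-1). Qed.

Lemma binomial_step_bound c s b K : (forall x, `|b x| <= K) ->
  forall x, `|binomial_step c s b x| <= K.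
Proof.
move=> bK x; rewrite /binomial_step normr_div2 ler_pdivrMr// (le_trans (ler_normD _ _))//.
by have := bK (x + (c + s)); have := bK (x + (c - s)); lra.
Qed.

Lemma measurable_binomial_step c s b : measurable_fun setT b ->
  measurable_fun setT (binomial_step c s b).
Proof.
move=> mb; apply: measurable_funM => //; apply: measurable_funD.
  by apply: measurableT_comp => //; exact: measurable_funD.
by apply: measurableT_comp => //; exact: measurable_funD.
Qed.

(** The conditions are invariant under translation and convex in the triple, so averaging two
    translates keeps the same [K], however many times it is iterated. *)
Lemma taylor3_binomial_step c s b p q K : taylor3 b p q K ->
  taylor3 (binomial_step c s b) (binomial_step c s p) (binomial_step c s q) K.
Proof.
move=> [[mb mp mq] b1 pK qK bpq]; split.
- by split; exact: measurable_binomial_step.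
- exact: binomial_step_bound.
- exact: binomial_step_bound.
- exact: binomial_step_bound.
- move=> x y; rewrite /binomial_step.
  have := bpq (x + (c + s)) y; have := bpq (x + (c - s)) y.
  rewrite ![x + _ + y]addrAC => h1 h2.
  set E1 := (X in `|X| <= _) in h1; set E2 := (X in `|X| <= _) in h2.
  rewrite (_ : (_ - _) = (E1 + E2) / 2); last by rewrite /E1 /E2; field.
  rewrite normr_div2 ler_pdivrMr//.
  by rewrite (le_trans (ler_normD _ _))//; lra.
Qed.

(** Averaging the expansions at the increments [c + s] and [c - s] leaves their mean [c] and their
    second moment [c ^+ 2 + s ^+ 2]. *)
Lemma taylor3_binomial_remainder c s b p q K : taylor3 b p q K -> forall x,
  `|binomial_step c s b x - b x - p x * c - q x * ((c ^+ 2 + s ^+ 2) / 2)| <=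
  K * (`|c| + `|s|) ^+ 3.
Proof.
move=> [_ _ pK _ bpq] x.
have K0 : 0 <= K by rewrite (le_trans _ (pK 0)).
have h1 : `|b (x + (c + s)) - b x - p x * (c + s) - q x * ((c + s) ^+ 2 / 2)| <=
    K * (`|c| + `|s|) ^+ 3.
  apply: (le_trans (bpq _ _)); rewrite ler_wpM2l// lerXn2r ?nnegrE ?addr_ge0//.
  exact: ler_normD.
have h2 : `|b (x + (c - s)) - b x - p x * (c - s) - q x * ((c - s) ^+ 2 / 2)| <=
    K * (`|c| + `|s|) ^+ 3.
  apply: (le_trans (bpq _ _)); rewrite ler_wpM2l// lerXn2r ?nnegrE ?addr_ge0//.
  exact: ler_normB.
set E1 := (X in `|X| <= _) in h1; set E2 := (X in `|X| <= _) in h2.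
rewrite (_ : (_ - _) = (E1 + E2) / 2); last first.
  by rewrite /E1 /E2 /binomial_step; field.
rewrite normr_div2 ler_pdivrMr//.
by rewrite (le_trans (ler_normD _ _))//; lra.
Qed.

Context d (Omega : measurableType d) (P : probability Omega R).
Implicit Types (X : nat -> Omega -> R) (G : Omega -> R).

Definition third_moments X : Prop :=
  forall k, P.-integrable setT (EFin \o (fun w => `|X k w| ^+ 3)).

(** The cost of replacing [X k] by a binomial increment: the gaps between the first moments and
    between the halved second moments, plus one bound on each third absolute moment. *)
Definition moment_error X k c s : R :=
  `|\int[P]_w X k w - c| + `|\int[P]_w (X k w ^+ 2) - (c ^+ 2 + s ^+ 2)| / 2 +
  \int[P]_w (`|X k w| ^+ 3) + (`|c| + `|s|) ^+ 3.

Definition block_sum X a l (w : Omega) : R := \sum_(a <= k < a + l) X k w.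

Lemma block_sumS X a l w :
  block_sum X a l.+1 w = block_sum X a l w + X (a + l)%N w.
Proof. by rewrite /block_sum addnS big_nat_recr ?leq_addr. Qed.

Lemma adapted_block_sum X a l : adapted X (a + l) (block_sum X a l).
Proof.
elim: l => [|l IH].
  rewrite (_ : block_sum X a 0 = cst 0); first exact: measurable_cst.
  by apply/funext => w; rewrite /block_sum addn0 big_geq.
rewrite (_ : block_sum X a l.+1 = block_sum X a l \+ X (a + l)%N); last first.
  by apply/funext => w; rewrite block_sumS.
rewrite addnS; apply: measurable_funD; last exact: adapted_coord.
by apply: adapted_le IH; rewrite leqnSn.
Qed.

(** Expanding both terms around [U], the orders one and two differ by [p (U) * (X n - c)] and
    [q (U)] times half the gap of the squares. Both factor by independence, [G] and [U] being
    functions of the past; the cubic remainders are bounded pointwise. *)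
Lemma lindeberg_step X n G U b p q K c s : indep_seq P X -> third_moments X ->
    adapted X n G -> adapted X n U -> (forall w, `|G w| <= 1) ->
    taylor3 b p q K ->
  `|\int[P]_w (G w * b (U w + X n w)) -
    \int[P]_w (G w * binomial_step c s b (U w))| <= K * moment_error X n c s.
Proof.
move=> iX X3 aG aU G1 T3; have [[mb mp mq] b1 pK qK bpq] := T3.
have K0 : 0 <= K by rewrite (le_trans _ (pK 0)).
have mG := adapted_measurable iX aG; have mU := adapted_measurable iX aU.
have mX := iX.1 n.
have mabs3 : measurable_fun setT (fun x : R => `|x| ^+ 3).
  by apply: measurable_funX; exact: normr_measurable.
have cube_ge0 x : 0 <= `|x : R| ^+ 3 by rewrite exprn_ge0.
have le_cube (x : R) : `|x| <= 1 + `|x| ^+ 3.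
  have := normr_ge0 x; set t := `|x| => t0.
  by have [t1|t1] := leP t 1; nra.
have sqr_le_cube (x : R) : x ^+ 2 <= 1 + `|x| ^+ 3.
  rewrite -[x ^+ 2]real_normK ?num_real//.
  have := normr_ge0 x; set t := `|x| => t0.
  by have [t1|t1] := leP t 1; nra.
have iX1 : P.-integrable setT (EFin \o X n).
  by apply: (@integrable_comp_cube _ _ _ _ _ id 1) => // x; rewrite mul1r.
have iX2 : P.-integrable setT (EFin \o (fun w => X n w ^+ 2)).
  apply: (@integrable_comp_cube _ _ _ _ _ (fun x => x ^+ 2) 1) => // x.
  by rewrite mul1r ger0_norm ?sqr_ge0.
have bGM (h : R -> R) (M : R) : (forall x, `|h x| <= M) ->
    forall w, `|G w * h (U w)| <= M.
  move=> hM w; rewrite normrM (le_trans _ (hM (U w)))//.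
  by rewrite ler_piMl.
have aGM (h : R -> R) : measurable_fun setT h ->
    adapted X n (fun w => G w * h (U w)).
  by move=> mh; apply: measurable_funM => //; exact: measurableT_comp.
set psi1 := fun x : R => x - c.
set psi2 := fun x : R => (x ^+ 2 - (c ^+ 2 + s ^+ 2)) / 2.
have ipsi1 : P.-integrable setT (EFin \o (psi1 \o X n)).
  by apply: integrable_EFinB => //; exact: integrable_EFin_cst.
have ipsi2 : P.-integrable setT (EFin \o (psi2 \o X n)).
  have : P.-integrable setT (EFin \o
      (fun w => 2^-1 * (X n w ^+ 2 - (c ^+ 2 + s ^+ 2)))).
    apply: integrable_EFinZ; apply: integrable_EFinB => //.
    exact: integrable_EFin_cst.
  by apply: eq_integrable => // w _; rewrite /psi2 /= mulrC.
have E1 : \int[P]_w (G w * p (U w) * psi1 (X n w)) =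
    (\int[P]_w (G w * p (U w))) * (\int[P]_w (X n w) - c).
  rewrite (Rintegral_adaptedM iX (aGM p mp) (bGM p K pK))//; last first.
    exact: measurable_funB.
  by rewrite /psi1 RintegralB// ?Rintegral_probability_cst//;
    exact: integrable_EFin_cst.
have E2 : \int[P]_w (G w * q (U w) * psi2 (X n w)) =
    (\int[P]_w (G w * q (U w))) *
    ((\int[P]_w (X n w ^+ 2) - (c ^+ 2 + s ^+ 2)) / 2).
  rewrite (Rintegral_adaptedM iX (aGM q mq) (bGM q K qK))//; last first.
    by apply: measurable_funM => //; exact: measurable_funB.
  rewrite /psi2 RintegralZr//; last first.
    by apply: integrable_EFinB => //; exact: integrable_EFin_cst.
  by rewrite RintegralB// ?Rintegral_probability_cst//;
    exact: integrable_EFin_cst.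
have iB1 : P.-integrable setT (EFin \o (fun w => G w * b (U w + X n w))).
  apply: (@bounded_integrable _ _ _ _ _ 1).
    apply: measurable_funM => //; apply: measurableT_comp => //.
    exact: measurable_funD.
  by move=> w; rewrite normrM mulr_ile1.
have mbs := measurable_binomial_step c s mb.
have bs1 := binomial_step_bound c s b1.
have iB2 : P.-integrable setT
    (EFin \o (fun w => G w * binomial_step c s b (U w))).
  apply: (@bounded_integrable _ _ _ _ _ 1); last exact: bGM.
  exact: adapted_measurable iX (aGM _ mbs).
have iG1 : P.-integrable setT
    (EFin \o (fun w => G w * p (U w) * psi1 (X n w))).
  apply: (RintegralMl_integrable _ (bGM p K pK)) => //.
  exact: adapted_measurable iX (aGM _ mp).
have iG2 : P.-integrable setT
    (EFin \o (fun w => G w * q (U w) * psi2 (X n w))).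
  apply: (RintegralMl_integrable _ (bGM q K qK)) => //.
  exact: adapted_measurable iX (aGM _ mq).
(* What is left after removing the orders one and two: [G] times a difference of two Taylor
   remainders. *)
pose D w := G w * b (U w + X n w) - G w * binomial_step c s b (U w) -
  G w * p (U w) * psi1 (X n w) - G w * q (U w) * psi2 (X n w).
have ED : \int[P]_w D w = \int[P]_w (G w * b (U w + X n w)) -
    \int[P]_w (G w * binomial_step c s b (U w)) -
    (\int[P]_w (G w * p (U w))) * (\int[P]_w (X n w) - c) -
    (\int[P]_w (G w * q (U w))) *
    ((\int[P]_w (X n w ^+ 2) - (c ^+ 2 + s ^+ 2)) / 2).
  by rewrite -E1 -E2 -!RintegralB//; do ?apply: integrable_EFinB.
have DK : `|\int[P]_w D w| <=
    K * (\int[P]_w (`|X n w| ^+ 3) + (`|c| + `|s|) ^+ 3).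
  rewrite -[X in _ + X](Rintegral_probability_cst P) -RintegralD//; last first.
    exact: integrable_EFin_cst.
  have iD3 : P.-integrable setT (EFin \o
      (fun w => `|X n w| ^+ 3 + (`|c| + `|s|) ^+ 3)).
    by apply: integrable_EFinD => //; exact: integrable_EFin_cst.
  rewrite -RintegralZl//; apply: le_normr_Rintegral_bound => //.
  - by do ?apply: integrable_EFinB.
  - exact: integrable_EFinZ.
  move=> w; rewrite mulrDr.
  have h1 := bpq (U w) (X n w); have h2 := taylor3_binomial_remainder c s T3 (U w).
  set e1 := (X in `|X| <= _) in h1; set e2 := (X in `|X| <= _) in h2.
  rewrite (_ : D w = G w * (e1 - e2)); last first.
    by rewrite /D /e1 /e2 /psi1 /psi2; field.
  rewrite normrM (le_trans (ler_piMl _ (G1 w)))//.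
  by rewrite (le_trans (ler_normB _ _))// lerD.
have bE (h : R -> R) (r : R) : (forall x, `|h x| <= K) -> measurable_fun setT h ->
    `|(\int[P]_w (G w * h (U w))) * r| <= K * `|r|.
  move=> hK mh; rewrite normrM ler_wpM2r// -[leRHS](Rintegral_probability_cst P).
  apply: le_normr_Rintegral_bound; last exact: bGM.
    apply: (@bounded_integrable _ _ _ _ _ K); last exact: bGM.
    exact: adapted_measurable iX (aGM _ mh).
  exact: integrable_EFin_cst.
have := bE p (\int[P]_w (X n w) - c) pK mp.
have := bE q ((\int[P]_w (X n w ^+ 2) - (c ^+ 2 + s ^+ 2)) / 2) qK mq.
rewrite normr_div2.
move: ED DK; rewrite /moment_error.
set e0 := \int[P]_w D w; set e1 := \int[P]_w (G w * b _).
set e2 := \int[P]_w (G w * _ ); set e3 := _ * (_ - c); set e4 := _ * (_ / 2).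
move=> ED DK h2 h1.
rewrite (_ : e1 - e2 = e0 + e3 + e4); last by rewrite ED; ring.
rewrite (le_trans (ler_normD _ _))// (le_trans (lerD (ler_normD _ _) (lexx _)))//.
by move: DK h1 h2; rewrite !mulrDr; lra.
Qed.

(** The last variable of the block is replaced, which turns [b] into [binomial_step c s b]; the
    induction hypothesis applies to that function with the same [K]. *)
Lemma lindeberg X (a l : nat) G b p q K c s e x : indep_seq P X ->
    third_moments X -> (forall k, moment_error X k c s <= e) ->
    adapted X a G -> (forall w, `|G w| <= 1) -> taylor3 b p q K ->
  `|\int[P]_w (G w * b (x + block_sum X a l w)) -
    (\int[P]_w G w) * iter l (binomial_step c s) b x| <= l%:R * (K * e).
Proof.
move=> iX X3 Xe aG G1; elim: l b p q => [|l IH] b p q T3.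
  rewrite mul0r -RintegralZr//; last first.
    by apply: bounded_integrable G1; exact: adapted_measurable iX aG.
  under eq_Rintegral do rewrite /block_sum addn0 big_geq// addr0.
  by rewrite subrr normr0.
have K0 : 0 <= K by have [_ _ pK _ _] := T3; rewrite (le_trans _ (pK 0)).
have := IH _ _ _ (taylor3_binomial_step c s T3).
have aGl : adapted X (a + l) G by apply: adapted_le aG; rewrite leq_addr.
have aU : adapted X (a + l) (fun w => x + block_sum X a l w).
  by apply: measurable_funD => //; exact: adapted_block_sum.
have := lindeberg_step c s iX X3 aGl aU G1 T3.
have -> : \int[P]_w (G w * b (x + block_sum X a l.+1 w)) =
    \int[P]_w (G w * b (x + block_sum X a l w + X (a + l)%N w)).
  by apply: eq_Rintegral => w _; rewrite block_sumS addrA.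
rewrite iterSr -natr1 mulrDl mul1r => h1 h2.
rewrite (le_trans (ler_distD (\int[P]_w (G w *
  binomial_step c s b (x + block_sum X a l w))) _ _))// addrC lerD//.
by rewrite (le_trans h1)// ler_wpM2l.
Qed.

(** Blocks are peeled from the last one, the product of the earlier factors serving as the past
    weight [G]. The comparison term does not involve [P], so two sequences on different spaces can
    share it. *)
Lemma lindeberg_blocks X (N l : nat) (b p q : nat -> R -> R) K c s e :
    indep_seq P X -> third_moments X -> (forall k, moment_error X k c s <= e) ->
    (forall j, taylor3 (b j) (p j) (q j) K) ->
  `|\int[P]_w (\prod_(j < N) b j (block_sum X (j * l) l w)) -
    \prod_(j < N) iter l (binomial_step c s) (b j) 0| <= (N * l)%:R * (K * e).
Proof.
move=> iX X3 Xe T3.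
pose G n w := \prod_(j < n) b j (block_sum X (j * l) l w).
have aG n : adapted X (n * l) (G n).
  elim: n => [|n IH].
    rewrite (_ : G 0%N = cst 1); first exact: measurable_cst.
    by apply/funext => w; rewrite /G big_ord0.
  rewrite (_ : G n.+1 = G n \* (b n \o block_sum X (n * l) l)); last first.
    by apply/funext => w; rewrite /G big_ord_recr.
  have [mb _ _] := taylor3_measurable (T3 n).
  apply: measurable_funM; first by apply: adapted_le IH; rewrite leq_mul2r leqnSn orbT.
  rewrite mulSn addnC; apply: measurableT_comp => //.
  exact: adapted_block_sum.
have G1 n w : `|G n w| <= 1.
  rewrite /G normr_prod; apply: prodr_ile1 => i _.
  by rewrite normr_ge0/= (taylor3_le1 (T3 i)).
have it1 j m : forall x, `|iter m (binomial_step c s) (b j) x| <= 1.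
  elim: m => [|m IH] x /=; first exact: taylor3_le1 (T3 j) _.
  exact: binomial_step_bound.
elim: N => [|N IH].
  by rewrite big_ord0 mul0n mul0r; under eq_Rintegral do rewrite big_ord0;
    rewrite Rintegral_probability_cst subrr normr0.
under eq_Rintegral do rewrite big_ord_recr/=.
rewrite big_ord_recr/= mulSn natrD mulrDl.
have := lindeberg l 0 iX X3 Xe (aG N) (G1 N) (T3 N).
under eq_Rintegral do rewrite add0r.
rewrite -/(G N) => h.
rewrite (le_trans (ler_distD ((\int[P]_w G N w) *
  iter l (binomial_step c s) (b N) 0) _ _))// lerD//.
rewrite -mulrBl normrM (le_trans (ler_piMr _ (it1 N l 0)))//.
Qed.

End lindeberg.

(** * Smooth partitions of unity *)

Section spline.
Context {R : realType}.
Implicit Types x y : R.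

Definition pospart x : R := Num.max x 0.

Lemma pospart_ge0 x : 0 <= pospart x.
Proof. by rewrite /pospart le_max lexx orbT. Qed.

Lemma pospart_eq0 x : x <= 0 -> pospart x = 0.
Proof. by move=> x0; rewrite /pospart max_r. Qed.

Lemma pospart_id x : 0 <= x -> pospart x = x.
Proof. by move=> x0; rewrite /pospart max_l. Qed.

Lemma measurable_pospart : measurable_fun setT (@pospart).
Proof. by apply: measurable_maxr => //; exact: measurable_cst. Qed.

(** The second derivative [6 * pospart x] of the cube is Lipschitz with constant 6, which yields a
    remainder constant 6 / 3! = 1. The proof is a case analysis on the signs of [x] and [x + y]. *)
Lemma pospart_taylor x y :
  `|pospart (x + y) ^+ 3 - pospart x ^+ 3 - 3 * pospart x ^+ 2 * y -
    6 * pospart x * (y ^+ 2 / 2)| <= `|y| ^+ 3.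
Proof.
rewrite -normrX; set u := pospart (x + y); set v := pospart x.
have [x0|x0] := leP 0 x; have [xy0|xy0] := leP 0 (x + y).
- rewrite /u /v !pospart_id//; rewrite le_eqVlt; apply/orP; left; apply/eqP.
  by congr (`|_|); field.
- rewrite /u /v (pospart_eq0 (ltW xy0)) pospart_id//.
  have y0 : y <= 0 by lra.
  rewrite [leRHS]ler0_norm; last by rewrite exprS mulr_le0_ge0 ?sqr_ge0.
  rewrite (_ : _ - _ = y ^+ 3 - (x + y) ^+ 3); last by field.
  have h1 : (x + y) ^+ 3 <= 0 by rewrite exprS mulr_le0_ge0 ?sqr_ge0 ?ltW.
  have h2 : y ^+ 3 <= (x + y) ^+ 3.
    rewrite -subr_ge0 (_ : _ - _ = x * ((x + y) ^+ 2 + (x + y) * y + y ^+ 2)); last by ring.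
    by rewrite mulr_ge0// !addr_ge0 ?sqr_ge0//; nra.
  by rewrite ler0_norm; lra.
- rewrite /u /v (pospart_eq0 (ltW x0)) pospart_id//.
  have y0 : 0 <= y by lra.
  rewrite !expr0n/= !mulr0 !mul0r !subr0 !ger0_norm ?exprn_ge0//.
  by rewrite lerXn2r ?nnegrE//; lra.
- rewrite /u /v (pospart_eq0 (ltW x0)) (pospart_eq0 (ltW xy0)).
  by rewrite !expr0n/= !mulr0 !mul0r !subr0 normr0.
Qed.

(* The distribution function of the sum of three independent uniform variables
   on [[0, 1]], followed by its first two derivatives. *)
Definition smooth_step x : R := (pospart x ^+ 3 - 3 * pospart (x - 1) ^+ 3 +
  3 * pospart (x - 2) ^+ 3 - pospart (x - 3) ^+ 3) / 6.

Definition smooth_step1 x : R := (pospart x ^+ 2 - 3 * pospart (x - 1) ^+ 2 +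
  3 * pospart (x - 2) ^+ 2 - pospart (x - 3) ^+ 2) / 2.

Definition smooth_step2 x : R := pospart x - 3 * pospart (x - 1) +
  3 * pospart (x - 2) - pospart (x - 3).

(** The coefficients 1, 3, 3, 1 give the constant 8 / 6, rounded up to 2. *)
Lemma smooth_step_taylor x y : `|smooth_step (x + y) - smooth_step x -
  smooth_step1 x * y - smooth_step2 x * (y ^+ 2 / 2)| <= 2 * `|y| ^+ 3.
Proof.
have h0 := pospart_taylor x y; have h1 := pospart_taylor (x - 1) y.
have h2 := pospart_taylor (x - 2) y; have h3 := pospart_taylor (x - 3) y.
set e0 := (X in `|X| <= _) in h0; set e1 := (X in `|X| <= _) in h1.
set e2 := (X in `|X| <= _) in h2; set e3 := (X in `|X| <= _) in h3.
rewrite (_ : _ - _ = (e0 - 3 * e1 + 3 * e2 - e3) / 6); last first.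
  rewrite /e0 /e1 /e2 /e3 /smooth_step /smooth_step1 /smooth_step2.
  by rewrite -![x + y - _]addrAC; field.
move: h0 h1 h2 h3; rewrite !ler_norml; move: (`|y| ^+ 3) => t.
by move=> /andP[? ?] /andP[? ?] /andP[? ?] /andP[? ?]; apply/andP; split; lra.
Qed.

Lemma smooth_step_eq0 x : x <= 0 -> smooth_step x = 0.
Proof.
move=> x0; rewrite /smooth_step !pospart_eq0 ?expr0n/=; last 4 first.
- by lra.
- by lra.
- by lra.
- by lra.
by field.
Qed.

Lemma smooth_step_eq1 x : 3 <= x -> smooth_step x = 1.
Proof.
move=> x3; rewrite /smooth_step !pospart_id; last 4 first.
- by lra.
- by lra.
- by lra.
- by lra.
by field.
Qed.

(** The polynomial pieces of the step and of its unit translate together. Beyond 3 the translate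
    stays unevaluated, since the bound by 1 is enough there. *)
Variant smooth_step_spec x : R -> R -> Set :=
| SmoothStep0 of x <= 0 : smooth_step_spec x 0 0
| SmoothStep1 of 0 <= x <= 1 : smooth_step_spec x (x ^+ 3 / 6) 0
| SmoothStep2 of 1 <= x <= 2 : smooth_step_spec x
    ((x ^+ 3 - 3 * (x - 1) ^+ 3) / 6) ((x - 1) ^+ 3 / 6)
| SmoothStep3 of 2 <= x <= 3 : smooth_step_spec x
    (1 - (3 - x) ^+ 3 / 6) (((x - 1) ^+ 3 - 3 * (x - 2) ^+ 3) / 6)
| SmoothStep4 of 3 <= x : smooth_step_spec x 1 (smooth_step (x - 1)).

Lemma smooth_stepP x :
  smooth_step_spec x (smooth_step x) (smooth_step (x - 1)).
Proof.
have e2 : x - 1 - 1 = x - 2 by ring.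
have e3 : x - 1 - 2 = x - 3 by ring.
have e4 : x - 1 - 3 = x - 4 by ring.
have [x0|x0] := leP x 0.
  rewrite !smooth_step_eq0//; last by lra.
  by constructor.
have [x1|x1] := leP x 1.
  rewrite (@smooth_step_eq0 (x - 1)); last by lra.
  rewrite /smooth_step (pospart_id (ltW x0)) !pospart_eq0; do ?by lra.
  rewrite (_ : _ / 6 = x ^+ 3 / 6); last by field.
  by constructor; rewrite x1 ltW.
have [x2|x2] := leP x 2.
  rewrite /smooth_step e2 e3 e4 (pospart_id (ltW x0)) (@pospart_id (x - 1)); last by lra.
  rewrite !(@pospart_eq0 (x - 2)) ?(@pospart_eq0 (x - 3)) ?(@pospart_eq0 (x - 4)); do ?by lra.
  rewrite (_ : _ / 6 = (x ^+ 3 - 3 * (x - 1) ^+ 3) / 6); last by field.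
  rewrite (_ : (_ - 3 * 0 ^+ 3 + _ - _) / 6 = (x - 1) ^+ 3 / 6); last by field.
  by constructor; rewrite x2 ltW.
have [x3|x3] := leP x 3.
  rewrite /smooth_step e2 e3 e4 (pospart_id (ltW x0)) (@pospart_id (x - 1)); last by lra.
  rewrite (@pospart_id (x - 2)) ?(@pospart_eq0 (x - 3)) ?(@pospart_eq0 (x - 4)); do ?by lra.
  rewrite (_ : _ / 6 = 1 - (3 - x) ^+ 3 / 6); last by field.
  rewrite (_ : (_ + 3 * 0 ^+ 3 - _) / 6 =
    ((x - 1) ^+ 3 - 3 * (x - 2) ^+ 3) / 6); last by field.
  by constructor; rewrite x3 ltW.
by rewrite (smooth_step_eq1 (ltW x3)); constructor; exact: ltW.
Qed.

Lemma smooth_step_ge0 x : 0 <= smooth_step x.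
Proof.
case: smooth_stepP => // [/andP[? ?]|/andP[? ?]|/andP[? ?]].
- by rewrite divr_ge0// exprn_ge0.
- rewrite divr_ge0// (_ : _ - _ =
    1 + 3 * (x - 1) + (x - 1) ^+ 2 * (5 - 2 * x)); last by ring.
  by rewrite !addr_ge0// ?mulr_ge0 ?sqr_ge0//; lra.
- have : (3 - x) ^+ 3 <= 1 by rewrite exprn_ile1//; lra.
  by lra.
Qed.

Lemma smooth_step_le1 x : smooth_step x <= 1.
Proof.
case: smooth_stepP => // [/andP[? ?]|/andP[? ?]|/andP[? ?]].
- have : x ^+ 3 <= 1 by rewrite exprn_ile1.
  by lra.
- rewrite -subr_ge0 (_ : _ - _ =
    ((2 - x) ^+ 2 * (2 * x - 1) + 1 + 3 * (2 - x)) / 6); last by field.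
  by rewrite divr_ge0// !addr_ge0 ?mulr_ge0 ?sqr_ge0//; lra.
- have : 0 <= (3 - x) ^+ 3 by rewrite exprn_ge0//; lra.
  by lra.
Qed.

Lemma smooth_step_homo1 x : smooth_step (x - 1) <= smooth_step x.
Proof.
have h1 := smooth_step_le1 (x - 1).
case: smooth_stepP h1 => // [/andP[? ?]|/andP[? ?]|/andP[? ?]] _.
- by rewrite divr_ge0// exprn_ge0.
- rewrite -subr_ge0 (_ : _ - _ =
    (1 + 3 * (x - 1) + 3 * ((x - 1) ^+ 2 * (2 - x))) / 6); last by field.
  by rewrite divr_ge0// !addr_ge0 ?mulr_ge0 ?sqr_ge0//; lra.
- have [u [u0 u1 ->]] : exists u, [/\ 0 <= u, u <= 1 & x = u + 2].
    by exists (x - 2); split; lra.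
  rewrite -subr_ge0 (_ : _ - _ = (1 + 3 * (1 - u * (2 - u) * u)) / 6); last by field.
  have : u * (2 - u) <= 1 by nra.
  by move=> ?; rewrite divr_ge0//; nra.
Qed.

(** The function vanishes outside [[0, 3]], where every truncated square is at most 9; 36 is a crude
    value. *)
Lemma smooth_step1_bound x : `|smooth_step1 x| <= 36.
Proof.
have [x0|x0] := leP x 0.
  rewrite /smooth_step1 !pospart_eq0; do ?by lra.
  by rewrite !expr0n/= !mulr0 !subr0 addr0 mul0r normr0.
have [x3|x3] := leP x 3; last first.
  rewrite /smooth_step1 !pospart_id; do ?by lra.
  by rewrite (_ : _ / 2 = 0) ?normr0//; field.
have pp y : y <= 3 -> 0 <= pospart y ^+ 2 <= 9.
  move=> y3; rewrite exprn_ge0 ?pospart_ge0//=.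
  rewrite (_ : 9 = 3 ^+ 2); last by ring.
  by rewrite lerXn2r ?nnegrE ?pospart_ge0//; rewrite /pospart ge_max y3 ler0n.
have /andP[? ?] := pp _ x3.
have /andP[? ?] := pp (x - 1) ltac:(lra).
have /andP[? ?] := pp (x - 2) ltac:(lra).
have /andP[? ?] := pp (x - 3) ltac:(lra).
by rewrite /smooth_step1 ler_norml; apply/andP; split; lra.
Qed.

Lemma smooth_step2_bound x : `|smooth_step2 x| <= 24.
Proof.
have [x0|x0] := leP x 0.
  rewrite /smooth_step2 !pospart_eq0; do ?by lra.
  by rewrite !mulr0 !subr0 addr0 normr0.
have [x3|x3] := leP x 3; last first.
  rewrite /smooth_step2 !pospart_id; do ?by lra.
  by rewrite (_ : _ - _ = 0) ?normr0//; ring.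
have pp y : y <= 3 -> 0 <= pospart y <= 3.
  by move=> y3; rewrite pospart_ge0 /pospart ge_max y3 ler0n.
have /andP[? ?] := pp _ x3.
have /andP[? ?] := pp (x - 1) ltac:(lra).
have /andP[? ?] := pp (x - 2) ltac:(lra).
have /andP[? ?] := pp (x - 3) ltac:(lra).
by rewrite /smooth_step2 ler_norml; apply/andP; split; lra.
Qed.

Lemma measurable_smooth_step : measurable_fun setT smooth_step /\
  (measurable_fun setT smooth_step1 /\ measurable_fun setT smooth_step2).
Proof.
have mp (z : R) : measurable_fun setT (fun x => pospart (x - z)).
  by apply: measurableT_comp (@measurable_pospart) _; exact: measurable_funB.
split; last split.
- rewrite /smooth_step; apply: measurable_funM => //.
  apply: measurable_funB; last exact: measurable_funX.
  apply: measurable_funD; last by apply: measurable_funM => //; exact: measurable_funX.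
  apply: measurable_funB; first exact: measurable_funX measurable_pospart.
  by apply: measurable_funM => //; exact: measurable_funX.
- rewrite /smooth_step1; apply: measurable_funM => //.
  apply: measurable_funB; last exact: measurable_funX.
  apply: measurable_funD; last by apply: measurable_funM => //; exact: measurable_funX.
  apply: measurable_funB; first exact: measurable_funX measurable_pospart.
  by apply: measurable_funM => //; exact: measurable_funX.
- rewrite /smooth_step2; apply: measurable_funB => //.
  apply: measurable_funD; last exact: measurable_funM.
  by apply: measurable_funB; [exact: measurable_pospart|exact: measurable_funM].
Qed.

(* [bump m r k], [k < 2 * r], is a partition of unity of mesh [m^-1] on the
   interval of half-length [(r - 3) / m] centered at 0. *)
Definition bump (m r k : nat) x : R :=
  smooth_step (m%:R * x + r%:R - k%:R) - smooth_step (m%:R * x + r%:R - k%:R - 1).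

Definition bump1 (m r k : nat) x : R := m%:R *
  (smooth_step1 (m%:R * x + r%:R - k%:R) - smooth_step1 (m%:R * x + r%:R - k%:R - 1)).

Definition bump2 (m r k : nat) x : R := m%:R ^+ 2 *
  (smooth_step2 (m%:R * x + r%:R - k%:R) - smooth_step2 (m%:R * x + r%:R - k%:R - 1)).

(** The left end of the support of [bump m r k], an interval of length [4 / m]. *)
Definition bump_node (m r k : nat) : R := (k%:R - r%:R) / m%:R.

Lemma bump_ge0 m r k x : 0 <= bump m r k x.
Proof. by rewrite subr_ge0 smooth_step_homo1. Qed.

Lemma bump_eq0 m r k x : (0 < m)%N -> 4 / m%:R < `|x - bump_node m r k| ->
  bump m r k x = 0.
Proof.
move=> m0; have m_gt0 : 0 < m%:R :> R by rewrite ltr0n.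
rewrite /bump; set y := m%:R * x + r%:R - k%:R.
have -> : x - bump_node m r k = y / m%:R.
  by rewrite /y /bump_node; field; rewrite gt_eqF.
rewrite normrM normfV (ger0_norm (ltW m_gt0)) ltr_pM2r ?invr_gt0// => y4.
have [y0|y0] := leP y 0; first by rewrite !smooth_step_eq0 ?subrr//; lra.
move: y4; rewrite gtr0_norm// => y4.
by rewrite !smooth_step_eq1 ?subrr//; lra.
Qed.

(** Rescaling by [m] multiplies the derivative of order [j] by [m ^ j], absorbed into [m ^ 3] as
    [m >= 1]; 72 is twice the bound 36, for a difference of two steps. *)
Lemma taylor3_bump m r k : (0 < m)%N ->
  taylor3 (bump m r k) (bump1 m r k) (bump2 m r k) (72 * m%:R ^+ 3).
Proof.
move=> m0; have m1 : 1 <= m%:R :> R by rewrite ler1n.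
have [ms [ms1 ms2]] := measurable_smooth_step.
have maff (z : R) : measurable_fun setT (fun x : R => m%:R * x + r%:R - k%:R - z).
  by do 2 (apply: measurable_funB => //); apply: measurable_funD => //; exact: measurable_funM.
have maff0 : measurable_fun setT (fun x : R => m%:R * x + r%:R - k%:R).
  by apply: measurable_funB => //; apply: measurable_funD => //; exact: measurable_funM.
have m21 : (1 : R) <= m%:R ^+ 2 by rewrite exprn_ege1.
have m31 : (1 : R) <= m%:R ^+ 3 by rewrite exprn_ege1.
split.
- split.
  + by apply: measurable_funB; exact: measurableT_comp.
  + by apply: measurable_funM => //; apply: measurable_funB; exact: measurableT_comp.
  + by apply: measurable_funM => //; apply: measurable_funB; exact: measurableT_comp.
- move=> x; rewrite ger0_norm ?bump_ge0// /bump.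
  set y := _ - k%:R; have := smooth_step_le1 y; have := smooth_step_ge0 (y - 1).
  by lra.
- move=> x; rewrite /bump1 normrM ger0_norm//; set y := _ - k%:R.
  have h : `|smooth_step1 y - smooth_step1 (y - 1)| <= 72.
    rewrite (le_trans (ler_normB _ _))//.
    by have := smooth_step1_bound y; have := smooth_step1_bound (y - 1); lra.
  rewrite mulrC ler_pM//.
  by rewrite -[leLHS]expr1 ler_weXn2l.
- move=> x; rewrite /bump2 normrM ger0_norm ?exprn_ge0//; set y := _ - k%:R.
  have h : `|smooth_step2 y - smooth_step2 (y - 1)| <= 72.
    rewrite (le_trans (ler_normB _ _))//.
    by have := smooth_step2_bound y; have := smooth_step2_bound (y - 1); lra.
  by rewrite mulrC ler_pM// ler_weXn2l.
- move=> x y; rewrite /bump /bump1 /bump2 mulrDr.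
  have e z : m%:R * x + m%:R * y + r%:R - k%:R - z =
      (m%:R * x + r%:R - k%:R - z) + m%:R * y by ring.
  rewrite e -[m%:R * x + _ + _ - k%:R]subr0 e subr0; set t := _ - k%:R.
  have h0 := smooth_step_taylor t (m%:R * y).
  have h1 := smooth_step_taylor (t - 1) (m%:R * y).
  set e0 := (X in `|X| <= _) in h0; set e1 := (X in `|X| <= _) in h1.
  rewrite (_ : _ - _ = e0 - e1); last by rewrite /e0 /e1; field.
  rewrite (le_trans (ler_normB _ _))//; move: h0 h1.
  rewrite normrM (ger0_norm (ler0n _ _)) exprMn.
  have : 0 <= m%:R ^+ 3 * `|y| ^+ 3 by rewrite mulr_ge0 ?exprn_ge0.
  by rewrite -!mulrA; move: (m%:R ^+ 3 * `|y| ^+ 3) => u; lra.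
Qed.

Definition bump_window (m r : nat) x : R := \sum_(k < 2 * r) bump m r k x.

(** The sum telescopes, consecutive bumps sharing a step. *)
Lemma bump_windowE m r x : bump_window m r x =
  smooth_step (m%:R * x + r%:R) - smooth_step (m%:R * x - r%:R).
Proof.
rewrite /bump_window; set y := m%:R * x + r%:R.
have -> : m%:R * x - r%:R = y - (2 * r)%:R by rewrite /y natrM; ring.
elim: (2 * r)%N => [|n IH]; first by rewrite big_ord0 subr0 subrr.
rewrite big_ord_recr/= IH /bump -/y.
have -> : y - n.+1%:R = y - n%:R - 1 by rewrite -natr1; ring.
by ring.
Qed.

Lemma bump_window_ge0 m r x : 0 <= bump_window m r x.
Proof. by apply: sumr_ge0 => k _; exact: bump_ge0. Qed.

Lemma bump_window_le1 m r x : bump_window m r x <= 1.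
Proof.
rewrite bump_windowE; have := smooth_step_le1 (m%:R * x + r%:R).
by have := smooth_step_ge0 (m%:R * x - r%:R); lra.
Qed.

Lemma bump_window_eq1 m r x : m%:R * `|x| + 3 <= r%:R -> bump_window m r x = 1.
Proof.
move=> h; rewrite bump_windowE.
have : m%:R * x <= m%:R * `|x| by rewrite ler_wpM2l// ler_norm.
have : m%:R * - x <= m%:R * `|x| by rewrite ler_wpM2l// -normrN ler_norm.
move=> h1 h2; rewrite smooth_step_eq1; last by lra.
by rewrite smooth_step_eq0 ?subr0//; lra.
Qed.

End spline.

Section spline_approximation.
Context {R : realType} (N : nat).
Implicit Types (h : ('I_N -> R) -> R) (s : 'I_N -> R).

(** Interpolation of [h] from its values on a grid: a finite linear combination of functions with
    separated variables, the only ones which the replacement method handles. *)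
Definition spline_approx h (m r : nat) s : R :=
  \sum_(z : {ffun 'I_N -> 'I_(2 * r)})
    h (fun j => bump_node m r (z j)) * \prod_(j < N) bump m r (z j) (s j).

Lemma prod_bump_window m r s : \prod_(j < N) bump_window m r (s j) =
  \sum_(z : {ffun 'I_N -> 'I_(2 * r)}) \prod_(j < N) bump m r (z j) (s j).
Proof.
exact: (bigA_distr_bigA (fun (j : 'I_N) (k : 'I_(2 * r)) => bump m r k (s j))).
Qed.

(** Write [h s] as [h s * W + h s * (1 - W)], [W] being the product of the windows. In the first
    part only nodes within [4 / m] of [s] in each of the [N] coordinates contribute; the second is
    at most [M * (1 - W)]. *)
Lemma spline_approx_error h (M L : R) m r s : (0 < m)%N ->
    (forall s, `|h s| <= M) -> 0 <= L ->
    (forall s s', `|h s - h s'| <= L * \sum_(j < N) `|s j - s' j|) ->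
  `|h s - spline_approx h m r s| <=
  4 * L * N%:R / m%:R + M * (1 - \prod_(j < N) bump_window m r (s j)).
Proof.
move=> m0 hM L0 hL; set W := \prod_(j < N) _.
have W1 : W <= 1.
  by apply: prodr_ile1 => j _; rewrite bump_window_ge0 bump_window_le1.
have W0 : 0 <= W by apply: prodr_ge0 => j _; exact: bump_window_ge0.
have C0 : 0 <= 4 * L * N%:R / m%:R by rewrite !mulr_ge0// invr_ge0.
have -> : h s - spline_approx h m r s =
    \sum_(z : {ffun 'I_N -> 'I_(2 * r)})
      (h s - h (fun j => bump_node m r (z j))) * \prod_(j < N) bump m r (z j) (s j) +
    h s * (1 - W).
  under eq_bigr do rewrite mulrBl.
  rewrite sumrB -mulr_sumr -prod_bump_window -/W /spline_approx; ring.
rewrite (le_trans (ler_normD _ _))// lerD//; last first.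
  rewrite normrM [X in _ * X]ger0_norm ?subr_ge0//.
  by rewrite ler_wpM2r// subr_ge0.
rewrite (le_trans (ler_norm_sum _ _ _))//.
apply: (@le_trans _ _ (4 * L * N%:R / m%:R * W)); last by rewrite ler_piMr.
rewrite /W prod_bump_window mulr_sumr; apply: ler_sum => z _.
have B0 : 0 <= \prod_(j < N) bump m r (z j) (s j).
  by apply: prodr_ge0 => j _; exact: bump_ge0.
rewrite normrM (ger0_norm B0).
have [[j jP]|near] := pselect (exists j, 4 / m%:R < `|s j - bump_node m r (z j)|).
  by rewrite (bigD1 j)//= bump_eq0// mul0r !mulr0.
rewrite ler_wpM2r//; apply: (le_trans (hL _ _)).
have -> : 4 * L * N%:R / m%:R = L * \sum_(j < N) (4 / m%:R).
  by rewrite sumr_const card_ord -[in RHS]mulr_natr; ring.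
rewrite ler_wpM2l//; apply: ler_sum => j _.
by rewrite leNgt; apply/negP => sj; apply: near; exists j.
Qed.

End spline_approximation.

(** * From products of splines to bounded Lipschitz functions of a vector *)

Section bounded_convergence.
Context d (Omega : measurableType d) (R : realType) (P : probability Omega R).

Lemma Rintegral_sum (I : Type) (s : seq I) (F : I -> Omega -> R) :
  (forall i, P.-integrable setT (EFin \o F i)) ->
  P.-integrable setT (EFin \o (fun w => \sum_(i <- s) F i w)) /\
  \int[P]_w (\sum_(i <- s) F i w) = \sum_(i <- s) \int[P]_w F i w.
Proof.
move=> iF; elim: s => [|i s [IH1 IH2]].
  split; last first.
    rewrite big_nil; under eq_Rintegral do rewrite big_nil.
    exact: Rintegral_probability_cst.
  apply: eq_integrable (integrable_EFin_cst P 0) => // w _.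
  by rewrite /= big_nil.
split.
  by apply: eq_integrable (integrable_EFinD (iF i) IH1) => // w _; rewrite /= big_cons.
under eq_Rintegral do rewrite big_cons.
by rewrite big_cons -IH2 RintegralD.
Qed.

Lemma bounded_cvg_Rintegral (U_ : nat -> Omega -> R) (U : Omega -> R) (M : R) :
    (forall n, measurable_fun setT (U_ n)) -> measurable_fun setT U ->
    (forall n w, `|U_ n w| <= M) -> (forall w, U_ n w @[n --> \oo] --> U w) ->
  \int[P]_w U_ n w @[n --> \oo] --> \int[P]_w U w.
Proof.
move=> mU_ mU UM Ucvg.
have := @dominated_convergence _ _ _ P setT measurableT
  (fun n => EFin \o U_ n) (EFin \o U) (fun=> M%:E).
case.
- by move=> n; exact/measurable_EFinP.
- exact/measurable_EFinP.
- by apply: aeW => w _; apply: cvg_EFin (Ucvg w); exact: nearW.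
- exact: integrable_EFin_cst.
- by apply: aeW => w n _; rewrite /= lee_fin.
move=> iU _ cU; apply: fine_cvg; rewrite fineK//; exact: integrable_fin_num.
Qed.

End bounded_convergence.

Section spline_convergence.
Context {R : realType} (d : nat -> measure_display)
  (Omega : forall n, measurableType (d n)) (P : forall n, probability (Omega n) R)
  (d' : measure_display) (Omega' : measurableType d')
  (P' : probability Omega' R) (N : nat).

Lemma spline_approx_Rintegral d0 (Omega0 : measurableType d0)
    (P0 : probability Omega0 R) (V : Omega0 -> 'I_N -> R) (h : ('I_N -> R) -> R)
    (M L : R) (m r : nat) :
    (forall j, measurable_fun setT (V ^~ j)) -> (0 < m)%N ->
    (forall s, `|h s| <= M) -> 0 <= L ->
    (forall s s', `|h s - h s'| <= L * \sum_(j < N) `|s j - s' j|) ->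
    measurable_fun setT (h \o V) ->
  [/\ \int[P0]_w spline_approx h m r (V w) =
      \sum_(z : {ffun 'I_N -> 'I_(2 * r)}) h (fun j => bump_node m r (z j)) *
        \int[P0]_w (\prod_(j < N) bump m r (z j) (V w j)),
      \int[P0]_w (\prod_(j < N) bump_window m r (V w j)) =
      \sum_(z : {ffun 'I_N -> 'I_(2 * r)})
        \int[P0]_w (\prod_(j < N) bump m r (z j) (V w j)) &
      `|\int[P0]_w h (V w) - \int[P0]_w spline_approx h m r (V w)| <=
      4 * L * N%:R / m%:R +
      M * (1 - \int[P0]_w (\prod_(j < N) bump_window m r (V w j)))].
Proof.
move=> mV m0 hM L0 hL mh.
have iB (z : {ffun 'I_N -> 'I_(2 * r)}) : P0.-integrable setT
    (EFin \o (fun w => \prod_(j < N) bump m r (z j) (V w j))).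
  apply: (@bounded_integrable _ _ _ _ _ 1).
    apply: measurable_prod => j _; have [[mb _ _] _ _ _ _] := @taylor3_bump R m r (z j) m0.
    exact: measurableT_comp mb _.
  move=> w; rewrite normr_prod; apply: prodr_ile1 => j _; rewrite normr_ge0/=.
  exact: taylor3_le1 (taylor3_bump r (z j) m0) _.
have [iW EW] := Rintegral_sum (index_enum _) iB.
have ihB (z : {ffun 'I_N -> 'I_(2 * r)}) : P0.-integrable setT
    (EFin \o (fun w => h (fun j => bump_node m r (z j)) *
      \prod_(j < N) bump m r (z j) (V w j))).
  exact: integrable_EFinZ (iB z).
have [iA EA] := Rintegral_sum (index_enum _) ihB.
split.
- by rewrite [LHS]EA; apply: eq_bigr => z _; rewrite RintegralZl.
- by rewrite -EW; apply: eq_Rintegral => w _; rewrite prod_bump_window.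
have ih : P0.-integrable setT (EFin \o (h \o V)).
  by apply: (@bounded_integrable _ _ _ _ _ M) => // w; exact: hM.
have iW' : P0.-integrable setT
    (EFin \o (fun w => \prod_(j < N) bump_window m r (V w j))).
  by apply: eq_integrable iW => // w _; rewrite /= prod_bump_window.
have iW1 : P0.-integrable setT
    (EFin \o (fun w => 1 - \prod_(j < N) bump_window m r (V w j))).
  by apply: integrable_EFinB => //; exact: integrable_EFin_cst.
have i1 := integrable_EFin_cst P0.
have -> : 4 * L * N%:R / m%:R +
    M * (1 - \int[P0]_w (\prod_(j < N) bump_window m r (V w j))) =
    \int[P0]_w (4 * L * N%:R / m%:R +
      M * (1 - \prod_(j < N) bump_window m r (V w j))).
  rewrite RintegralD//; last exact: integrable_EFinZ.
  by rewrite Rintegral_probability_cst RintegralZl// RintegralB//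
    Rintegral_probability_cst.
rewrite -RintegralB//.
apply: le_normr_Rintegral_bound.
- exact: integrable_EFinB.
- by apply: integrable_EFinD => //; exact: integrable_EFinZ.
- by move=> w; exact: spline_approx_error.
Qed.

(** The mesh [m] is chosen from [L] and [N], then the width [r] from the limit law alone. The
    integrals of the windows converge as well, being finite sums of integrals of products of
    splines, so the tail estimate passes to [P n] for large [n]. *)
Lemma spline_cvg_Rintegral (V : forall n, Omega n -> 'I_N -> R)
    (V' : Omega' -> 'I_N -> R) (h : ('I_N -> R) -> R) (M L : R) :
    (forall n j, measurable_fun setT ((V n) ^~ j)) ->
    (forall j, measurable_fun setT (V' ^~ j)) ->
    (forall b p q K, (forall j : nat, taylor3 (b j) (p j) (q j) K) ->
      \int[P n]_w (\prod_(j < N) b j (V n w j)) @[n --> \oo] -->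
      \int[P']_w (\prod_(j < N) b j (V' w j))) ->
    (forall s, `|h s| <= M) -> 0 <= L ->
    (forall s s', `|h s - h s'| <= L * \sum_(j < N) `|s j - s' j|) ->
    (forall n, measurable_fun setT (h \o V n)) -> measurable_fun setT (h \o V') ->
  \int[P n]_w h (V n w) @[n --> \oo] --> \int[P']_w h (V' w).
Proof.
move=> mV mV' VV' hM L0 hL mh mh'; apply/cvgrPdist_lt => e e0.
have M0 : 0 <= M by rewrite (le_trans _ (hM (fun=> 0))).
have [m m0 me] : exists2 m, (0 < m)%N & 4 * L * N%:R / m%:R < e / 8.
  exists (Num.truncn (4 * L * N%:R / (e / 8))).+1 => //.
  by rewrite ltr_pdivrMr// [ltRHS]mulrC -ltr_pdivrMr ?truncnS_gt ?divr_gt0.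
pose W d0 (O0 : measurableType d0) (P0 : probability O0 R) (V0 : O0 -> 'I_N -> R) r
  := \int[P0]_w (\prod_(j < N) bump_window m r (V0 w j)).
have Wcvg : W _ _ P' V' r @[r --> \oo] --> (1 : R).
  rewrite -[X in _ --> X](Rintegral_probability_cst P').
  apply: (@bounded_cvg_Rintegral _ _ _ _ _ _ 1).
  - move=> r; apply: measurable_prod => j _.
    have -> : (fun w => bump_window m r (V' w j)) =
        (fun w => \sum_(k < 2 * r) bump m r k (V' w j)) by [].
    apply: measurable_sum => k; have [[mb _ _] _ _ _ _] := @taylor3_bump R m r k m0.
    exact: measurableT_comp mb _.
  - exact: measurable_cst.
  - move=> r w; rewrite normr_prod; apply: prodr_ile1 => j _; rewrite normr_ge0/=.
    by rewrite ger0_norm ?bump_window_ge0 ?bump_window_le1.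
  - move=> w; apply: cvg_near_cst.
    near=> r; apply: big1 => j _; apply: bump_window_eq1.
    apply: (@le_trans _ _ (m%:R * (\sum_(i < N) `|V' w i|) + 3)).
      rewrite lerD2r ler_wpM2l// (bigD1 j)//= lerDl.
      by apply: sumr_ge0.
    near: r; exact: nbhs_infty_ger.
have [r re] : exists r, M * (1 - W _ _ P' V' r) < e / 8.
  have : M * (1 - W _ _ P' V' r) @[r --> \oo] --> M * (1 - 1).
    by apply: cvgMr; apply: cvgB => //; exact: cvg_cst.
  rewrite subrr mulr0 => /cvgrPdist_lt /(_ (e / 8)) []; first by rewrite divr_gt0.
  move=> r _ /(_ r (leqnn r)) /=; rewrite sub0r normrN => Mr.
  by exists r; apply: le_lt_trans Mr; exact: ler_norm.
have [EA' EW' Eh'] := spline_approx_Rintegral P' r mV' m0 hM L0 hL mh'.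
have EAn n := spline_approx_Rintegral (P n) r (mV n) m0 hM L0 hL (mh n).
have cB (z : {ffun 'I_N -> 'I_(2 * r)}) :
    \int[P n]_w (\prod_(j < N) bump m r (z j) (V n w j)) @[n --> \oo] -->
    \int[P']_w (\prod_(j < N) bump m r (z j) (V' w j)).
  (* The hypothesis on products takes families indexed by all of [nat]; [z] is extended by 0. *)
  pose zz j := if insub j is Some i then val (z i) else 0%N.
  have zzE (j : 'I_N) : zz j = z j by rewrite /zz valK.
  have T3 (j : nat) : @taylor3 R (bump m r (zz j)) (bump1 m r (zz j))
    (bump2 m r (zz j)) (72 * m%:R ^+ 3) by exact: taylor3_bump.
  have := VV' _ _ _ _ T3.
  have EE d0 (O0 : measurableType d0) (P0 : probability O0 R) (V0 : O0 -> 'I_N -> R) :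
      \int[P0]_w (\prod_(j < N) bump m r (zz j) (V0 w j)) =
      \int[P0]_w (\prod_(j < N) bump m r (z j) (V0 w j)).
    by apply: eq_Rintegral => w _; apply: eq_bigr => j _; rewrite zzE.
  by rewrite EE; under eq_fun do rewrite EE.
have cA : \int[P n]_w spline_approx h m r (V n w) @[n --> \oo] -->
    \int[P']_w spline_approx h m r (V' w).
  rewrite EA'; have -> : (fun n => \int[P n]_w spline_approx h m r (V n w)) =
    (fun n => \sum_(z : {ffun 'I_N -> 'I_(2 * r)})
      h (fun j => bump_node m r (z j)) *
      \int[P n]_w (\prod_(j < N) bump m r (z j) (V n w j))).
    by apply/funext => n; have [-> _ _] := EAn n.
  by apply: cvg_big => [|z _]; [exact: add_continuous|exact: cvgMr].
have cW : W _ _ (P n) (V n) r @[n --> \oo] --> W _ _ P' V' r.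
  rewrite /W EW'; have -> : (fun n => W _ _ (P n) (V n) r) =
    (fun n => \sum_(z : {ffun 'I_N -> 'I_(2 * r)})
      \int[P n]_w (\prod_(j < N) bump m r (z j) (V n w j))).
    by apply/funext => n; have [_ <- _] := EAn n.
  by apply: cvg_big => [|z _]; [exact: add_continuous|exact: cB].
have cMW : M * W _ _ (P n) (V n) r @[n --> \oo] --> M * W _ _ P' V' r.
  exact: cvgMr.
(* Six errors of size [e / 8]: the mesh error on both sides, the tail of the limit counted twice,
   the gap of the windows and the gap of the spline integrals. *)
near=> n; have [_ _ Ehn] := EAn n.
have h1 : `|\int[P']_w spline_approx h m r (V' w) -
    \int[P n]_w spline_approx h m r (V n w)| < e / 8.
  by near: n; move/cvgrPdist_lt : cA; apply; rewrite divr_gt0.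
have h2 : `|M * W _ _ P' V' r - M * W _ _ (P n) (V n) r| < e / 8.
  by near: n; move/cvgrPdist_lt : cMW; apply; rewrite divr_gt0.
move: Ehn Eh' re h1 h2; rewrite -!/(W _ _ _ _ r).
move: (W _ _ P' V' r) (W _ _ (P n) (V n) r) => W1 W2.
set e1 := \int[_]__ _; set e2 := \int[_]__ _; set e3 := \int[_]__ h _.
set e4 := \int[_]__ _.
rewrite !mulrBr !ler_norml !ltr_norml.
move: me; set C := 4 * _ * _ / _; move: (M * W1) (M * W2) => t1 t2.
rewrite mulr1 => ? /andP[? ?] /andP[? ?] ? /andP[? ?] /andP[? ?].
by apply/andP; split; lra.
Unshelve. all: by end_near. Qed.

End spline_convergence.

(** * A maximal inequality *)

Section maximal_inequality.
Context d (Omega : measurableType d) (R : realType) (P : probability Omega R).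
Variables (X : nat -> Omega -> R) (a : nat) (kappa theta : R).

(* [exp (S_i - i kappa)], frozen as soon as it reaches [theta]. *)
Fixpoint stopped_exp (i : nat) (w : Omega) : R :=
  if i is j.+1 then
    if theta <= stopped_exp j w then stopped_exp j w
    else stopped_exp j w * expR (X (a + j)%N w - kappa)
  else 1.

Lemma stopped_exp_gt0 i w : 0 < stopped_exp i w.
Proof. by elim: i => //= i IH; case: ifP => // _; rewrite mulr_gt0 ?expR_gt0. Qed.

Lemma adapted_stopped_exp i : adapted X (a + i) (stopped_exp i).
Proof.
elim: i => [|i IH]; first exact: measurable_cst.
have aQ : adapted X (a + i.+1) (stopped_exp i).
  by apply: adapted_le IH; rewrite addnS.
apply: measurable_fun_ifT => //=.
  by apply: measurable_fun_ler => //; exact: measurable_cst.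
apply: measurable_funM => //; apply: measurableT_comp => //.
by apply: measurable_funB => //; rewrite addnS; exact: adapted_coord.
Qed.

(** A value that has reached [theta] is kept, so the variable at the final time alone detects a
    crossing at any earlier time. *)
Lemma stopped_expP i w : theta <= stopped_exp i w \/
  (stopped_exp i w = expR (block_sum X a i w - kappa * i%:R) /\
   forall j, (j <= i)%N -> expR (block_sum X a j w - kappa * j%:R) < theta).
Proof.
elim: i => [|i [h|[Qi lti]]]; last 2 first.
- by left; rewrite /= h.
- have [Qtheta|Qtheta] := leP theta (stopped_exp i.+1 w); first by left.
  right; have Qi1 : stopped_exp i.+1 w =
      expR (block_sum X a i.+1 w - kappa * i.+1%:R).
    have Qi_lt : stopped_exp i w < theta by rewrite Qi; exact: lti.
    rewrite /= leNgt Qi_lt/= Qi -expRD block_sumS -natr1; congr expR; ring.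
  split=> // j; rewrite leq_eqVlt => /predU1P[->|]; first by rewrite -Qi1.
  by rewrite ltnS; exact: lti.
have S0 : block_sum X a 0 w = 0 by rewrite /block_sum addn0 big_geq.
have [h|h] := leP theta 1; [by left|right].
rewrite S0 mulr0 subr0 expR0; split=> // j.
by rewrite leqn0 => /eqP ->; rewrite S0 mulr0 subr0 expR0.
Qed.

Variable C : R.
Hypothesis indepX : indep_seq P X.
Hypothesis boundX : forall k w, `|X k w| <= C.
Hypothesis expX : forall k, \int[P]_w expR (X k w) <= expR kappa.

Let mX k : measurable_fun setT (X k). Proof. exact: indepX.1. Qed.

Lemma stopped_exp_bounded i : exists M : R, forall w, `|stopped_exp i w| <= M.
Proof.
elim: i => [|i [M QM]]; first by exists 1 => w; rewrite normr1.
exists (M + M * expR (C + `|kappa|)) => w /=.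
have M0 : 0 <= M by rewrite (le_trans _ (QM w)).
case: ifP => _; first by rewrite (le_trans (QM w))// lerDl mulr_ge0 ?expR_ge0.
rewrite (@le_trans _ _ (M * expR (C + `|kappa|)))//; last by rewrite lerDr.
rewrite normrM ler_pM// ger0_norm ?expR_ge0// ler_expR.
apply: lerD; first exact: le_trans (ler_norm _) (boundX _ _).
by rewrite -normrN ler_norm.
Qed.

(** Supermartingale property: each increment is a nonnegative bounded function of the past times
    [expR (X - kappa) - 1], whose mean is nonpositive by [expX]. *)
Lemma Rintegral_stopped_exp i : \int[P]_w stopped_exp i w <= 1.
Proof.
elim: i => [|i IH]; first by rewrite Rintegral_probability_cst.
apply: le_trans IH.
have aQ := @adapted_stopped_exp i; have mQ := adapted_measurable indepX aQ.
have [M QM] := stopped_exp_bounded i; have iQ := bounded_integrable P mQ QM.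
have [M' QM'] := stopped_exp_bounded i.+1.
have aQ' := @adapted_stopped_exp i.+1; have mQ' := adapted_measurable indepX aQ'.
have iQ' := bounded_integrable P mQ' QM'.
pose U w := if theta <= stopped_exp i w then 0 else stopped_exp i w.
have aU : adapted X (a + i) U.
  apply: measurable_fun_ifT => //=.
  by apply: measurable_fun_ler => //; exact: measurable_cst.
have UM w : `|U w| <= M.
  by rewrite /U; case: ifP => _ //; rewrite normr0 (le_trans _ (QM w)).
have mpsi : measurable_fun setT (fun x : R => expR (x - kappa) - 1).
  apply: measurable_funB => //; apply: measurableT_comp => //.
  exact: measurable_funB.
have iexp : P.-integrable setT (EFin \o (fun w => expR (X (a + i)%N w))).
  apply: (@bounded_integrable _ _ _ _ _ (expR C)).
    exact: measurableT_comp.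
  by move=> w; rewrite ger0_norm ?expR_ge0// ler_expR (le_trans (ler_norm _) (boundX _ _)).
have iZ : P.-integrable setT
    (EFin \o ((fun x : R => expR (x - kappa) - 1) \o X (a + i)%N)).
  apply: integrable_EFinB; last exact: integrable_EFin_cst.
  apply: eq_integrable (integrable_EFinZ (expR (- kappa)) iexp) => // w _.
  by rewrite /= -expRD addrC.
have := Rintegral_adaptedM indepX aU UM mpsi iZ.
have -> : \int[P]_w (U w * (expR (X (a + i)%N w - kappa) - 1)) =
    \int[P]_w stopped_exp i.+1 w - \int[P]_w stopped_exp i w.
  rewrite -RintegralB//; apply: eq_Rintegral => w _ /=.
  by rewrite /U; case: ifP => _; rewrite ?mul0r ?subrr// mulrBr mulr1.
have -> : \int[P]_w (expR (X (a + i)%N w - kappa) - 1) =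
    expR (- kappa) * (\int[P]_w expR (X (a + i)%N w)) - 1.
  rewrite RintegralB//; last exact: integrable_EFin_cst.
    rewrite Rintegral_probability_cst -RintegralZl//.
    by under eq_Rintegral do rewrite addrC expRD.
  apply: eq_integrable (integrable_EFinZ (expR (- kappa)) iexp) => // w _.
  by rewrite /= -expRD addrC.
move=> E; rewrite -subr_le0 E mulr_ge0_le0//.
  apply: Rintegral_ge0 => w _; rewrite /U; case: ifP => // _.
  exact/ltW/stopped_exp_gt0.
by rewrite subr_le0 expRN mulrC ler_pdivrMr ?expR_gt0// mul1r.
Qed.

End maximal_inequality.

(* [G] plays the role of the indicator of a maximal deviation event. *)
Lemma maximal_majorant d (Omega : measurableType d) (R : realType)
    (P : probability Omega R) (X : nat -> Omega -> R) (a m : nat) (kappa c C : R) :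
    indep_seq P X -> (forall k w, `|X k w| <= C) -> 0 <= kappa ->
    (forall k, \int[P]_w expR (X k w) <= expR kappa) ->
  exists G : Omega -> R,
    [/\ P.-integrable setT (EFin \o G), forall w, 0 <= G w,
        \int[P]_w G w <= expR (kappa * m%:R - c) &
        forall w i, (i <= m)%N -> c <= block_sum X a i w -> 1 <= G w].
Proof.
move=> iX XC k0 eX; pose theta := expR (c - kappa * m%:R).
have aQ := @adapted_stopped_exp _ _ _ X a kappa theta m.
have mQ := adapted_measurable iX aQ.
have iQ : P.-integrable setT (EFin \o (stopped_exp X a kappa theta m)).
  have [M QM] : exists M : R, forall w, `|stopped_exp X a kappa theta m w| <= M.
    exact: stopped_exp_bounded XC _.
  exact: (bounded_integrable P mQ QM).
(* Markov's inequality in functional form: the stopped process divided by [theta]. A sum at least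
   [c] at some time [i <= m] puts [S_i - i kappa] above [c - m kappa], the logarithm of [theta]. *)
exists (fun w => expR (kappa * m%:R - c) * stopped_exp X a kappa theta m w); split.
- exact: integrable_EFinZ.
- by move=> w; rewrite mulr_ge0 ?expR_ge0// ltW// stopped_exp_gt0.
- rewrite RintegralZl// ler_piMr ?expR_ge0//.
  exact: Rintegral_stopped_exp XC eX _.
move=> w i im cS.
have [|[_ /(_ i im)]] := stopped_expP X a kappa theta m w.
  rewrite /theta -[c - _]opprB expRN => h.
  by rewrite mulrC -ler_pdivrMr ?expR_gt0// mul1r.
rewrite ltr_expR => h; exfalso.
have : kappa * i%:R <= kappa * m%:R by rewrite ler_wpM2l// ler_nat.
by move: h cS; lra.
Qed.

(** * Borel maps into the Skorokhod space *)

Section borel_measurability.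
Context {R : realType} d (Omega : measurableType d).

Lemma measurable_borelP (S : ptopologicalType) (Y : Omega -> S) :
  (forall U, open U -> measurable (Y @^-1` U)) ->
  measurable_fun setT (Y : Omega -> borel S).
Proof.
move=> mY; apply: (@measurability _ _ _ (borel S) _ _ (@open S)) => //.
by move=> _ [U oU <-]; rewrite setTI; exact: mY.
Qed.

Lemma measurable_preimage_open (S : ptopologicalType) (Y : Omega -> S) U :
  measurable_fun setT (Y : Omega -> borel S) -> open U ->
  measurable (Y @^-1` U).
Proof.
by move=> mY oU; rewrite -[_ @^-1` _]setTI; apply: mY => //; exact: sub_sigma_algebra.
Qed.

Lemma measurable_continuous_comp (S : ptopologicalType) (g : S -> R)
    (Y : Omega -> S) : continuous g ->
  measurable_fun setT (Y : Omega -> borel S) -> measurable_fun setT (g \o Y).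
Proof.
move=> /continuousP cg mY; apply: (measurability _ (RGenOpens.measurableE R)).
move=> _ [_ [a [b ->] <-]]; rewrite setTI comp_preimage.
apply: measurable_preimage_open mY _; exact/cg/interval_open.
Qed.

(* [Y] lies in the open set [U] iff, for some [k], all but finitely many [Y_ n]
   lie in the interior of the set of points whose [1/k]-ball is in [U]. *)
Lemma measurable_borel_cvg (S : pseudoPMetricType R) (Y_ : nat -> Omega -> S)
    (Y : Omega -> S) :
    (forall n, measurable_fun setT (Y_ n : Omega -> borel S)) ->
    (forall w e, 0 < e -> \forall n \near \oo, ball (Y w) e (Y_ n w)) ->
  measurable_fun setT (Y : Omega -> borel S).
Proof.
move=> mY_ YY; apply: measurable_borelP => U oU.
pose V (k : nat) := [set x : S | ball x k.+1%:R^-1 `<=` U]^°.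
have -> : Y @^-1` U = \bigcup_k \bigcup_n0 \bigcap_(n in [set n | (n0 <= n)%N])
    Y_ n @^-1` V k.
  apply/seteqP; split=> [w Uw|w [k _ [n0 _ h]]]; last first.
    have [n1 _ n1P] := YY w k.+1%:R^-1 ltac:(by rewrite invr_gt0).
    have /interior_subset := h (maxn n0 n1) (leq_maxl _ _).
    by apply; apply: ball_sym; apply: n1P; rewrite /= leq_maxr.
  have /nbhs_ballP[e /= e0 eU] := open_nbhs_nbhs (conj oU Uw).
  have [k ke] : exists k : nat, k.+1%:R^-1 < e / 2.
    by exists (Num.truncn (e / 2)^-1); rewrite invf_plt ?posrE ?divr_gt0// truncnS_gt.
  exists k => //; have Vk : V k (Y w).
    apply/nbhs_ballP; exists k.+1%:R^-1; first by rewrite /= invr_gt0.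
    move=> x Yx y xy; apply: eU; apply: (le_ball (ltW _) (ball_triangle Yx xy)).
    by rewrite [ltRHS]splitr ltrD.
  have /nbhs_ballP[e' /= e'0 e'V] : nbhs (Y w) (V k).
    by apply: open_nbhs_nbhs; split => //; exact: open_interior.
  have [n0 _ n0P] := YY w e' e'0.
  by exists n0 => // n n0n; apply: e'V; exact: n0P.
apply: bigcupT_measurable => k; apply: bigcupT_measurable => n0.
apply: bigcap_measurableType => // n _.
by apply: measurable_preimage_open => //; exact: open_interior.
Qed.

End borel_measurability.

Section step_functions.
Context {R : realType} (T : R).
Implicit Types (c : R) (v : nat -> R) (x y : skorokhod T).

Lemma skorokhod_ext x y : (forall t, x t = y t) -> x = y.
Proof.
case: x y => [x cx ox] [y cy oy] /= /funext xy.
by rewrite xy in cx ox *; congr Skorokhod; exact: Prop_irrelevance.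
Qed.

Lemma uniform_skorokhod_ball x y (e e' : R) : 0 <= e' -> e' < e ->
  (forall t, t \in `[0, T] -> `|x t - y t| <= e') -> skorokhod_ball x e y.
Proof.
move=> e'0 e'e xy; exists id; first exact: time_change_id.
by exists e' => // t tT; rewrite subrr normr0; split=> //; exact: xy.
Qed.

Lemma truncn_mul_le0 c t : c <= 0 -> 0 <= t -> Num.truncn (c * t) = 0%N.
Proof.
move=> c0 t0; apply/truncn0Pn; rewrite -ltNge; apply: le_lt_trans ltr01.
exact: mulr_le0_ge0.
Qed.

Lemma truncn_mul_right c t : 0 <= t ->
  \forall s \near t^'+, Num.truncn (c * s) = Num.truncn (c * t).
Proof.
move=> t0; have [c0|c0] := leP c 0.
  near=> s; have ts : t < s by near: s; exact: nbhs_right_gt.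
  by rewrite !truncn_mul_le0// (le_trans t0)// ltW.
set m := Num.truncn (c * t).
have m_gt : t < m.+1%:R / c by rewrite ltr_pdivlMr// mulrC truncnS_gt.
have m_le : m%:R <= c * t by rewrite truncn_le// mulr_ge0// ltW.
near=> s; have ts : t < s by near: s; exact: nbhs_right_gt.
have sm : s < m.+1%:R / c by near: s; exact: nbhs_right_lt.
apply/truncn_def; rewrite (le_trans m_le) ?ler_pM2l ?ltW//=.
by rewrite mulrC -ltr_pdivlMr.
Unshelve. all: by end_near. Qed.

Lemma truncn_mul_left c t : 0 < t ->
  exists m : nat, \forall s \near t^'-, Num.truncn (c * s) = m.
Proof.
move=> t0; have [c0|c0] := leP c 0.
  exists 0%N; near=> s; have s0 : 0 < s by near: s; exact: nbhs_left_gt.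
  by rewrite truncn_mul_le0// ltW.
have ct0 : 0 < c * t by rewrite mulr_gt0.
have [m /andP[mlt tle]] : exists m : nat, m%:R < c * t <= m.+1%:R.
  have /andP[] := truncn_itv (ltW ct0); set k := Num.truncn _.
  rewrite le_eqVlt => /predU1P[kE _|kt tk]; last by exists k; rewrite kt ltW.
  have k0 : (0 < k)%N by rewrite -(ltr_nat R) kE.
  by exists k.-1; rewrite prednK// -kE lexx andbT ltr_nat prednK.
have ml : m%:R / c < t by rewrite ltr_pdivrMr// mulrC.
exists m; near=> s; have st : s < t by near: s; exact: nbhs_left_lt.
have ms : m%:R / c < s by near: s; exact: nbhs_left_gt.
apply/truncn_def; rewrite mulrC -ler_pdivrMr// ltW//= mulrC.
by rewrite (lt_le_trans _ tle)// ltr_pM2l.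
Unshelve. all: by end_near. Qed.

Lemma cadlag_step c v : cadlag T (fun t => v (Num.truncn (c * t))).
Proof.
split=> t /andP[t0 tT].
  apply: cvg_near_cst; near=> s.
  by rewrite (near (truncn_mul_right c t0) s).
have [m tm] := truncn_mul_left c t0.
apply/cvg_ex; exists (v m).
by apply: cvg_near_cst; near=> s; rewrite (near tm s).
Unshelve. all: by end_near. Qed.

(** For [c > 0], the path equal to [v m] on the interval from [m / c] to [m.+1 / c]. The wealth, its
    logarithmic form and all frozen paths are instances. *)
Definition step_path c v : skorokhod T := to_skorokhod (cadlag_step c v).

Lemma step_pathE c v t : t \in `[0, T] ->
  step_path c v t = v (Num.truncn (c * t)).
Proof. by move=> tT; rewrite /step_path/= patchE mem_setE tT. Qed.

Lemma truncn_mul_le c t : t \in `[0, T] ->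
  (Num.truncn (c * t) <= Num.truncn (`|c| * T))%N.
Proof.
rewrite in_itv/= => /andP[t0 tT]; apply: le_truncn.
by rewrite (le_trans (ler_wpM2r t0 (ler_norm c)))// ler_wpM2l.
Qed.

(** On [[0, T]] the path depends on finitely many values, and continuously so for the uniform
    distance. The preimage of an open set is therefore a countable union of boxes with rational
    centres and radii [1 / k]. *)
Lemma measurable_step_path d (Omega : measurableType d) c (V : nat -> Omega -> R) :
  (forall m, measurable_fun setT (V m)) ->
  measurable_fun setT
    ((fun w => step_path c (V ^~ w)) : Omega -> borel (skorokhod T)).
Proof.
move=> mV; apply: measurable_borelP => U oU.
pose N := Num.truncn (`|c| * T).
pose box (z : {ffun 'I_N.+1 -> rat} * nat) :=
  \bigcap_(i in [set: 'I_N.+1]) V i @^-1` ball (ratr (z.1 i) : R) z.2.+1%:R^-1.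
pose inU (z : {ffun 'I_N.+1 -> rat} * nat) := forall v : nat -> R,
  (forall i : 'I_N.+1, ball (ratr (z.1 i) : R) z.2.+1%:R^-1 (v i)) ->
  U (step_path c v).
have mbox z : measurable (box z).
  apply: fin_bigcap_measurable => // i _.
  rewrite -[X in measurable X]setTI; apply: mV => //.
  by apply: open_measurable; exact: ball_open.
have -> : (fun w => step_path c (V ^~ w)) @^-1` U =
    \bigcup_z (if pselect (inU z) then box z else set0).
  apply/seteqP; split=> [w Uw|w [z _]]; last first.
    by case: pselect => //= Uz boxw; apply: Uz => i; exact: boxw.
  have /nbhs_ballP[e /= e0 eU] := open_nbhs_nbhs (conj oU Uw).
  have [k ke] : exists k : nat, k.+1%:R^-1 < e / 3.
    by exists (Num.truncn (e / 3)^-1); rewrite invf_plt ?posrE ?divr_gt0// truncnS_gt.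
  have k0 : 0 < k.+1%:R^-1 :> R by rewrite invr_gt0.
  have /choice[q qP] : forall i : 'I_N.+1, exists q : rat,
      ball (ratr q : R) k.+1%:R^-1 (V i w).
    move=> i; have /rat_in_itvoo[q] : V i w - k.+1%:R^-1 < V i w + k.+1%:R^-1.
      by rewrite ltrBlDr -addrA ltrDl addr_gt0.
    rewrite in_itv/= => /andP[q1 q2]; exists q.
    by rewrite /ball/= ltr_distl q1 q2.
  exists ([ffun i => q i], k) => //; case: pselect => [_ i _|]; last first.
    case=> v vq; apply: eU.
    (* Both vectors lie within [e / 3] of the centre of the box. *)
    apply: (@uniform_skorokhod_ball _ _ _ (2 * e / 3)).
    - by rewrite divr_ge0// mulr_ge0// ltW.
    - by rewrite ltr_pdivrMr//; lra.
    move=> t tT; rewrite !step_pathE//.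
    have jN : (Num.truncn (c * t) < N.+1)%N by rewrite ltnS truncn_mul_le.
    have := vq (Ordinal jN); have := qP (Ordinal jN); rewrite /= ffunE.
    move: ke k0; set a := ratr _; set r := _^-1 => ke k0.
    rewrite /ball/= !ltr_norml => /andP[? ?] /andP[? ?].
    by rewrite ler_norml; apply/andP; split; lra.
  by rewrite /= ffunE; exact: qP.
apply: countable_bigcupT_measurable => [|z]; first exact: countableP.
by case: pselect => /= [Uz|_]; [exact: mbox|exact: measurable0].
Qed.

End step_functions.

(** * Reduction to Lipschitz test functions *)

Section lipschitz_regularization.
Context {R : realType} (S : pseudoPMetricType R).
Implicit Types (g : S -> R) (k M e : R).

Definition ball_lipschitz (L : R) g : Prop :=
  forall x y e, 0 < e -> ball x e y -> `|g x - g y| <= L * e.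

Lemma ball_lipschitz_continuous L g : ball_lipschitz L g -> continuous g.
Proof.
move=> gL x; apply/cvgrPdist_lt => e e0.
have L0 : 0 < `|L| + 1 by rewrite ltr_wpDl.
apply/nbhs_ballP; exists (e / (`|L| + 1)); first by rewrite /= divr_gt0.
move=> y xy /=; apply: (le_lt_trans (gL x y _ _ xy)); first by rewrite divr_gt0.
rewrite mulrCA gtr_pMr// ltr_pdivrMr// mul1r.
by rewrite (le_lt_trans (ler_norm _))// ltrDl.
Qed.

(** The inf-convolution of [g] with [k] times the distance, the distance from [x] to [y] being
    replaced by the radius [e] of a ball around [x] containing [y]. *)
Definition lipschitz_minorant k g x : R :=
  inf [set r | exists y e, [/\ 0 < e, ball x e y & r = g y + k * e]].

Variables (g : S -> R) (M : R).
Hypothesis gM : forall x, `|g x| <= M.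

Let M0 : 0 <= M. Proof. exact: le_trans (gM point). Qed.

Let lower k x : 0 <= k ->
  lbound [set r | exists y e, [/\ 0 < e, ball x e y & r = g y + k * e]] (- M).
Proof.
move=> k0 _ [y [e [e0 _ ->]]]; rewrite (@le_trans _ _ (g y))//.
  by have := gM y; rewrite ler_norml => /andP[].
by rewrite lerDl mulr_ge0// ltW.
Qed.

Let nonempty k x :
  nonempty [set r | exists y e, [/\ 0 < e, ball x e y & r = g y + k * e]].
Proof. by exists (g x + k * 1); exists x, 1; split => //; exact: ballxx. Qed.

Lemma lipschitz_minorant_le k x : 0 <= k -> lipschitz_minorant k g x <= g x.
Proof.
move=> k0; apply/ler_addgt0Pr => e e0.
have k1 : 0 < k + 1 by rewrite ltr_wpDl.
apply: (@le_trans _ _ (g x + k * (e / (k + 1)))).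
  apply: ge_inf; first by exists (- M); exact: lower.
  by exists x, (e / (k + 1)); split=> //; [rewrite divr_gt0|apply: ballxx; rewrite divr_gt0].
by rewrite lerD2l mulrCA ger_pMr// ler_pdivrMr// mul1r lerDl.
Qed.

Lemma lipschitz_minorant_bound k x : 0 <= k -> `|lipschitz_minorant k g x| <= M.
Proof.
move=> k0; rewrite ler_norml; apply/andP; split.
  by apply: lb_le_inf; [exact: nonempty|exact: lower].
rewrite (le_trans (lipschitz_minorant_le x k0))//.
by rewrite (le_trans (ler_norm _)).
Qed.

Lemma lipschitz_minorant_lipschitz k : 0 <= k ->
  ball_lipschitz k (lipschitz_minorant k g).
Proof.
move=> k0.
have main x y e : 0 < e -> ball x e y ->
    lipschitz_minorant k g x - k * e <= lipschitz_minorant k g y.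
  move=> e0 xy; apply: lb_le_inf; first exact: nonempty.
  move=> _ [z [e' [e'0 yz ->]]]; rewrite lerBlDr -addrA -mulrDr [e' + e]addrC.
  apply: ge_inf; first by exists (- M); exact: lower.
  by exists z, (e + e'); split; [rewrite addr_gt0|exact: ball_triangle yz|].
move=> x y e e0 xy; rewrite ler_distlC.
by rewrite main//= -lerBlDr main//; exact: ball_sym.
Qed.

(** Near [x] the values of [g] are at least [g x - e]; at radius [r] or more the penalty is at least
    [2 * M] once [n >= 2 * M / r], which compensates for any value of [g]. *)
Lemma lipschitz_minorant_cvg x : {for x, continuous g} ->
  lipschitz_minorant n%:R g x @[n --> \oo] --> g x.
Proof.
move=> gx; apply/cvgrPdist_le => e e0.
have /nbhs_ballP[r /= r0 rg] : nbhs x [set y | `|g x - g y| <= e].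
  by move/cvgrPdist_le : gx; exact.
near=> n; rewrite ger0_norm ?subr_ge0 ?lipschitz_minorant_le//.
rewrite lerBlDr -lerBlDl; apply: lb_le_inf; first exact: nonempty.
move=> _ [y [e' [e'0 xy ->]]]; have [e'r|re'] := ltP e' r.
  have /= : `|g x - g y| <= e by apply: rg; exact: le_ball (ltW e'r) _ xy.
  rewrite ler_norml => /andP[_ h].
  have : 0 <= n%:R * e' by rewrite mulr_ge0// ltW.
  by lra.
have nr : 2 * M / r <= n%:R by near: n; exact: nbhs_infty_ger.
have : 2 * M <= n%:R * e'.
  by rewrite -ler_pdivrMr// (le_trans _ nr)// ler_wpM2l ?mulr_ge0// lef_pV2 ?posrE.
have := gM x; have := gM y; rewrite !ler_norml => /andP[? ?] /andP[? ?].
by lra.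
Unshelve. all: by end_near. Qed.

End lipschitz_regularization.

Section reduction_to_lipschitz.
Context {R : realType} (S : pseudoPMetricType R) (d : nat -> measure_display)
  (Omega : forall n, measurableType (d n)) (P : forall n, probability (Omega n) R)
  (X : forall n, Omega n -> S) (d' : measure_display) (Omega' : measurableType d')
  (P' : probability Omega' R) (Y : Omega' -> S).
Arguments X : clear implicits.
Hypothesis mX : forall n, measurable_fun setT (X n : Omega n -> borel S).
Hypothesis mY : measurable_fun setT (Y : Omega' -> borel S).
Hypothesis lipschitz_cvg : forall (g : S -> R) (M L : R),
  (forall x, `|g x| <= M) -> 0 <= L -> ball_lipschitz L g ->
  \int[P n]_w g (X n w) @[n --> \oo] --> \int[P']_w g (Y w).

(** A Lipschitz minorant [gk k] of [g] loses at most [e / 2] on the limit side, by bounded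
    convergence; its own integrals converge and stay below those of [g]. *)
Let eventually_ge (g : S -> R) (M e : R) : continuous g ->
  (forall x, `|g x| <= M) -> 0 < e ->
  \forall n \near \oo, \int[P']_w g (Y w) - e <= \int[P n]_w g (X n w).
Proof.
move=> cg gM e0; pose gk k := lipschitz_minorant k%:R g.
have k0 k : 0 <= k%:R :> R by [].
have cgk k : continuous (gk k).
  exact: ball_lipschitz_continuous (lipschitz_minorant_lipschitz gM (k0 k)).
have gkM k x : `|gk k x| <= M by exact: lipschitz_minorant_bound.
have mgX (h : S -> R) n : continuous h -> measurable_fun setT (h \o X n).
  by move=> ch; exact: measurable_continuous_comp.
have mgY (h : S -> R) : continuous h -> measurable_fun setT (h \o Y).
  by move=> ch; exact: measurable_continuous_comp.
have ckY : \int[P']_w gk k (Y w) @[k --> \oo] --> \int[P']_w g (Y w).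
  apply: (@bounded_cvg_Rintegral _ _ _ _ _ _ M) => //.
  - by move=> k; exact: mgY.
  - exact: mgY.
  - by move=> w; apply: lipschitz_minorant_cvg => //; exact: cg.
have [k kP] : exists k, \int[P']_w g (Y w) - e / 2 <= \int[P']_w gk k (Y w).
  have /cvgrPdist_le /(_ (e / 2)) [] := ckY; first by rewrite divr_gt0.
  move=> k _ /(_ k (leqnn k)) /=; rewrite ler_norml => /andP[_ h].
  by exists k; lra.
have := lipschitz_cvg (gkM k) (k0 k) (lipschitz_minorant_lipschitz gM (k0 k)).
move=> /cvgrPdist_le /(_ (e / 2)) H; near=> n.
have : `|\int[P']_w gk k (Y w) - \int[P n]_w gk k (X n w)| <= e / 2.
  by near: n; apply: H; rewrite divr_gt0.
rewrite ler_norml => /andP[_ h].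
have : \int[P n]_w gk k (X n w) <= \int[P n]_w g (X n w).
  apply: le_Rintegral => //.
  - by apply: (@bounded_integrable _ _ _ _ _ M) => //; exact: mgX.
  - by apply: (@bounded_integrable _ _ _ _ _ M) => //; exact: mgX.
  - by move=> w _; exact: lipschitz_minorant_le.
by lra.
Unshelve. all: by end_near. Qed.

(** The one-sided estimate is applied to [g] and to [- g]. *)
Lemma cvg_in_law_lipschitz : cvg_in_law P X P' Y.
Proof.
split => // g cg [M [_ gM]].
have {}gM x : `|g x| <= M + 1 by apply: gM => //; rewrite ltrDl.
have mgX n : measurable_fun setT (g \o X n).
  exact: measurable_continuous_comp.
have mgY : measurable_fun setT (g \o Y).
  exact: measurable_continuous_comp.
have iX n : (P n).-integrable setT (EFin \o (g \o X n)).
  by apply: (@bounded_integrable _ _ _ _ _ (M + 1)) => // w; exact: gM.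
have iY : P'.-integrable setT (EFin \o (g \o Y)).
  by apply: (@bounded_integrable _ _ _ _ _ (M + 1)) => // w; exact: gM.
have EX n : ('E_(P n)[g \o X n] = (\int[P n]_w g (X n w))%:E)%E.
  by rewrite unlock /Rintegral fineK//; exact: integrable_fin_num.
have EY : ('E_P'[g \o Y] = (\int[P']_w g (Y w))%:E)%E.
  by rewrite unlock /Rintegral fineK//; exact: integrable_fin_num.
rewrite EY; under eq_fun do rewrite EX.
apply: cvg_EFin; first exact: nearW.
apply/cvgrPdist_le => e e0.
have cNg : continuous (fun x => - g x) by move=> x; apply: cvgN; exact: cg.
have NgM x : `|- g x| <= M + 1 by rewrite normrN.
near=> n.
have h1 : \int[P']_w g (Y w) - e <= \int[P n]_w g (X n w).
  by near: n; exact: eventually_ge gM e0.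
have h2 : \int[P']_w - g (Y w) - e <= \int[P n]_w - g (X n w).
  by near: n; exact: eventually_ge NgM e0.
have opp d0 (O0 : measurableType d0) (P0 : probability O0 R) (h : O0 -> R) :
    P0.-integrable setT (EFin \o h) -> \int[P0]_w - h w = - \int[P0]_w h w.
  move=> ih; rewrite -mulN1r -RintegralZl//.
  by under [RHS]eq_Rintegral do rewrite mulN1r.
have oY : \int[P']_w - g (Y w) = - \int[P']_w g (Y w) := opp _ _ _ _ iY.
have oX : \int[P n]_w - g (X n w) = - \int[P n]_w g (X n w) := opp _ _ _ _ (iX n).
move: h2; rewrite oY oX /= => h2.
move: h1 h2; set e1 := \int[_]_w g (Y w); set e2 := \int[_]_w g (X n w) => h1 h2.
by rewrite ler_norml; apply/andP; split; lra.
Unshelve. all: by end_near. Qed.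

End reduction_to_lipschitz.

(** * Taylor bounds and Gaussian moments *)

Section exponential_estimates.
Context {R : realType}.
Implicit Types x u : R.

Lemma cube_le_expR x : `|x| ^+ 3 <= 6 * expR `|x|.
Proof.
have := @expR_ge1Dxn R `|x| 2 (normr_ge0 x).
rewrite (_ : 3`!%:R = 6 :> R)// => h.
by rewrite mulrC -ler_pdivrMr//; move: h; lra.
Qed.

(** The tail of the series is compared term by term with [|x| ^+ 3] times the full series at [|x|],
    using [k! <= (k + 3)!]. *)
Lemma expR_taylor2 x : `|expR x - 1 - x - x ^+ 2 / 2| <= `|x| ^+ 3 * expR `|x|.
Proof.
have cvg_exp (y : R) : series (exp_coeff y) n @[n --> \oo] --> expR y.
  exact: is_cvg_series_exp_coeff.
have partial n : `|series (exp_coeff x) n.+3 - 1 - x - x ^+ 2 / 2| <=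
    `|x| ^+ 3 * expR `|x|.
  have -> : series (exp_coeff x) n.+3 - 1 - x - x ^+ 2 / 2 =
      \sum_(0 <= k < n) x ^+ k.+3 / k.+3`!%:R.
    rewrite /series/= big_nat_recl// big_nat_recl// big_nat_recl//.
    rewrite /exp_coeff/= (_ : 0`! = 1%N)// (_ : 1`! = 1%N)// (_ : 2`! = 2%N)//.
    by rewrite expr0 expr1; field.
  rewrite (le_trans (ler_norm_sum _ _ _))//.
  apply: (@le_trans _ _ (`|x| ^+ 3 * series (exp_coeff `|x|) n)).
    rewrite /series/= mulr_sumr; apply: ler_sum => k _.
    rewrite /exp_coeff/= normrM normrX normfV (@ger0_norm _ (k.+3`!%:R))// mulrA -exprD add3n.
    rewrite ler_wpM2l ?exprn_ge0// lef_pV2 ?posrE ?ltr0n ?fact_gt0//.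
    by rewrite ler_nat; apply: leq_fact; rewrite -addn3 leq_addr.
  rewrite ler_wpM2l ?exprn_ge0//.
  have cs : cvgn (series (exp_coeff `|x|)) := is_cvg_series_exp_coeff _.
  apply: nondecreasing_cvgn_le => //; apply: nondecreasing_series => k _ _.
  exact: exp_coeff_ge0.
have c3 : series (exp_coeff x) n.+3 @[n --> \oo] --> expR x.
  by have := cvg_exp x; rewrite -(cvg_shiftn 3); under eq_fun do rewrite addn3.
apply: (@closed_cvg _ _ \oo _ (fun n => series (exp_coeff x) n.+3)
  [set y | `|y - 1 - x - x ^+ 2 / 2| <= `|x| ^+ 3 * expR `|x|]) => //.
- rewrite (_ : mkset _ = (fun y => `|y - 1 - x - x ^+ 2 / 2|) @^-1`
    [set y | y <= `|x| ^+ 3 * expR `|x|])//.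
  apply: closed_comp; last exact: closed_le.
  move=> y _; apply: cvg_norm; apply: cvgB; last exact: cvg_cst.
  by apply: cvgB; last exact: cvg_cst; apply: cvgB => //; exact: cvg_cst.
- exact: nearW.
Qed.

(** With [y = x ^+ 2 / 2 <= 1 / 2], [expR y <= (1 - y)^-1 <= 1 + y + 2 * y ^+ 2], and
    [2 * y ^+ 2 = x ^+ 4 / 2] is below the cube. *)
Lemma expR_half_sqr_taylor x : `|x| <= 1 ->
  `|expR (x ^+ 2 / 2) - 1 - x ^+ 2 / 2| <= `|x| ^+ 3.
Proof.
have sq : x ^+ 2 = `|x| ^+ 2 by rewrite real_normK ?num_real.
rewrite sq; have := normr_ge0 x; move: (`|x|) => t t0 t1.
set y := t ^+ 2 / 2; have y0 : 0 <= y by rewrite divr_ge0// sqr_ge0.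
have yle : y <= 2^-1 by rewrite /y; nra.
have y1 := expR_ge1Dx y; rewrite ger0_norm; last by lra.
have ey : expR y <= (1 - y)^-1.
  rewrite -[y in expR y]opprK expRN lef_pV2 ?posrE ?expR_gt0//; last by lra.
  exact: expR_ge1Dx.
have yV : (1 - y)^-1 <= 1 + y + 2 * y ^+ 2.
  rewrite -div1r ler_pdivrMr; last by lra.
  rewrite -subr_ge0 (_ : _ - 1 = y ^+ 2 * (1 - 2 * y)); last by ring.
  by rewrite mulr_ge0 ?sqr_ge0//; lra.
have : 2 * y ^+ 2 <= t ^+ 3.
  rewrite /y (_ : 2 * _ = t ^+ 3 * (t / 2)); last by field.
  by rewrite ler_piMr ?exprn_ge0//; lra.
by move: ey yV; move: (expR y) (_^-1) => u v; lra.
Qed.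

Lemma expR_le_quadratic x : `|x| <= 6^-1 -> expR x <= 1 + x + x ^+ 2.
Proof.
move=> x6; have := expR_taylor2 x.
have e2 : expR `|x| <= 3.
  rewrite -(opprK `|x|) expRN invf_ple ?posrE ?expR_gt0//.
  by have := expR_ge1Dx (- `|x|); lra.
have h : `|x| ^+ 3 * expR `|x| <= x ^+ 2 / 2.
  rewrite exprS -mulrA mulrCA real_normK ?num_real// ler_wpM2l ?sqr_ge0//.
  rewrite (@le_trans _ _ (6^-1 * 3))//; last by lra.
  by rewrite ler_pM// expR_ge0.
by rewrite ler_norml => /andP[_]; lra.
Qed.

(** The expansion of the exponential is applied to [y = ln (1 + u)]: it gives [u = y + y ^+ 2 / 2]
    up to [16 * |u| ^+ 3], and [y ^+ 2] is [u ^+ 2] up to [6 * |u| ^+ 3]. Both 16 + 6 / 2 and 6 are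
    below 31. *)
Lemma ln_taylor2 u : `|u| <= 2^-1 ->
  [/\ `|ln (1 + u)| <= 2 * `|u|,
      `|ln (1 + u) - (u - u ^+ 2 / 2)| <= 31 * `|u| ^+ 3 &
      `|ln (1 + u) ^+ 2 - u ^+ 2| <= 31 * `|u| ^+ 3].
Proof.
move=> u2; have /andP[ul uu] : - 2^-1 <= u <= 2^-1 by rewrite -ler_norml.
have u1 : 0 < 1 + u by lra.
set y := ln (1 + u); have Ey : expR y = 1 + u by rewrite lnK.
have yu : y <= u by apply: le_ln1Dx; lra.
have yl : u - 2 * u ^+ 2 <= y.
  rewrite -ler_expR Ey.
  suff : (1 + u)^-1 <= expR (- (u - 2 * u ^+ 2)).
    by rewrite expRN lef_pV2 ?posrE ?expR_gt0.
  apply: le_trans (expR_ge1Dx _).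
  rewrite -div1r ler_pdivrMr// -subr_ge0.
  rewrite (_ : _ - 1 = u ^+ 2 * (1 + 2 * u)); last by ring.
  by rewrite mulr_ge0 ?sqr_ge0//; lra.
have u0 : 0 <= `|u| := normr_ge0 u.
have sq : u ^+ 2 = `|u| ^+ 2 by rewrite real_normK ?num_real.
have sqh : u ^+ 2 <= `|u| / 2 by rewrite sq expr2 ler_wpM2l.
have y2 : `|y| <= 2 * `|u|.
  rewrite ler_norml; apply/andP; split.
    have := ler_norm (- u); rewrite normrN; lra.
  by have := ler_norm u; lra.
have ey2 : expR `|y| <= 2.
  have [y0|y0] := leP 0 y; first by rewrite ger0_norm// Ey; lra.
  rewrite ltr0_norm// expRN Ey -div1r ler_pdivrMr//; lra.
have h3 : `|u - y - y ^+ 2 / 2| <= 16 * `|u| ^+ 3.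
  have := expR_taylor2 y; rewrite Ey (_ : 1 + u - 1 - y = u - y); last by ring.
  move/le_trans; apply; rewrite (_ : 16 * _ = (2 * `|u|) ^+ 3 * 2); last by ring.
  by rewrite ler_pM ?exprn_ge0 ?expR_ge0// lerXn2r ?nnegrE// mulr_ge0.
have yu2 : `|y - u| <= 2 * `|u| ^+ 2.
  rewrite distrC ger0_norm ?subr_ge0// -sq; lra.
have sqd : `|y ^+ 2 - u ^+ 2| <= 6 * `|u| ^+ 3.
  rewrite subr_sqr normrM (_ : 6 * _ = (2 * `|u| ^+ 2) * (3 * `|u|)); last by ring.
  by rewrite ler_pM// (le_trans (ler_normD _ _))//; lra.
have c0 : 0 <= `|u| ^+ 3 by rewrite exprn_ge0.
split=> //; last by rewrite (le_trans sqd)//; lra.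
rewrite (_ : _ - _ = - (u - y - y ^+ 2 / 2) - (y ^+ 2 - u ^+ 2) / 2); last by field.
rewrite (le_trans (ler_normB _ _))// normrN normr_div2.
by move: h3 sqd; lra.
Qed.

End exponential_estimates.

(** * Moments of the centred normal law *)

Section normal_moments.
Context {R : realType}.

Lemma ge0_integral_normal_prob (m s : R) (g : R -> R) :
  measurable_fun setT g -> (forall x, 0 <= g x) ->
  (\int[normal_prob m s]_x (g x)%:E =
   \int[lebesgue_measure]_x (g x * normal_pdf m s x)%:E)%E.
Proof.
move=> mg g0.
have dom := normal_prob_dominates m s.
have mpdf := measurable_normal_pdf m s.
rewrite -(Radon_Nikodym_SigmaFinite.change_of_variables dom)//; last first.
  exact/measurable_EFinP.
have fint := Radon_Nikodym_SigmaFinite.f_integrable dom.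
apply: ae_eq_integral => //.
- apply: emeasurable_funM; first exact/measurable_EFinP.
  exact: measurable_int fint.
- by apply/measurable_EFinP; exact: measurable_funM.
- under [X in ae_eq _ _ _ X]eq_fun do rewrite EFinM.
  apply: ae_eqe_mul2l; apply: integral_ae_eq => //.
  + exact/measurable_EFinP.
  + by move=> E _ mE; rewrite -Radon_Nikodym_SigmaFinite.f_integral.
Qed.

(** Completing the square turns the integrand into a constant times the normal density centred at
    [lambda * s ^+ 2]. *)
Lemma expR_normal_prob (s lambda : R) : s != 0 ->
  (\int[normal_prob 0 s]_x (expR (lambda * x))%:E =
   (expR (lambda ^+ 2 * s ^+ 2 / 2))%:E)%E.
Proof.
move=> s0; have mexp : measurable_fun setT (fun x : R => expR (lambda * x)).
  by apply: measurableT_comp => //; exact: measurable_funM.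
rewrite ge0_integral_normal_prob//.
have -> : (fun x : R => (expR (lambda * x) * normal_pdf 0 s x)%:E) =
    (fun x => (expR (lambda ^+ 2 * s ^+ 2 / 2))%:E *
      (normal_pdf (lambda * s ^+ 2) s x)%:E)%E.
  apply/funext => x; rewrite -EFinM !normal_pdfE//; congr EFin.
  rewrite /normal_fun mulrCA [in RHS]mulrCA; congr (_ * _).
  by rewrite -!expRD; congr expR; rewrite -mulr_natr; field.
rewrite integralZl//; last exact: integrable_normal_pdf.
by rewrite integral_normal_pdf mule1.
Qed.

Context d (Omega : measurableType d) (P : probability Omega R).
Variables (D : {RV P >-> R}) (s : R).
Hypothesis s0 : 0 < s.
Hypothesis lawD : forall A, measurable A -> P (D @^-1` A) = normal_prob 0 s A.

Lemma normal_expR (lambda : R) :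
  P.-integrable setT (EFin \o (fun w => expR (lambda * D w))) /\
  \int[P]_w expR (lambda * D w) = expR (lambda ^+ 2 * s ^+ 2 / 2).
Proof.
have mexp : measurable_fun setT (fun x : R => expR (lambda * x)).
  by apply: measurableT_comp => //; exact: measurable_funM.
have E : (\int[P]_w (expR (lambda * D w))%:E =
    (expR (lambda ^+ 2 * s ^+ 2 / 2))%:E)%E.
  rewrite -expR_normal_prob ?gt_eqF//.
  have mE : measurable_fun setT (EFin \o (fun x : R => expR (lambda * x))).
    exact/measurable_EFinP.
  have E0 y : (0 <= (EFin \o (fun x : R => expR (lambda * x))) y)%E.
    by rewrite lee_fin expR_ge0.
  rewrite -(ge0_integral_distribution D mE E0).
  (* [normal_prob] is a measure on [measurableTypeR R], the law of [D] one on
     [R]: the same sigma-algebra with another display. *)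
  pose idR : measurableTypeR R -> R := id.
  have midR : measurable_fun setT idR by move=> _ A mA; rewrite setTI.
  transitivity (\int[pushforward (normal_prob 0 s) idR]_x
      (EFin \o (fun x : R => expR (lambda * x))) x)%E.
    by apply: eq_measure_integral => A mA _; exact: lawD.
  by rewrite ge0_integral_pushforward.
split; last by rewrite /Rintegral E.
apply/integrableP; split.
  by apply/measurable_EFinP; apply: measurableT_comp => //; exact: measurable_funM.
under eq_integral do rewrite /= ger0_norm ?expR_ge0//.
by rewrite E ltry.
Qed.

(** The cube of [|D / s|] is at most six times the sum of the exponentials of [D / s] and of its
    opposite; 48 = 6 * 2 * 4, with [expR 2^-1 <= 4]. *)
Lemma normal_cube :
  P.-integrable setT (EFin \o (fun w => `|D w| ^+ 3)) /\
  \int[P]_w (`|D w| ^+ 3) <= 48 * s ^+ 3.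
Proof.
have [i1 E1] := normal_expR (s^-1); have [i2 E2] := normal_expR (- s^-1).
have sV : s^-1 ^+ 2 * s ^+ 2 / 2 = 2^-1 by field; rewrite gt_eqF.
have e2 : expR 2^-1 <= 4 :> R.
  rewrite -[2^-1]opprK expRN invf_ple ?posrE ?expR_gt0//.
  by have := @expR_ge1Dx R (- 2^-1); lra.
have iB : P.-integrable setT (EFin \o (fun w =>
    6 * s ^+ 3 * (expR (s^-1 * D w) + expR (- s^-1 * D w)))).
  by apply: integrable_EFinZ; exact: integrable_EFinD.
have le3 w : `|D w| ^+ 3 <=
    6 * s ^+ 3 * (expR (s^-1 * D w) + expR (- s^-1 * D w)).
  have := cube_le_expR (s^-1 * D w).
  rewrite normrM exprMn normfV (gtr0_norm s0) exprVn.
  rewrite mulrC ler_pdivrMr ?exprn_gt0// => h; apply: (le_trans h).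
  have s3 : 0 <= 6 * s ^+ 3 by rewrite mulr_ge0// exprn_ge0// ltW.
  rewrite mulrAC ler_wpM2l//.
  have [h0|h0] := leP 0 (D w); first by rewrite ger0_norm// lerDl expR_ge0.
  by rewrite ltr0_norm// mulrN mulNr lerDr expR_ge0.
have i3 : P.-integrable setT (EFin \o (fun w => `|D w| ^+ 3)).
  apply: integrable_dominated iB; last by move=> w; rewrite ger0_norm ?exprn_ge0.
  by apply: measurable_funX; exact: measurableT_comp.
split=> //; apply: (le_trans (le_Rintegral measurableT i3 iB (fun w _ => le3 w))).
rewrite RintegralZl//; last exact: integrable_EFinD.
rewrite RintegralD// E1 E2 sqrrN sV.
have : 0 <= s ^+ 3 by rewrite exprn_ge0// ltW.
by move: e2; nra.
Qed.

(** Both moments are read off the Laplace transform. The bound [main] at [theta] and at [- theta]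
    separates the odd part from the even one, and letting [theta] tend to 0 makes each vanish. *)
Lemma normal_mean_variance : [/\ \int[P]_w D w = 0, \int[P]_w (D w ^+ 2) = s ^+ 2,
  P.-integrable setT (EFin \o D) &
  P.-integrable setT (EFin \o (fun w => D w ^+ 2))].
Proof.
have [i3 _] := normal_cube.
have iD : P.-integrable setT (EFin \o D).
  apply: (@integrable_comp_cube _ _ _ _ _ id 1) => // x; rewrite mul1r.
  have := normr_ge0 x; set t := `|x| => t0.
  by have [t1|t1] := leP t 1; nra.
have iD2 : P.-integrable setT (EFin \o (fun w => D w ^+ 2)).
  apply: (@integrable_comp_cube _ _ _ _ _ (fun x => x ^+ 2) 1) => // x.
  rewrite mul1r normrX; have := normr_ge0 x; set t := `|x| => t0.
  by have [t1|t1] := leP t 1; nra.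
set a := \int[P]_w D w / s; set v := \int[P]_w (D w ^+ 2) / s ^+ 2.
(* Second-order expansion in [theta] of both sides of
   [E exp (theta D / s) = exp (theta ^ 2 / 2)]. *)
have [C C0 main] : exists2 C, 0 < C & forall theta, `|theta| <= 1 ->
    `|theta * a + theta ^+ 2 * (v - 1) / 2| <= C * `|theta| ^+ 3.
  (* The exponential moment at [2 / s]: for [|theta| <= 1] the remainder is at most
     [6 * |theta| ^+ 3 * expR (2 * |D / s|)], which gives [12 * E2]. The extra 1 comes from
     expanding [expR (theta ^+ 2 / 2)]. *)
  pose E2 := expR (2 ^+ 2 * s^-1 ^+ 2 * s ^+ 2 / 2) : R.
  exists (12 * E2 + 1); first by rewrite addr_gt0// mulr_gt0// expR_gt0.
  move=> theta t1; have [it Et] := normal_expR (theta / s).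
  have [i1 E1] := normal_expR (2 / s); have [i1' E1'] := normal_expR (- (2 / s)).
  have sn0 : s != 0 by rewrite gt_eqF.
  have Et' : \int[P]_w expR (theta / s * D w) = expR (theta ^+ 2 / 2).
    by rewrite Et; congr expR; field.
  pose rem w := expR (theta / s * D w) - 1 - theta / s * D w -
    2^-1 * (theta / s) ^+ 2 * (D w ^+ 2).
  have irem : P.-integrable setT (EFin \o rem).
    apply: integrable_EFinB; last exact: integrable_EFinZ.
    apply: integrable_EFinB; last exact: integrable_EFinZ.
    by apply: integrable_EFinB => //; exact: integrable_EFin_cst.
  have Erem : \int[P]_w rem w =
      expR (theta ^+ 2 / 2) - 1 - theta * a - theta ^+ 2 * v / 2.
    rewrite /rem RintegralB//; last exact: integrable_EFinZ.
      rewrite RintegralB//; last exact: integrable_EFinZ.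
        rewrite RintegralB//; last exact: integrable_EFin_cst.
        rewrite !RintegralZl// Rintegral_probability_cst Et' /a /v.
        by field; rewrite sn0.
      by apply: integrable_EFinB => //; exact: integrable_EFin_cst.
    apply: integrable_EFinB; last exact: integrable_EFinZ.
    by apply: integrable_EFinB => //; exact: integrable_EFin_cst.
  have iB : P.-integrable setT (EFin \o (fun w => 6 * `|theta| ^+ 3 *
      (expR (2 / s * D w) + expR (- (2 / s) * D w)))).
    by apply: integrable_EFinZ; exact: integrable_EFinD.
  have rembound w : `|rem w| <= 6 * `|theta| ^+ 3 *
      (expR (2 / s * D w) + expR (- (2 / s) * D w)).
    have := expR_taylor2 (theta / s * D w).
    rewrite (_ : (_ / s * D w) ^+ 2 / 2 = 2^-1 * (theta / s) ^+ 2 * D w ^+ 2);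
      last by ring.
    move=> /le_trans; apply.
    have -> : theta / s * D w = theta * (s^-1 * D w) by rewrite mulrA.
    set z := s^-1 * D w.
    rewrite [6 * _]mulrC -[leRHS]mulrA normrM exprMn -[leLHS]mulrA.
    rewrite ler_wpM2l ?exprn_ge0//.
    have h : expR (`|theta| * `|z|) <= expR `|z| by rewrite ler_expR ler_piMl.
    apply: (@le_trans _ _ (6 * expR `|z| * expR `|z|)).
      by rewrite ler_pM ?exprn_ge0 ?expR_ge0 ?cube_le_expR.
    have ezz : expR `|z| * expR `|z| = expR (2 * `|z|).
      by rewrite -expRD; congr expR; ring.
    rewrite -[leLHS]mulrA ezz ler_wpM2l//.
    have -> : 2 / s * D w = 2 * z by rewrite mulrA.
    have -> : - (2 / s) * D w = - (2 * z) by rewrite mulNr mulrA.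
    have [z0|z0] := leP 0 z; first by rewrite ger0_norm// lerDl expR_ge0.
    by rewrite ltr0_norm// mulrN lerDr expR_ge0.
  have h1 : `|\int[P]_w rem w| <= 12 * E2 * `|theta| ^+ 3.
    apply: (le_trans (le_normr_Rintegral_bound irem iB rembound)).
    rewrite RintegralZl//; last exact: integrable_EFinD.
    rewrite RintegralD// E1 E1' sqrrN.
    have -> : expR ((2 / s) ^+ 2 * s ^+ 2 / 2) = E2.
      by rewrite /E2 exprMn.
    rewrite le_eqVlt; apply/orP; left; apply/eqP; ring.
  have h2 := expR_half_sqr_taylor t1.
  rewrite (_ : _ + _ = (expR (theta ^+ 2 / 2) - 1 - theta ^+ 2 / 2) -
    \int[P]_w rem w); last by rewrite Erem; field.
  by rewrite (le_trans (ler_normB _ _))// mulrDl mul1r addrC lerD.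
have small (x : R) K : 0 < K -> (forall t, 0 < t -> t <= 1 -> `|x| <= K * t) -> x = 0.
  move=> K0 xK; apply/eqP; rewrite -normr_le0; apply/ler_addgt0Pr => e e0.
  rewrite add0r; have [le1|gt1] := leP (e / K) 1.
    have := xK (e / K); rewrite divr_gt0// => /(_ isT le1).
    by rewrite mulrCA divff ?gt_eqF// mulr1.
  have := xK 1 ltr01 (lexx _); rewrite mulr1 => /le_trans; apply.
  by move: gt1; rewrite ltr_pdivlMr// mul1r => /ltW.
have ab t : 0 < t -> t <= 1 -> `|a| <= C * t ^+ 2 /\ `|v - 1| <= 2 * C * t.
  move=> t0 t1.
  have h1 : `|t * a + t ^+ 2 * (v - 1) / 2| <= C * t ^+ 3.
    by have := main t; rewrite gtr0_norm// => /(_ t1).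
  have h2 : `|- t * a + t ^+ 2 * (v - 1) / 2| <= C * t ^+ 3.
    by have := main (- t); rewrite normrN gtr0_norm// sqrrN => /(_ t1).
  split.
    rewrite -(ler_pM2l t0) -[X in X * `|a|](gtr0_norm t0) -normrM.
    rewrite (_ : t * (C * t ^+ 2) = C * t ^+ 3); last by ring.
    rewrite (_ : t * a = ((t * a + t ^+ 2 * (v - 1) / 2) -
      (- t * a + t ^+ 2 * (v - 1) / 2)) / 2); last by field.
    by rewrite normr_div2 (le_trans (ler_wpM2r _ (ler_normB _ _)))//; lra.
  have t20 : 0 < t ^+ 2 by rewrite exprn_gt0.
  rewrite -(ler_pM2l t20) -[X in X * `|v - 1|](gtr0_norm t20) -normrM.
  rewrite (_ : t ^+ 2 * (2 * C * t) = 2 * C * t ^+ 3); last by ring.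
  rewrite (_ : t ^+ 2 * (v - 1) = (t * a + t ^+ 2 * (v - 1) / 2) +
    (- t * a + t ^+ 2 * (v - 1) / 2)); last by field.
  by rewrite (le_trans (ler_normD _ _))//; lra.
have a0 : a = 0.
  apply: (small _ C C0) => t t0 t1; have [h _] := ab t t0 t1.
  by rewrite (le_trans h)// ler_wpM2l ?(ltW C0)// expr2 ger_pMr.
have v1 : v - 1 = 0.
  by apply: (small _ (2 * C)); [rewrite mulr_gt0|move=> t t0 t1; have [] := ab t t0 t1].
split=> //.
  by move/eqP: a0; rewrite mulf_eq0 invr_eq0 (gt_eqF s0) orbF => /eqP.
move/eqP: v1; rewrite subr_eq0 /v => /eqP h.
by rewrite -[LHS](divfK (_ : s ^+ 2 != 0)) ?h ?mul1r// expf_neq0// gt_eqF.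
Qed.

End normal_moments.

(** * Logarithmic returns *)

Lemma sqrt_nat_ge1 {R : realType} (n : nat) : (0 < n)%N ->
  1 <= Num.sqrt n%:R :> R.
Proof. by move=> n0; rewrite -[leLHS]sqrtr1 ler_wsqrtr// ler1n. Qed.

Section log_return.
Context {R : realType} (mu sigma f C : R).
Hypotheses (mu0 : 0 <= mu) (sigma0 : 0 <= sigma) (C0 : 0 <= C)
  (f01 : 0 <= f <= 1).

(** The bound on the variables being only almost sure, clamping makes every return small at every
    point for large [n], so that the logarithm is bounded there. *)
Definition clamp (x : R) : R := Num.max (- C) (Num.min C x).

Definition log_return (n : nat) (x : R) : R :=
  ln (1 + f * rate mu sigma n (clamp x)).

Definition log_drift : R := f * mu - f ^+ 2 * sigma ^+ 2 / 2.

Definition return_scale : R := mu + sigma * C.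

(** The first term is the error of [ln_taylor2], the second the square of the drift [f * mu / n],
    present in the second moment of the return. *)
Definition moment_constant : R := 31 * return_scale ^+ 3 + mu ^+ 2.

Lemma clamp_bound x : `|clamp x| <= C.
Proof.
rewrite ler_norml /clamp le_max lexx/= ge_max ge_min lexx/= andbT.
by rewrite lerNl (le_trans _ C0)// oppr_le0.
Qed.

Lemma clamp_id x : `|x| <= C -> clamp x = x.
Proof. by rewrite ler_norml => /andP[h1 h2]; rewrite /clamp min_r// max_r. Qed.

Lemma measurable_clamp : measurable_fun setT clamp.
Proof. by apply: measurable_maxr => //; exact: measurable_minr. Qed.

Lemma measurable_log_return n : measurable_fun setT (log_return n).
Proof.
apply: measurableT_comp => //; apply: measurable_funD => //.
apply: measurable_funM => //; apply: measurable_funD => //.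
by apply: measurable_funM => //; exact: measurable_clamp.
Qed.

Lemma return_scale_ge0 : 0 <= return_scale.
Proof. by rewrite addr_ge0// mulr_ge0. Qed.

Lemma rate_bound (n : nat) x : (0 < n)%N ->
  `|f * rate mu sigma n (clamp x)| <= return_scale / Num.sqrt n%:R.
Proof.
move=> n0; have [f0 f1] := andP f01.
have q0 : 0 < Num.sqrt n%:R :> R by rewrite sqrtr_gt0 ltr0n.
have q1 : 1 <= Num.sqrt n%:R :> R by exact: sqrt_nat_ge1.
have nq : n%:R = Num.sqrt n%:R * Num.sqrt n%:R :> R.
  by rewrite -expr2 sqr_sqrtr.
rewrite normrM (ger0_norm f0) (@le_trans _ _ `|rate mu sigma n (clamp x)|)//.
  by rewrite ler_piMl.
rewrite /rate /return_scale mulrDl (le_trans (ler_normD _ _))// lerD//.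
  rewrite normrM normfV !ger0_norm// ler_wpM2l// lef_pV2 ?posrE ?ltr0n//.
  by rewrite [leRHS]nq ler_peMl// ltW.
rewrite normrM (ger0_norm (divr_ge0 sigma0 (ltW q0))) mulrAC.
by rewrite ler_wpM2r ?invr_ge0 ?(ltW q0)// ler_wpM2l// clamp_bound.
Qed.

Lemma log_return_bound (n : nat) x : (0 < n)%N ->
  return_scale / Num.sqrt n%:R <= 2^-1 ->
  `|log_return n x| <= 2 * (return_scale / Num.sqrt n%:R).
Proof.
move=> n0 qn; have ub := rate_bound x n0.
have [h _ _] := ln_taylor2 (le_trans ub qn).
by rewrite (le_trans h)// ler_wpM2l.
Qed.

Context d (Omega : measurableType d) (P : probability Omega R)
  (xi : Omega -> R).
Hypotheses (mxi : measurable_fun setT xi)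
  (mean0 : \int[P]_w clamp (xi w) = 0)
  (var1 : \int[P]_w (clamp (xi w) ^+ 2) = 1).

(** With [q] the inverse square root of [n], the return is [u = f * mu * q ^+ 2 + f * sigma * q *
    eta]. Its first two moments are exact, the logarithm is [u - u ^+ 2 / 2] up to a cube, and the
    square of the drift, of order [q ^+ 4], joins the error. *)
Lemma log_return_moments (n : nat) : (0 < n)%N ->
    return_scale / Num.sqrt n%:R <= 2^-1 ->
  [/\ `|\int[P]_w log_return n (xi w) - log_drift / n%:R| <=
        moment_constant / Num.sqrt n%:R ^+ 3,
      `|\int[P]_w (log_return n (xi w) ^+ 2) - (f * sigma) ^+ 2 / n%:R| <=
        moment_constant / Num.sqrt n%:R ^+ 3,
      \int[P]_w (`|log_return n (xi w)| ^+ 3) <=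
        moment_constant / Num.sqrt n%:R ^+ 3 &
      P.-integrable setT (EFin \o (fun w => `|log_return n (xi w)| ^+ 3))].
Proof.
move=> n0 cn; have [f0 f1] := andP f01.
set q := (Num.sqrt n%:R : R)^-1.
have sn0 : 0 < Num.sqrt n%:R :> R by rewrite sqrtr_gt0 ltr0n.
have q0 : 0 <= q by rewrite invr_ge0 ltW.
have q1 : q <= 1.
  by rewrite invf_le1// sqrt_nat_ge1.
have nq : n%:R^-1 = q ^+ 2 by rewrite /q exprVn sqr_sqrtr.
rewrite -exprVn -/q nq.
have q3 : 0 <= q ^+ 3 by rewrite exprn_ge0.
have q43 : q ^+ 4 <= q ^+ 3 by rewrite [leLHS]exprS ler_piMl.
have c0 := return_scale_ge0; set c := return_scale in c0 cn *.
have c3 : 0 <= c ^+ 3 by rewrite exprn_ge0.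
pose eta w := clamp (xi w); pose u w := f * rate mu sigma n (eta w).
have uE w : u w = f * mu * q ^+ 2 + f * sigma * q * eta w.
  by rewrite /u /rate nq -/q; ring.
have uc w : `|u w| <= c * q by exact: rate_bound.
have u2 w : `|u w| <= 2^-1 by exact: le_trans (uc w) cn.
have uc3 w : `|u w| ^+ 3 <= c ^+ 3 * q ^+ 3.
  by rewrite -exprMn lerXn2r ?nnegrE// mulr_ge0.
have meta : measurable_fun setT eta by exact: measurableT_comp measurable_clamp mxi.
have ieta : P.-integrable setT (EFin \o eta).
  by apply: bounded_integrable meta _ => w; exact: clamp_bound.
have meta2 : measurable_fun setT (fun w => eta w ^+ 2) by exact: measurable_funX.
have ieta2 : P.-integrable setT (EFin \o (fun w => eta w ^+ 2)).
  apply: (@bounded_integrable _ _ _ _ _ (C ^+ 2)) => // w.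
  by rewrite normrX lerXn2r ?nnegrE// clamp_bound.
have mu_ : measurable_fun setT u.
  apply: measurable_funM => //; apply: measurable_funD => //.
  exact: measurable_funM.
have iu : P.-integrable setT (EFin \o u).
  exact: (bounded_integrable P mu_ uc).
have iu2 : P.-integrable setT (EFin \o (fun w => u w ^+ 2)).
  apply: (@bounded_integrable _ _ _ _ _ ((c * q) ^+ 2)); first exact: measurable_funX.
  by move=> w; rewrite normrX lerXn2r ?nnegrE// mulr_ge0.
have meta0 : \int[P]_w eta w = 0 by exact: mean0.
have meta1 : \int[P]_w (eta w ^+ 2) = 1 by exact: var1.
have Eu : \int[P]_w u w = f * mu * q ^+ 2.
  under eq_Rintegral do rewrite uE.
  rewrite RintegralD//; [|exact: integrable_EFin_cst|exact: integrable_EFinZ].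
  by rewrite Rintegral_probability_cst RintegralZl// meta0 mulr0 addr0.
have Eu2 : \int[P]_w (u w ^+ 2) =
    (f * mu * q ^+ 2) ^+ 2 + (f * sigma) ^+ 2 * q ^+ 2.
  have eu w : u w ^+ 2 = (f * mu * q ^+ 2) ^+ 2 +
      (2 * (f * mu * q ^+ 2) * (f * sigma * q) * eta w +
       (f * sigma * q) ^+ 2 * eta w ^+ 2) by rewrite uE; ring.
  under eq_Rintegral do rewrite eu.
  have i1 : P.-integrable setT (EFin \o (fun w =>
      2 * (f * mu * q ^+ 2) * (f * sigma * q) * eta w)) by exact: integrable_EFinZ.
  have i2 : P.-integrable setT (EFin \o (fun w =>
      (f * sigma * q) ^+ 2 * eta w ^+ 2)) by exact: integrable_EFinZ.
  rewrite RintegralD//; [|exact: integrable_EFin_cst|exact: integrable_EFinD].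
  rewrite Rintegral_probability_cst RintegralD// !RintegralZl// meta0 meta1.
  by ring.
pose L w := log_return n (xi w).
have mL : measurable_fun setT L by exact: measurableT_comp (measurable_log_return n) mxi.
have Lb w : `|L w| <= 2 * (c * q) by exact: log_return_bound.
have iL : P.-integrable setT (EFin \o L) by exact: (bounded_integrable P mL Lb).
have iL2 : P.-integrable setT (EFin \o (fun w => L w ^+ 2)).
  apply: (@bounded_integrable _ _ _ _ _ ((2 * (c * q)) ^+ 2)); first exact: measurable_funX.
  by move=> w; rewrite normrX lerXn2r ?nnegrE// !mulr_ge0.
have mL3 : measurable_fun setT (fun w => `|L w| ^+ 3).
  by apply: measurable_funX; exact: measurableT_comp.
have L3b w : `|L w| ^+ 3 <= 8 * (c ^+ 3 * q ^+ 3).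
  rewrite (_ : 8 * _ = (2 * (c * q)) ^+ 3); last by ring.
  by rewrite lerXn2r ?nnegrE// !mulr_ge0.
have iL3 : P.-integrable setT (EFin \o (fun w => `|L w| ^+ 3)).
  apply: (@bounded_integrable _ _ _ _ _ (8 * (c ^+ 3 * q ^+ 3))) => // w.
  by rewrite ger0_norm ?exprn_ge0.
have icst r := integrable_EFin_cst P r.
have Lu1 w : `|L w - (u w - 2^-1 * u w ^+ 2)| <= 31 * (c ^+ 3 * q ^+ 3).
  have [_ h _] := ln_taylor2 (u2 w).
  by rewrite [2^-1 * _]mulrC (le_trans h)// ler_wpM2l.
have Lu2 w : `|L w ^+ 2 - u w ^+ 2| <= 31 * (c ^+ 3 * q ^+ 3).
  by have [_ _ h] := ln_taylor2 (u2 w); rewrite (le_trans h)// ler_wpM2l.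
have iu2' : P.-integrable setT (EFin \o (fun w => 2^-1 * u w ^+ 2)).
  exact: integrable_EFinZ.
have iuu : P.-integrable setT (EFin \o (fun w => u w - 2^-1 * u w ^+ 2)).
  exact: integrable_EFinB.
have E1 : `|\int[P]_w L w - (f * mu * q ^+ 2 - 2^-1 * \int[P]_w (u w ^+ 2))| <=
    31 * (c ^+ 3 * q ^+ 3).
  rewrite -Eu -RintegralZl// -RintegralB// -RintegralB//.
  rewrite -[leRHS](Rintegral_probability_cst P).
  by apply: le_normr_Rintegral_bound => //; exact: integrable_EFinB.
have E2 : `|\int[P]_w (L w ^+ 2) - \int[P]_w (u w ^+ 2)| <= 31 * (c ^+ 3 * q ^+ 3).
  rewrite -RintegralB// -[leRHS](Rintegral_probability_cst P).
  by apply: le_normr_Rintegral_bound => //; exact: integrable_EFinB.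
have fm : 0 <= (f * mu * q ^+ 2) ^+ 2 <= mu ^+ 2 * q ^+ 3.
  rewrite sqr_ge0/= (_ : (f * mu * q ^+ 2) ^+ 2 = (f * mu) ^+ 2 * q ^+ 4); last by ring.
  rewrite ler_pM ?sqr_ge0 ?exprn_ge0//.
  by rewrite lerXn2r ?nnegrE ?mulr_ge0// ler_piMl.
have mq : 0 <= mu ^+ 2 * q ^+ 3 by rewrite mulr_ge0 ?sqr_ge0.
have cq : 0 <= c ^+ 3 * q ^+ 3 by rewrite mulr_ge0.
have -> : moment_constant * q ^+ 3 = 31 * (c ^+ 3 * q ^+ 3) + mu ^+ 2 * q ^+ 3.
  by rewrite /moment_constant -/c; ring.
split=> //.
- rewrite (_ : _ - _ = (\int[P]_w L w - (f * mu * q ^+ 2 -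
      2^-1 * \int[P]_w (u w ^+ 2))) - (f * mu * q ^+ 2) ^+ 2 / 2); last first.
    by rewrite Eu2 /log_drift /L; field.
  rewrite (le_trans (ler_normB _ _))// lerD// normr_div2.
  by case/andP: fm => h1 h2; rewrite ger0_norm//; lra.
- rewrite (_ : _ - _ = (\int[P]_w (L w ^+ 2) - \int[P]_w (u w ^+ 2)) +
      (f * mu * q ^+ 2) ^+ 2); last first.
    by rewrite Eu2 /L; ring.
  rewrite (le_trans (ler_normD _ _))// lerD//.
  by case/andP: fm => h1 h2; rewrite ger0_norm.
- apply: (@le_trans _ _ (8 * (c ^+ 3 * q ^+ 3))); last by lra.
  rewrite -[leRHS](Rintegral_probability_cst P).
  by apply: le_Rintegral => // w _; exact: L3b.
Qed.

(** The condition on [lambda] allows the bound of [expR x] by [1 + x + x ^+ 2]; the two moments are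
    inserted, and [1 + y <= expR y] concludes. *)
Lemma log_return_expR (n : nat) (lambda : R) : (0 < n)%N ->
    return_scale / Num.sqrt n%:R <= 2^-1 ->
    `|lambda| * (2 * (return_scale / Num.sqrt n%:R)) <= 6^-1 ->
  \int[P]_w expR (lambda * log_return n (xi w)) <=
  expR ((`|lambda| + lambda ^+ 2) *
    (`|log_drift| + (f * sigma) ^+ 2 + moment_constant) / n%:R).
Proof.
move=> n0 cn ln6.
have [E1 E2 _ i3] := log_return_moments n0 cn.
pose L w := log_return n (xi w).
have mL : measurable_fun setT L by exact: measurableT_comp (measurable_log_return n) mxi.
have Lb w : `|L w| <= 2 * (return_scale / Num.sqrt n%:R) by exact: log_return_bound.
have iL : P.-integrable setT (EFin \o L) by exact: (bounded_integrable P mL Lb).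
have iL2 : P.-integrable setT (EFin \o (fun w => L w ^+ 2)).
  apply: (@bounded_integrable _ _ _ _ _ ((2 * (return_scale / Num.sqrt n%:R)) ^+ 2)).
    exact: measurable_funX.
  move=> w; rewrite normrX lerXn2r ?nnegrE//.
  exact: le_trans (Lb w).
have lL w : `|lambda * L w| <= 6^-1.
  by rewrite normrM (le_trans _ ln6)// ler_wpM2l.
have i1 : P.-integrable setT (EFin \o (fun w => lambda * L w)) by exact: integrable_EFinZ.
have i2 : P.-integrable setT (EFin \o (fun w => lambda ^+ 2 * L w ^+ 2)).
  exact: integrable_EFinZ.
have icst := integrable_EFin_cst P 1.
have iq : P.-integrable setT (EFin \o
    (fun w => 1 + (lambda * L w + lambda ^+ 2 * L w ^+ 2))).
  by apply: integrable_EFinD => //; exact: integrable_EFinD.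
have h : \int[P]_w expR (lambda * L w) <=
    1 + (lambda * \int[P]_w L w + lambda ^+ 2 * \int[P]_w (L w ^+ 2)).
  rewrite -!RintegralZl// -RintegralD// -[X in X + _](Rintegral_probability_cst P).
  rewrite -RintegralD//; last exact: integrable_EFinD.
  apply: le_Rintegral => //.
    apply: (@bounded_integrable _ _ _ _ _ (expR 6^-1)).
      by apply: measurableT_comp => //; exact: measurable_funM.
    by move=> w; rewrite ger0_norm ?expR_ge0// ler_expR (le_trans (ler_norm _)).
  move=> w _; rewrite (le_trans (expR_le_quadratic (lL w)))// exprMn addrA.
  by rewrite lerD2l.
apply: (le_trans h); apply: le_trans (expR_ge1Dx _); rewrite lerD2l.
have sn0 : 0 < Num.sqrt n%:R :> R by rewrite sqrtr_gt0 ltr0n.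
have sn1 : 1 <= Num.sqrt n%:R :> R by exact: sqrt_nat_ge1.
have n0' : 0 < n%:R :> R by rewrite ltr0n.
have A0 : 0 <= moment_constant.
  by rewrite addr_ge0 ?sqr_ge0// mulr_ge0// exprn_ge0// return_scale_ge0.
have An : moment_constant / Num.sqrt n%:R ^+ 3 <= moment_constant / n%:R.
  rewrite ler_wpM2l// lef_pV2 ?posrE ?exprn_gt0// -[leLHS]sqr_sqrtr//.
  by rewrite [leRHS]exprS ler_peMl// exprn_ge0// ltW.
have nV : 0 <= n%:R^-1 :> R by rewrite invr_ge0 ltW.
have e1 : `|\int[P]_w L w| <= (`|log_drift| + moment_constant) / n%:R.
  rewrite mulrDl -[X in `|X|](subrK (log_drift / n%:R)).
  rewrite (le_trans (ler_normD _ _))// addrC lerD//; last exact: le_trans An.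
  by rewrite normrM (ger0_norm nV).
have e2 : \int[P]_w (L w ^+ 2) <= ((f * sigma) ^+ 2 + moment_constant) / n%:R.
  rewrite mulrDl -lerBlDl; apply: le_trans An; apply: le_trans E2.
  exact: ler_norm.
have ld0 : 0 <= `|log_drift| / n%:R by rewrite mulr_ge0.
have fs0 : 0 <= (f * sigma) ^+ 2 / n%:R by rewrite mulr_ge0// sqr_ge0.
rewrite -mulrA mulrDl lerD//.
  rewrite (le_trans (ler_norm _))// normrM ler_wpM2l// (le_trans e1)//.
  by rewrite ler_wpM2r// addrAC lerDl sqr_ge0.
rewrite ler_wpM2l ?sqr_ge0// (le_trans e2)// ler_wpM2r//.
by rewrite -addrA lerDr.
Qed.

End log_return.

Section clamped_moments.
Context {R : realType} d (Omega : measurableType d) (P : probability Omega R)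
  (xi : {RV P >-> R}) (C0 : R).
Hypothesis xi_bound : {ae P, forall w, `|xi w| <= C0}.

Lemma ae_clamp : {ae P, forall w, clamp `|C0| (xi w) = xi w}.
Proof.
apply: filterS xi_bound => w h; apply: clamp_id.
by rewrite (le_trans h)// ler_norm.
Qed.

Let mclamp : measurable_fun setT (fun w => clamp `|C0| (xi w)).
Proof. exact: measurableT_comp (measurable_clamp _) _. Qed.

Lemma Rintegral_clamp (h : R -> R) : measurable_fun setT h ->
  \int[P]_w h (clamp `|C0| (xi w)) = \int[P]_w h (xi w).
Proof.
move=> mh; congr fine; apply: ae_eq_integral => //.
- by apply/measurable_EFinP; exact: measurableT_comp.
- by apply/measurable_EFinP; exact: measurableT_comp.
- by apply: filterS ae_clamp => w -> _.
Qed.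

Lemma Rintegral_clamp_mean : ('E_P[xi] = 0)%E ->
  \int[P]_w clamp `|C0| (xi w) = 0.
Proof. by rewrite unlock (Rintegral_clamp (h := id))// /Rintegral => ->. Qed.

Lemma Rintegral_clamp_var : ('E_P[xi] = 0)%E -> ('V_P[xi] = 1)%E ->
  \int[P]_w (clamp `|C0| (xi w) ^+ 2) = 1.
Proof.
move=> E0; rewrite /variance unlock E0 unlock => V1.
rewrite (Rintegral_clamp (h := fun x => x ^+ 2))//.
rewrite /Rintegral -[RHS]/(fine 1%E) -V1; congr fine.
by apply: eq_integral => w _; rewrite !fctE /= subr0.
Qed.

End clamped_moments.

(** * Increments of the Brownian motion with drift *)

Section brownian_increments.
Context {R : realType} d (Omega : measurableType d) (P : probability Omega R)
  (B : R -> {RV P >-> R}) (hB : brownian_motion B) (beta v h : R).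
Hypothesis h0 : 0 < h.

Definition drifted_increment (k : nat) (w : Omega) : R :=
  beta * h + v * (B (k.+1%:R * h) w - B (k%:R * h) w).

Lemma indep_seq_drifted_increment : indep_seq P drifted_increment.
Proof.
pose t (k : nat) : R := k%:R * h.
have H : independent_RVs P setT (fun k => B (t k.+1) \- B (t k)).
  apply: (brownian_indep hB) => [|i j ij]; first by rewrite /t mul0r.
  by rewrite /t ler_pM2r// ler_nat.
have mD k : measurable_fun setT (B (t k.+1) \- B (t k)) by exact: measurable_funB.
have iD := independent_RVs_indep_seq (@inj_id nat) (fun=> I) mD H.
have mpsi : measurable_fun setT (fun x : R => beta * h + v * x).
  by apply: measurable_funD => //; exact: measurable_funM.
exact: indep_seq_comp mpsi iD.
Qed.

(** The first two moments agree exactly with those of the binomial increment, so only third moments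
    remain: 4 and 192 = 4 * 48 for the increment, 1 for the walk, rounded up to 200. *)
Lemma drifted_increment_moments : third_moments P drifted_increment /\
  forall k, moment_error P drifted_increment k (beta * h) (v * Num.sqrt h) <=
    200 * (`|beta * h| + `|v * Num.sqrt h|) ^+ 3.
Proof.
have sh0 : 0 < Num.sqrt h by rewrite sqrtr_gt0.
have main k : P.-integrable setT (EFin \o (fun w => `|drifted_increment k w| ^+ 3)) /\
  moment_error P drifted_increment k (beta * h) (v * Num.sqrt h) <=
    200 * (`|beta * h| + `|v * Num.sqrt h|) ^+ 3.
  pose D : {RV P >-> R} := B (k.+1%:R * h) \- B (k%:R * h).
  have lawD A : measurable A -> P (D @^-1` A) = normal_prob 0 (Num.sqrt h) A.
    have t0 : 0 <= k%:R * h by rewrite mulr_ge0// ltW.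
    have t1 : k%:R * h < k.+1%:R * h by rewrite ltr_pM2r// ltr_nat.
    move=> mA; have := brownian_normal hB t0 t1 mA.
    have -> // : k.+1%:R * h - k%:R * h = h by rewrite -natr1; ring.
  have [ED ED2 iD iD2] := normal_mean_variance sh0 lawD.
  have [iD3 ED3] := normal_cube sh0 lawD.
  set c := beta * h; have cE w : drifted_increment k w = c + v * D w by [].
  have m3 : measurable_fun setT (fun w => `|drifted_increment k w| ^+ 3).
    apply: measurable_funX; apply: measurableT_comp => //.
    apply: measurable_funD => //; apply: measurable_funM => //.
    exact: measurable_funB.
  have icst r := integrable_EFin_cst P r.
  have vD : P.-integrable setT (EFin \o (fun w => v * D w)) by exact: integrable_EFinZ.
  have le3 w : `|drifted_increment k w| ^+ 3 <= 4 * `|c| ^+ 3 + 4 * `|v| ^+ 3 * `|D w| ^+ 3.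
    rewrite cE; apply: (@le_trans _ _ ((`|c| + `|v| * `|D w|) ^+ 3)).
      by rewrite lerXn2r ?nnegrE ?addr_ge0 ?mulr_ge0// -normrM ler_normD.
    rewrite -[4 * _ ^+ 3 * _]mulrA -exprMn.
    have : 0 <= `|v| * `|D w| by rewrite mulr_ge0.
    move: (`|v| * `|D w|) (normr_ge0 c) => y; move: (`|c|) => x x0 y0.
    rewrite -subr_ge0 (_ : _ - _ = 3 * (x + y) * (x - y) ^+ 2); last by ring.
    by rewrite mulr_ge0 ?sqr_ge0// mulr_ge0// addr_ge0.
  have i3b : P.-integrable setT (EFin \o
      (fun w => 4 * `|c| ^+ 3 + 4 * `|v| ^+ 3 * `|D w| ^+ 3)).
    by apply: integrable_EFinD => //; exact: integrable_EFinZ.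
  have i3 : P.-integrable setT (EFin \o (fun w => `|drifted_increment k w| ^+ 3)).
    apply: integrable_dominated i3b => // w.
    by rewrite ger0_norm ?exprn_ge0.
  split=> //.
  have E1 : \int[P]_w drifted_increment k w = c.
    under eq_Rintegral do rewrite cE.
    by rewrite RintegralD// Rintegral_probability_cst RintegralZl// ED mulr0 addr0.
  have E2 : \int[P]_w (drifted_increment k w ^+ 2) = c ^+ 2 + (v * Num.sqrt h) ^+ 2.
    have sqE w : drifted_increment k w ^+ 2 =
        c ^+ 2 + (2 * c * v * D w + v ^+ 2 * D w ^+ 2) by rewrite cE; ring.
    under eq_Rintegral do rewrite sqE.
    have j1 : P.-integrable setT (EFin \o (fun w => 2 * c * v * D w)).
      exact: integrable_EFinZ.
    have j2 : P.-integrable setT (EFin \o (fun w => v ^+ 2 * D w ^+ 2)).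
      exact: integrable_EFinZ.
    rewrite RintegralD//; last exact: integrable_EFinD.
    rewrite Rintegral_probability_cst RintegralD// !RintegralZl// ED ED2.
    by ring.
  have E3 : \int[P]_w (`|drifted_increment k w| ^+ 3) <=
      4 * `|c| ^+ 3 + 192 * `|v * Num.sqrt h| ^+ 3.
    apply: (le_trans (le_Rintegral measurableT i3 i3b (fun w _ => le3 w))).
    rewrite RintegralD//; last exact: integrable_EFinZ.
    rewrite Rintegral_probability_cst RintegralZl// lerD2l.
    rewrite normrM (ger0_norm (ltW sh0)) exprMn.
    rewrite (_ : 192 * _ = 4 * `|v| ^+ 3 * (48 * Num.sqrt h ^+ 3)); last by ring.
    by rewrite ler_wpM2l// mulr_ge0// exprn_ge0.
  rewrite /moment_error E1 E2 !subrr normr0 mul0r !add0r.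
  have : 0 <= `|v * Num.sqrt h| by []; have : 0 <= `|c| by [].
  move: E3; move: (\int[P]_w _) (`|v * _|) (`|c|) => I3 y x E3 x0 y0.
  have xy : x ^+ 3 + y ^+ 3 <= (x + y) ^+ 3.
    rewrite -subr_ge0 (_ : _ - _ = 3 * (x * y * (x + y))); last by ring.
    by rewrite !mulr_ge0// addr_ge0.
  have x3 : 0 <= x ^+ 3 by rewrite exprn_ge0.
  have y3 : 0 <= y ^+ 3 by rewrite exprn_ge0.
  by move: E3 xy x3 y3; move: (x ^+ 3) (y ^+ 3) ((x + y) ^+ 3) => a b e; lra.
by split=> k; have [] := main k.
Qed.

Lemma block_sum_drifted_increment (a l : nat) w :
  block_sum drifted_increment a l w =
  beta * (l%:R * h) + v * (B ((a + l)%:R * h) w - B (a%:R * h) w).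
Proof.
elim: l => [|l IH].
  by rewrite /block_sum addn0 big_geq// mul0r mulr0 subrr mulr0 addr0.
rewrite block_sumS IH /drifted_increment addnS -[l.+1%:R]natr1; ring.
Qed.

End brownian_increments.

(** * Central limit theorem for block sums *)

Lemma div_sqrt_nat_near {R : realType} (C e : R) : 0 < e ->
  \forall n \near \oo, C / Num.sqrt n%:R < e.
Proof.
move=> e0; near=> n.
have n0 : (0 < n)%N by near: n; exact: nbhs_infty_gt.
have sn0 : 0 < Num.sqrt n%:R :> R by rewrite sqrtr_gt0 ltr0n.
rewrite ltr_pdivrMr// -ltr_pdivrMl// mulrC (le_lt_trans (ler_norm _))//.
rewrite -(@ltr_pXn2r _ 2)// ?nnegrE ?(ltW sn0)// sqr_sqrtr//.
near: n; exact: nbhs_infty_gtr.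
Unshelve. all: by end_near. Qed.

Section block_length.
Context {R : realType} (T : R) (N : nat).
Hypotheses (T0 : 0 < T) (N0 : (0 < N)%N).

Definition block_len (n : nat) : nat := Num.truncn (n%:R * T / N%:R).

(** Close to [n^-1], but chosen so that [block_len n] steps fill a cell of length [T / N]
    exactly. *)
Definition block_step (n : nat) : R := T / (N%:R * (block_len n)%:R).

Let NR : 0 < N%:R :> R. Proof. by rewrite ltr0n. Qed.

Lemma block_len_le n : (N * block_len n)%:R <= n%:R * T.
Proof.
rewrite natrM mulrC -ler_pdivlMr// truncn_le.
by rewrite divr_ge0// mulr_ge0// ltW.
Qed.

Lemma block_len_gt n : n%:R * T < (N * (block_len n).+1)%:R.
Proof. by rewrite natrM [ltRHS]mulrC -ltr_pdivrMr// truncnS_gt. Qed.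

Lemma block_len_near (m : nat) : \forall n \near \oo, (m <= block_len n)%N.
Proof.
near=> n; rewrite /block_len truncn_ge_nat; last first.
  by rewrite divr_ge0// mulr_ge0// ltW.
rewrite ler_pdivlMr// -ler_pdivrMr//; near: n; exact: nbhs_infty_ger.
Unshelve. all: by end_near. Qed.

(** The third bound says that the time lost to rounding over a whole block is at most [n^-1]: the
    integer part removes less than one step. *)
Lemma block_step_bounds n : (0 < n)%N -> (0 < block_len n)%N ->
  [/\ 0 < block_step n, block_step n <= 2 / n%:R,
      (block_len n)%:R * `|n%:R^-1 - block_step n| <= n%:R^-1 &
      (block_len n)%:R <= T / N%:R * n%:R].
Proof.
move=> n0 l0; have := block_len_le n; have := block_len_gt n.
rewrite /block_step; move: (block_len n) l0 => l l0; rewrite !natrM -natr1.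
have nR : 0 < n%:R :> R by rewrite ltr0n.
have lR : 1 <= l%:R :> R by rewrite ler1n.
have l0R : 0 < l%:R :> R by rewrite ltr0n.
move: nR lR l0R NR; move: (n%:R : R) (l%:R : R) (N%:R : R) => x y z x0 y1 y0 z0 h1 h2.
have hx : x^-1 <= T / (z * y).
  by rewrite ler_pdivlMr ?mulr_gt0// mulrC ler_pdivrMr// [T * x]mulrC.
split.
- by rewrite divr_gt0// mulr_gt0.
- rewrite ler_pdivrMr ?mulr_gt0// mulrAC ler_pdivlMr//.
  by rewrite mulrC (le_trans (ltW h1))// [leRHS]mulrCA ler_pM2l//; lra.
- rewrite distrC ger0_norm ?subr_ge0//.
  rewrite (_ : y * _ = (T * x / z - y) / x); last first.
    by field; rewrite !gt_eqF.
  rewrite ler_pdivrMr// mulVf ?gt_eqF// lerBlDr ler_pdivrMr// [T * x]mulrC.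
  by rewrite (le_trans (ltW h1))// mulrC addrC.
- by rewrite mulrAC ler_pdivlMr// mulrC [T * x]mulrC.
Qed.

End block_length.

Section block_clt.
Context {R : realType} (d : nat -> measure_display)
  (Omega : forall n, measurableType (d n)) (P : forall n, probability (Omega n) R)
  (X : forall n, nat -> Omega n -> R)
  (d' : measure_display) (Omega' : measurableType d')
  (P' : probability Omega' R) (B : R -> {RV P' >-> R}) (hB : brownian_motion B).
Variables (beta v A T : R) (N : nat).
Arguments X : clear implicits.
Hypotheses (A0 : 0 <= A) (T0 : 0 < T) (N0 : (0 < N)%N).
Hypothesis indepX : forall n, (0 < n)%N -> indep_seq (P n) (X n).
Hypothesis momentsX : \forall n \near \oo, forall k,
  [/\ `|\int[P n]_w X n k w - beta / n%:R| <= A / Num.sqrt n%:R ^+ 3,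
      `|\int[P n]_w (X n k w ^+ 2) - v ^+ 2 / n%:R| <= A / Num.sqrt n%:R ^+ 3,
      \int[P n]_w (`|X n k w| ^+ 3) <= A / Num.sqrt n%:R ^+ 3 &
      (P n).-integrable setT (EFin \o (fun w => `|X n k w| ^+ 3))].

Let l n := block_len T N n.
Let h n := block_step T N n.

(** A common bound on the moment errors of both sides: the errors [A] of the returns, the mismatch
    between [n^-1] and the step, the square of the drift kept in the second moment of the walk, and
    the third moments. *)
Definition clt_error (n : nat) : R := 3 * (A / Num.sqrt n%:R ^+ 3) +
  (`|beta| + v ^+ 2) * `|n%:R^-1 - h n| + (beta * h n) ^+ 2 +
  200 * (`|beta * h n| + `|v * Num.sqrt (h n)|) ^+ 3.

Definition clt_constant : R := 3 * A * (T / N%:R) + (`|beta| + v ^+ 2) +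
  4 * beta ^+ 2 * (T / N%:R) + 1600 * (`|beta| + `|v|) ^+ 3 * (T / N%:R).

(** A block has at most [T / N * n] steps and every term but the mismatch is of order [n ^ (-3/2)]
    or less; the mismatch sums to [n^-1]. The factors 4 and 1600 = 200 * 8 come from [h <= 2 / n]
    and from the square root of [h] being at most [2 * q]. *)
Lemma clt_error_bound n : (1 < n)%N -> (0 < l n)%N ->
  (l n)%:R * clt_error n <= clt_constant / Num.sqrt n%:R.
Proof.
move=> n1 l0; have n0 : (0 < n)%N by exact: ltnW.
have [h0 h2 lh lT] := block_step_bounds T0 N0 n0 l0.
rewrite -/(h n) -/(l n) in h0 h2 lh lT; rewrite /clt_error /clt_constant.
have s0 : 0 < Num.sqrt n%:R :> R by rewrite sqrtr_gt0 ltr0n.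
have s1 : 1 <= Num.sqrt n%:R :> R by exact: sqrt_nat_ge1.
have nE : n%:R = Num.sqrt n%:R ^+ 2 :> R by rewrite sqr_sqrtr.
set q := (Num.sqrt n%:R : R)^-1.
have q0 : 0 <= q by rewrite invr_ge0 ltW.
have q1 : q <= 1 by rewrite invf_le1.
have nV : n%:R^-1 = q ^+ 2 :> R by rewrite nE exprVn.
have nq : n%:R * q ^+ 3 = q :> R.
  by rewrite nE /q; field; rewrite gt_eqF.
have nq4 : n%:R * q ^+ 4 = q ^+ 2 :> R.
  by rewrite nE /q; field; rewrite gt_eqF.
have q21 : q ^+ 2 <= q by rewrite expr2 ler_piMl.
have hle1 : h n <= 1.
  by rewrite (le_trans h2)// ler_pdivrMr ?ltr0n// mul1r ler_nat.
have TN : 0 <= T / N%:R by rewrite divr_ge0// ltW.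
have sh0 : 0 <= Num.sqrt (h n) by exact: sqrtr_ge0.
have hsh : h n <= Num.sqrt (h n).
  rewrite -[leLHS]sqr_sqrtr ?(ltW h0)// expr2 ler_piMl//.
  by rewrite -[leRHS]sqrtr1 ler_wsqrtr.
have shq : Num.sqrt (h n) <= 2 * q.
  rewrite -(@ler_pXn2r _ 2)// ?nnegrE ?mulr_ge0// sqr_sqrtr ?(ltW h0)//.
  by rewrite (le_trans h2)// exprMn nV; have := sqr_ge0 q; lra.
have cs : (`|beta * h n| + `|v * Num.sqrt (h n)|) ^+ 3 <=
    8 * (`|beta| + `|v|) ^+ 3 * q ^+ 3.
  rewrite (_ : 8 * _ * _ = ((`|beta| + `|v|) * (2 * q)) ^+ 3); last by ring.
  have : `|beta * h n| + `|v * Num.sqrt (h n)| <= (`|beta| + `|v|) * (2 * q).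
    rewrite (normrM beta) (normrM v) (ger0_norm (ltW h0)) (ger0_norm sh0) mulrDl lerD//.
      by rewrite ler_wpM2l// (le_trans hsh).
    by rewrite ler_wpM2l.
  by apply: lerXn2r; rewrite nnegrE ?mulr_ge0 ?addr_ge0.
have bh : (beta * h n) ^+ 2 <= 4 * beta ^+ 2 * q ^+ 4.
  rewrite exprMn (_ : 4 * _ * _ = beta ^+ 2 * (2 * q ^+ 2) ^+ 2); last by ring.
  rewrite ler_wpM2l ?sqr_ge0// lerXn2r ?nnegrE ?(ltW h0) ?mulr_ge0 ?sqr_ge0//.
  by rewrite -nV.
have lR0 : 0 <= (l n)%:R :> R by [].
have lq3 : (l n)%:R * q ^+ 3 <= T / N%:R * q.
  rewrite (_ : T / N%:R * q = T / N%:R * n%:R * q ^+ 3); last by rewrite -[RHS]mulrA nq.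
  by rewrite ler_wpM2r ?exprn_ge0.
have lq4 : (l n)%:R * q ^+ 4 <= T / N%:R * q.
  rewrite (@le_trans _ _ (T / N%:R * q ^+ 2))//; last by rewrite ler_wpM2l.
  rewrite (_ : T / N%:R * q ^+ 2 = T / N%:R * n%:R * q ^+ 4);
    last by rewrite -[RHS]mulrA nq4.
  by rewrite ler_wpM2r ?exprn_ge0.
rewrite -exprVn -/q.
have t1 : (l n)%:R * (3 * (A * q ^+ 3)) <= 3 * A * (T / N%:R * q).
  rewrite (_ : _ * (3 * _) = 3 * A * ((l n)%:R * q ^+ 3)); last by ring.
  by rewrite ler_wpM2l// mulr_ge0.
have t2 : (l n)%:R * ((`|beta| + v ^+ 2) * `|n%:R^-1 - h n|) <=
    (`|beta| + v ^+ 2) * q.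
  rewrite mulrCA ler_wpM2l ?addr_ge0 ?sqr_ge0//.
  by rewrite (le_trans lh)// nV.
have t3 : (l n)%:R * (beta * h n) ^+ 2 <= 4 * beta ^+ 2 * (T / N%:R * q).
  rewrite (le_trans (ler_wpM2l lR0 bh))// mulrCA ler_wpM2l//.
  by rewrite mulr_ge0 ?sqr_ge0.
have t4 : (l n)%:R * (`|beta * h n| + `|v * Num.sqrt (h n)|) ^+ 3 <=
    8 * (`|beta| + `|v|) ^+ 3 * (T / N%:R * q).
  have S0 : 0 <= 8 * (`|beta| + `|v|) ^+ 3 by rewrite mulr_ge0 ?exprn_ge0 ?addr_ge0.
  rewrite (le_trans (ler_wpM2l lR0 cs))// mulrCA.
  exact: ler_wpM2l.
move: t1 t2 t3 t4; move: (T / N%:R) (`|_ - h n|) ((beta * h n) ^+ 2)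
  ((_ + _) ^+ 3) ((`|beta| + `|v|) ^+ 3) (q ^+ 3) ((l n)%:R : R).
move=> x1 x2 x3 x4 x5 x6 x7 t1 t2 t3 t4.
rewrite (_ : x7 * _ = x7 * (3 * (A * x6)) + x7 * ((`|beta| + v ^+ 2) * x2) +
  x7 * x3 + 200 * (x7 * x4)); last by ring.
rewrite (_ : _ * q = 3 * A * (x1 * q) + (`|beta| + v ^+ 2) * q +
  4 * beta ^+ 2 * (x1 * q) + 200 * (8 * x5 * (x1 * q))); last by ring.
have k0 : 0 <= 200 :> R by exact: ler0n.
by rewrite lerD// ?(ler_wpM2l k0 t4)// lerD// lerD.
Qed.

Lemma moment_error_clt : \forall n \near \oo,
  [/\ third_moments (P n) (X n),
      forall k, moment_error (P n) (X n) k (beta * h n) (v * Num.sqrt (h n)) <=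
        clt_error n &
      forall k, moment_error P' (drifted_increment B beta v (h n)) k
        (beta * h n) (v * Num.sqrt (h n)) <= clt_error n].
Proof.
near=> n.
have n0 : (0 < n)%N by near: n; exact: nbhs_infty_gt.
have l0 : (0 < l n)%N by near: n; exact: block_len_near.
have mX : forall k,
  [/\ `|\int[P n]_w X n k w - beta / n%:R| <= A / Num.sqrt n%:R ^+ 3,
      `|\int[P n]_w (X n k w ^+ 2) - v ^+ 2 / n%:R| <= A / Num.sqrt n%:R ^+ 3,
      \int[P n]_w (`|X n k w| ^+ 3) <= A / Num.sqrt n%:R ^+ 3 &
      (P n).-integrable setT (EFin \o (fun w => `|X n k w| ^+ 3))].
  by near: n; exact: momentsX.
have [h0 _ _ _] := block_step_bounds T0 N0 n0 l0; rewrite -/(h n) in h0.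
have a0 : 0 <= A / Num.sqrt n%:R ^+ 3.
  by rewrite divr_ge0// exprn_ge0// sqrtr_ge0.
have b0 : 0 <= `|beta| * `|n%:R^-1 - h n| by rewrite mulr_ge0.
have v0 : 0 <= v ^+ 2 * `|n%:R^-1 - h n| by rewrite mulr_ge0 ?sqr_ge0.
have c0 : 0 <= (beta * h n) ^+ 2 by exact: sqr_ge0.
have s0 : 0 <= (`|beta * h n| + `|v * Num.sqrt (h n)|) ^+ 3.
  by rewrite exprn_ge0// addr_ge0.
split=> [k|k|k]; first by have [] := mX k.
- have [E1 E2 E3 _] := mX k; rewrite /moment_error.
  have e1 : `|\int[P n]_w X n k w - beta * h n| <=
      A / Num.sqrt n%:R ^+ 3 + `|beta| * `|n%:R^-1 - h n|.
    rewrite -normrM mulrBr (le_trans (ler_distD (beta / n%:R) _ _))//.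
    by rewrite lerD.
  have e2 : `|\int[P n]_w (X n k w ^+ 2) -
        ((beta * h n) ^+ 2 + (v * Num.sqrt (h n)) ^+ 2)| <=
      A / Num.sqrt n%:R ^+ 3 + v ^+ 2 * `|n%:R^-1 - h n| + (beta * h n) ^+ 2.
    rewrite [(v * _) ^+ 2]exprMn sqr_sqrtr ?(ltW h0)// [_ ^+ 2 + v ^+ 2 * _]addrC.
    rewrite opprD addrA.
    rewrite (le_trans (ler_normB _ _))// [X in _ + X]ger0_norm// lerD2r.
    rewrite -[v ^+ 2 in leRHS](ger0_norm (sqr_ge0 v)) -normrM mulrBr.
    by rewrite (le_trans (ler_distD (v ^+ 2 / n%:R) _ _))// lerD.
  rewrite /clt_error mulrDl.
  by move: E3 e1 e2 a0 b0 v0 c0 s0; rewrite -/(h n); lra.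
- have [_ /(_ k)] := drifted_increment_moments hB beta v h0.
  move/le_trans; apply; rewrite /clt_error lerDr.
  have bv0 : 0 <= (`|beta| + v ^+ 2) * `|n%:R^-1 - h n|.
    by rewrite mulr_ge0// addr_ge0// sqr_ge0.
  have a3 : 0 <= 3 * (A / Num.sqrt n%:R ^+ 3) by rewrite mulr_ge0.
  exact: addr_ge0 (addr_ge0 a3 bv0) c0.
Unshelve. all: by end_near. Qed.

Definition block_vector n (w : Omega n) (j : 'I_N) : R :=
  block_sum (X n) (j * l n) (l n) w.

Definition brownian_vector (w : Omega') (j : 'I_N) : R :=
  beta * (T / N%:R) +
  v * (B (j.+1%:R * (T / N%:R)) w - B (j%:R * (T / N%:R)) w).

Lemma block_clt b p q K : (forall j : nat, taylor3 (b j) (p j) (q j) K) ->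
  \int[P n]_w (\prod_(j < N) b j (block_vector w j)) @[n --> \oo] -->
  \int[P']_w (\prod_(j < N) b j (brownian_vector w j)).
Proof.
move=> T3; have K0 : 0 <= K.
  by have [_ _ pK _ _] := T3 0%N; rewrite (le_trans _ (pK 0)).
apply/cvgrPdist_lt => e e0; near=> n.
have n1 : (1 < n)%N by near: n; exact: nbhs_infty_gt.
have n0 := ltnW n1.
have l0 : (0 < l n)%N by near: n; exact: block_len_near.
have [h0 _ _ _] := block_step_bounds T0 N0 n0 l0; rewrite -/(h n) in h0.
have [X3 eX eD] : [/\ third_moments (P n) (X n),
      forall k, moment_error (P n) (X n) k (beta * h n) (v * Num.sqrt (h n)) <=
        clt_error n &
      forall k, moment_error P' (drifted_increment B beta v (h n)) k
        (beta * h n) (v * Num.sqrt (h n)) <= clt_error n].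
  by near: n; exact: moment_error_clt.
have iD := indep_seq_drifted_increment hB beta v h0.
have [D3 _] := drifted_increment_moments hB beta v h0.
have hX := lindeberg_blocks N (l n) (indepX n0) X3 eX T3.
have hD := lindeberg_blocks N (l n) iD D3 eD T3.
(* The small increments of a block add up exactly to the increment over the cell, since
   [l n * h n = T / N]. *)
have ED : \int[P']_w (\prod_(j < N) b j (brownian_vector w j)) =
    \int[P']_w (\prod_(j < N) b j
      (block_sum (drifted_increment B beta v (h n)) (j * l n) (l n) w)).
  apply: eq_Rintegral => w _; apply: eq_bigr => j _; congr (b j _).
  rewrite block_sum_drifted_increment /brownian_vector.
  have lN : (l n)%:R * h n = T / N%:R.
    by rewrite /h /block_step -/(l n); field; rewrite !pnatr_eq0 -!lt0n l0 N0.
  by rewrite -mulSnr !natrM -!mulrA lN.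
rewrite ED; apply: (@le_lt_trans _ _ (2 * ((N * l n)%:R * (K * clt_error n)))).
  rewrite (le_trans (ler_distD (\prod_(j < N) iter (l n)
    (binomial_step (beta * h n) (v * Num.sqrt (h n))) (b j) 0) _ _))//.
  by rewrite mulrDl mul1r lerD// distrC.
have -> : 2 * ((N * l n)%:R * (K * clt_error n)) =
    2 * N%:R * K * ((l n)%:R * clt_error n) by rewrite natrM; ring.
have NK : 0 <= 2 * N%:R * K by rewrite !mulr_ge0.
apply: (le_lt_trans (ler_wpM2l NK (clt_error_bound n1 l0))).
rewrite mulrA; near: n; exact: div_sqrt_nat_near.
Unshelve. all: by end_near. Qed.

End block_clt.

(** * Oscillations within a block *)

Section truncated_exponential.
Context {R : realType}.

(** Below the level [M] the exponential has slope at most [M]. If only [expR y] exceeds [M], [y] is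
    lowered to [ln M]. *)
Lemma min_expR_lipschitz (M x y : R) : 0 < M ->
  `|Num.min M (expR x) - Num.min M (expR y)| <= M * `|x - y|.
Proof.
move=> M0; wlog xy : x y / x <= y => [H|].
  have [/H//|/ltW /H] := leP x y; by rewrite distrC (distrC x).
rewrite distrC (distrC x) (ger0_norm (_ : 0 <= y - x)) ?subr_ge0//.
have exy : expR x <= expR y by rewrite ler_expR.
have main (z : R) : expR z <= M -> x <= z -> expR z - expR x <= M * (z - x).
  move=> zM xz; have -> : expR z - expR x = expR z * (1 - expR (x - z)).
    by rewrite mulrBr mulr1 -expRD addrCA subrr addr0.
  have := expR_ge1Dx (x - z) => h.
  apply: (@le_trans _ _ (expR z * (z - x))); last by rewrite ler_wpM2r ?subr_ge0.
  by rewrite ler_wpM2l ?expR_ge0//; lra.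
have Mxy : 0 <= M * (y - x) by rewrite mulr_ge0 ?subr_ge0// ltW.
have [yM|My] := leP (expR y) M.
  rewrite (min_r (le_trans exy yM)) ger0_norm ?subr_ge0//.
  exact: main.
have [xM|Mx] := leP (expR x) M; last first.
  by rewrite subrr normr0.
rewrite ger0_norm ?subr_ge0//.
have EM : expR (ln M) = M by rewrite lnK.
have := main (ln M); rewrite EM lexx -[x <= ln M]ler_expR EM => /(_ isT xM).
move/le_trans; apply; rewrite ler_wpM2l ?(ltW M0)// lerD2r.
by rewrite -ler_expR EM ltW.
Qed.

End truncated_exponential.

Section oscillation.
Context {R : realType} d (Omega : measurableType d) (P : probability Omega R)
  (X : nat -> Omega -> R) (T : R) (n M : nat).

(* With [N] cells, the maximal inequality at the level [lambda] bounds the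
   probability of an oscillation larger than [M^-2] over one cell by
   [C exp (- lambda / M^2)] as soon as [lambda ^ 2 <= N]; the exponents make the
   sum over all cells of order [M^-1]. *)
Definition cells : nat := (M.+1 ^ 14)%N.

Let l := block_len T cells n.

Definition discrete_path (w : Omega) : skorokhod T :=
  step_path T n%:R (fun m => expR (block_sum X 0 m w)).

(** Cell [j] takes the value at index [j * l], not at the integer part of [n] times its left end;
    the path is thus a function of sums over blocks of equal length. *)
Definition cell_path (w : Omega) : skorokhod T :=
  step_path T (cells%:R / T)
    (fun j => Num.min M.+1%:R (expR (block_sum X 0 (j * l) w))).

Lemma block_sum_split a i w :
  block_sum X 0 (a + i) w = block_sum X 0 a w + block_sum X a i w.
Proof. by rewrite /block_sum !add0n -big_cat_nat ?leq_addr. Qed.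

Lemma block_sumZ (c : R) a i w :
  block_sum (fun k w => c * X k w) a i w = c * block_sum X a i w.
Proof. by rewrite /block_sum mulr_sumr. Qed.

Hypothesis T0 : 0 < T.

Let cells_gt0 : (0 < cells)%N. Proof. by rewrite expn_gt0. Qed.

(** Rounding makes the blocks lag behind the cells: [n * t] is below [j.+1 * l.+1], which exceeds
    [j * l] by [l + j + 1]. Since [j <= cells <= l], an excess of [2 * l] covers the lag. *)
Lemma cell_index t j : (cells <= l)%N -> t \in `[0, T] ->
  j = Num.truncn (cells%:R / T * t) ->
  (j <= cells)%N /\ exists2 i, (i <= 2 * l)%N & Num.truncn (n%:R * t) = (j * l + i)%N.
Proof.
move=> Nl /[!in_itv]/= /andP[t0 tT] jE.
have NR : 0 < cells%:R :> R by rewrite ltr0n cells_gt0.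
have jt : j%:R <= cells%:R / T * t by rewrite jE truncn_le mulr_ge0// divr_ge0// ltW.
have tj : cells%:R / T * t < j.+1%:R by rewrite jE truncnS_gt.
have jN : (j <= cells)%N.
  rewrite -(ler_nat R) (le_trans jt)// mulrAC ler_pdivrMr//.
  by rewrite ler_wpM2l.
split=> //.
have := block_len_le T0 cells_gt0 n; have := block_len_gt T cells_gt0 n.
rewrite -/l ![(cells * _)%:R]natrM => nl ln.
have jlk : (j * l <= Num.truncn (n%:R * t))%N.
  rewrite truncn_ge_nat ?mulr_ge0// [(j * l)%:R]natrM.
  rewrite -(ler_pM2r T0) -(ler_pM2l NR).
  apply: (@le_trans _ _ ((cells%:R / T * t) * T * (cells%:R * l%:R))).
    rewrite (_ : cells%:R * _ = j%:R * T * (cells%:R * l%:R)); last by ring.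
    by rewrite ler_wpM2r ?mulr_ge0// ler_wpM2r// ltW.
  rewrite (_ : _ * (cells%:R * l%:R) = cells%:R * t * (cells%:R * l%:R)); last first.
    by field; rewrite gt_eqF.
  rewrite (_ : cells%:R * (n%:R * t * T) = cells%:R * t * (n%:R * T)); last by ring.
  by rewrite ler_wpM2l ?mulr_ge0.
exists (Num.truncn (n%:R * t) - j * l)%N; last by rewrite subnKC.
rewrite leq_subLR -ltnS truncn_lt_nat ?mulr_ge0//.
apply: (@lt_le_trans _ _ (j.+1%:R * l.+1%:R)).
  rewrite -(ltr_pM2r T0) -(ltr_pM2l NR).
  have n0t : 0 <= n%:R * T by rewrite mulr_ge0// ltW.
  apply: (@le_lt_trans _ _ (j.+1%:R * T * (n%:R * T))).
    rewrite (_ : cells%:R * _ = (cells%:R / T * t) * T * (n%:R * T)); last first.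
      by field; rewrite gt_eqF.
    by rewrite ler_wpM2r// ler_wpM2r// ltW// ltW.
  rewrite (_ : cells%:R * _ = j.+1%:R * T * (cells%:R * l.+1%:R)); last by ring.
  by rewrite ltr_pM2l// mulr_gt0.
rewrite -natrM ler_nat mulSn mulnS.
have : (j <= l)%N by exact: leq_trans Nl.
by move: l (j * l)%N => a b; lia.
Qed.

(** Under the first bound the cap never acts on the discrete path, so its Lipschitz constant [M.+1]
    multiplies the oscillation [M.+1 ^ -2]. *)
Lemma path_oscillation w : (cells <= l)%N ->
    (forall i, (i <= (cells + 2) * l)%N -> block_sum X 0 i w < ln M.+1%:R) ->
    (forall j i, (j <= cells)%N -> (i <= 2 * l)%N ->
       `|block_sum X (j * l) i w| <= (M.+1%:R ^+ 2)^-1) ->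
  forall t, t \in `[0, T] -> `|discrete_path w t - cell_path w t| <= M.+1%:R^-1.
Proof.
move=> Nl Sw Ow t tT; rewrite /discrete_path /cell_path !step_pathE//.
have [] := cell_index Nl tT erefl.
move: (Num.truncn (cells%:R / T * t)) => j jN [i il ->].
have M0 : 0 < M.+1%:R :> R by rewrite ltr0n.
have below k : (k <= (cells + 2) * l)%N -> expR (block_sum X 0 k w) <= M.+1%:R.
  by move=> kl; rewrite -[leRHS](@lnK R) ?posrE// ler_expR ltW// Sw.
have jl : (j * l + i <= (cells + 2) * l)%N.
  by rewrite mulnDl leq_add// leq_mul2r jN orbT.
rewrite -{1}(min_r (below _ jl)) (le_trans (min_expR_lipschitz _ _ M0))//.
rewrite block_sum_split addrAC subrr add0r.
rewrite (le_trans (ler_wpM2l (ltW M0) (Ow j i jN il)))//.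
by rewrite expr2 invfM mulrA divff ?gt_eqF// mul1r.
Qed.

Variables (K C : R).
Hypothesis K0 : 0 <= K.
Hypothesis n0 : (0 < n)%N.
Hypothesis indepX : indep_seq P X.
Hypothesis boundX : forall k w, `|X k w| <= C.
Hypothesis expX : forall lambda : R, `|lambda| <= M.+1%:R ^+ 7 -> forall k,
  \int[P]_w expR (lambda * X k w) <= expR ((`|lambda| + lambda ^+ 2) * K / n%:R).

Let scaled_majorant (lambda c : R) (a m : nat) : `|lambda| <= M.+1%:R ^+ 7 ->
  exists G : Omega -> R,
    [/\ P.-integrable setT (EFin \o G), forall w, 0 <= G w,
        \int[P]_w G w <= expR ((`|lambda| + lambda ^+ 2) * K / n%:R * m%:R - c) &
        forall w i, (i <= m)%N -> c <= lambda * block_sum X a i w -> 1 <= G w].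
Proof.
move=> lM.
have mpsi : measurable_fun setT (fun x : R => lambda * x) by exact: measurable_funM.
have iL := indep_seq_comp mpsi indepX.
have bL k w : `|lambda * X k w| <= `|lambda| * C by rewrite normrM ler_wpM2l.
have k0 : 0 <= (`|lambda| + lambda ^+ 2) * K / n%:R.
  by rewrite !mulr_ge0// ?invr_ge0// addr_ge0// sqr_ge0.
have [G [iG G0 EG PG]] := maximal_majorant a m c iL bL k0 (expX lM).
exists G; split=> // w i im h; apply: (PG w i im).
by rewrite -block_sumZ in h.
Qed.

(** A union bound with functions in place of events: [G0] majorizes the crossing of [ln r] by the
    whole sum, [Gp j] and [Gm j] the upward and downward deviations from index [j * l]. Their
    integrals contribute 1, 12 and 12 to the constant 25. *)
Lemma oscillation_majorant : (cells <= l)%N ->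
  exists G : Omega -> R,
    [/\ P.-integrable setT (EFin \o G), forall w, 0 <= G w,
        \int[P]_w G w <= 25 * expR (6 * T * K) / M.+1%:R &
        forall w, G w < 1 ->
          forall t, t \in `[0, T] -> `|discrete_path w t - cell_path w t| <= M.+1%:R^-1].
Proof.
move=> Nl; set r := M.+1%:R : R.
have r1 : 1 <= r by rewrite ler1n.
have r0 : 0 < r by rewrite (lt_le_trans ltr01).
have nR : 0 < n%:R :> R by rewrite ltr0n.
have cellsE : cells%:R = r ^+ 14 :> R by rewrite /cells natrX.
have lnT : cells%:R * l%:R / n%:R <= T.
  rewrite ler_pdivrMr// [T * _]mulrC.
  by have := block_len_le T0 cells_gt0 n; rewrite -/l [(cells * _)%:R]natrM.
pose lam := r ^+ 7.
have lam1 : 1 <= lam by rewrite exprn_ege1.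
have lam0 : 0 < lam by rewrite (lt_le_trans ltr01).
have [G0 [iG0 pG0 EG0 PG0]] := @scaled_majorant 1 (ln r) 0 ((cells + 2) * l)
  ltac:(by rewrite normr1).
have exG (s : R) : `|s| = 1 -> forall j : nat, exists G : Omega -> R,
    [/\ P.-integrable setT (EFin \o G), forall w, 0 <= G w,
        \int[P]_w G w <= 6 * expR (4 * T * K) / r ^+ 15 &
        forall w i, (i <= 2 * l)%N ->
          r ^+ 5 <= s * lam * block_sum X (j * l) i w -> 1 <= G w].
  move=> s1 j; have sl : `|s * lam| = lam by rewrite normrM s1 mul1r gtr0_norm.
  have [|G [iG pG EG PG]] := @scaled_majorant (s * lam) (r ^+ 5) (j * l) (2 * l).
    by rewrite sl.
  exists G; split=> //; apply: (le_trans EG).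
  have s2 : s ^+ 2 = 1 by rewrite -real_normK ?num_real// s1 expr1n.
  rewrite sl exprMn s2 mul1r expRD.
  (* Here [lam ^+ 2 = cells], so the compensator over two blocks is bounded independently of [M] and
     [n]. *)
  have e1 : (lam + lam ^+ 2) * K / n%:R * (2 * l)%:R <= 4 * T * K.
    have h1 : (lam + lam ^+ 2) <= 2 * lam ^+ 2.
      have lam2 : lam <= lam ^+ 2 by rewrite expr2 ler_peMl// ltW.
      by rewrite mulr2n mulrDl !mul1r lerD2r.
    have h2 : lam ^+ 2 * (l%:R / n%:R) <= T.
      by apply: le_trans lnT; rewrite cellsE /lam -exprM mulrA.
    have ln0 : 0 <= l%:R / n%:R :> R by rewrite divr_ge0.
    rewrite natrM (_ : _ * (2 * l%:R) =
      2 * K * ((lam + lam ^+ 2) * (l%:R / n%:R))); last by ring.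
    rewrite (_ : 4 * T * K = 2 * K * (2 * T)); last by ring.
    rewrite ler_wpM2l ?mulr_ge0//.
    by rewrite (le_trans (ler_wpM2r ln0 h1))// -mulrA ler_wpM2l.
  (* From [y ^+ 3 <= 6 * expR y] at [y = r ^+ 5]; summed over [r ^+ 14 + 1] indices it leaves a
     multiple of [r^-1]. *)
  have e2 : expR (- r ^+ 5) <= 6 / r ^+ 15.
    have r5 : 0 < r ^+ 5 by rewrite exprn_gt0.
    have := cube_le_expR (r ^+ 5); rewrite gtr0_norm// -exprM => h.
    rewrite expRN ler_pdivlMr ?exprn_gt0// mulrC ler_pdivrMr ?expR_gt0//.
  rewrite (_ : 6 * _ / _ = expR (4 * T * K) * (6 / r ^+ 15)); last by ring.
  by rewrite ler_pM ?expR_ge0// ler_expR.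
have /choice[Gp GpP] := exG 1 (normr1 _).
have /choice[Gm GmP] := exG (-1) ltac:(by rewrite normrN normr1).
have iGp j : P.-integrable setT (EFin \o Gp j) by have [] := GpP j.
have iGm j : P.-integrable setT (EFin \o Gm j) by have [] := GmP j.
have [iSp ESp] := Rintegral_sum (index_iota 0 cells.+1) iGp.
have [iSm ESm] := Rintegral_sum (index_iota 0 cells.+1) iGm.
exists (fun w => G0 w + (\sum_(0 <= j < cells.+1) Gp j w +
  \sum_(0 <= j < cells.+1) Gm j w)).
have pSp w : 0 <= \sum_(0 <= j < cells.+1) Gp j w.
  by apply: sumr_ge0 => j _; have [] := GpP j.
have pSm w : 0 <= \sum_(0 <= j < cells.+1) Gm j w.
  by apply: sumr_ge0 => j _; have [] := GmP j.
split.
- by apply: integrable_EFinD => //; exact: integrable_EFinD.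
- by move=> w; rewrite !addr_ge0.
- rewrite RintegralD//; last exact: integrable_EFinD.
  rewrite RintegralD// ESp ESm.
  have e0 : \int[P]_w G0 w <= expR (6 * T * K) / r.
    apply: (le_trans EG0); rewrite expRD expRN lnK// ler_wpM2r ?invr_ge0 ?(ltW r0)//.
    rewrite ler_expR normr1 expr1n [((cells + 2) * l)%:R]natrM natrD.
    rewrite (_ : (1 + 1) * K / n%:R * ((cells%:R + 2) * l%:R) =
      2 * K * ((cells%:R + 2) * l%:R / n%:R)); last first.
      by move: (cells%:R) => q; ring.
    rewrite (_ : 6 * T * K = 2 * K * (3 * T)); last by ring.
    rewrite ler_wpM2l ?mulr_ge0//.
    apply: (@le_trans _ _ (3 * (cells%:R * l%:R / n%:R))); last by rewrite ler_wpM2l.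
    rewrite !mulrA ler_wpM2r ?invr_ge0// ler_wpM2r//.
    have : 1 <= cells%:R :> R by rewrite ler1n cells_gt0.
    by move: (cells%:R) => q; lra.
  have eS (G : nat -> Omega -> R) :
      (forall j, \int[P]_w G j w <= 6 * expR (4 * T * K) / r ^+ 15) ->
      \sum_(0 <= j < cells.+1) \int[P]_w G j w <= 12 * expR (6 * T * K) / r.
    move=> EG; apply: (@le_trans _ _ (\sum_(0 <= j < cells.+1)
      (6 * expR (4 * T * K) / r ^+ 15))); first exact: ler_sum.
    rewrite sumr_const_nat subn0 -[leLHS]mulr_natr.
    apply: (@le_trans _ _ (6 * expR (4 * T * K) / r ^+ 15 * (2 * r ^+ 14))).
      rewrite ler_wpM2l ?mulr_ge0 ?expR_ge0 ?invr_ge0 ?exprn_ge0 ?(ltW r0)//.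
      by rewrite -natr1 cellsE mulr2n mulrDl mul1r lerD2l exprn_ege1.
    rewrite (_ : _ * (2 * r ^+ 14) = 12 * expR (4 * T * K) / r); last first.
      by rewrite [r ^+ 15]exprS; field; rewrite gt_eqF.
    rewrite ler_wpM2r ?invr_ge0 ?(ltW r0)// ler_wpM2l// ler_expR.
    rewrite ler_wpM2r// ler_wpM2r ?(ltW T0)//; lra.
  have ep : \sum_(0 <= j < cells.+1) \int[P]_w Gp j w <= 12 * expR (6 * T * K) / r.
    by apply: eS => j; have [] := GpP j.
  have em : \sum_(0 <= j < cells.+1) \int[P]_w Gm j w <= 12 * expR (6 * T * K) / r.
    by apply: eS => j; have [] := GmP j.
  by move: e0 ep em; rewrite -!mulrA; move: (expR _ * r^-1) => x; lra.
move=> w Gw1; apply: path_oscillation => // [i im|j i jN il].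
  rewrite ltNge; apply/negP => h; have := PG0 w i im; rewrite mul1r => /(_ h) g1.
  by move: Gw1 (pSp w) (pSm w); lra.
have part (G : nat -> Omega -> R) : (forall j, 0 <= G j w) ->
    G j w <= \sum_(0 <= j < cells.+1) G j w.
  move=> Gpos; rewrite (bigD1_seq j) ?iota_uniq ?mem_index_iota ?ltnS//.
  by rewrite lerDl; apply: sumr_ge0.
have lr : lam * (r ^+ 2)^-1 = r ^+ 5.
  by rewrite /lam (exprD r 5 2) mulfK// expf_neq0// gt_eqF.
rewrite ler_norml; apply/andP; split; rewrite leNgt; apply/negP => h.
  have [_ _ _ /(_ w i il) g1] := GmP j.
  have : 1 <= Gm j w.
    apply: g1; rewrite -lr -mulrA mulN1r -mulrN ler_wpM2l ?(ltW lam0)//.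
    by rewrite lerNr ltW.
  have gm j' : 0 <= Gm j' w by have [] := GmP j'.
  by move: (part Gm gm) Gw1 (pSp w) (pG0 w); lra.
have [_ _ _ /(_ w i il) g1] := GpP j.
have : 1 <= Gp j w.
  by apply: g1; rewrite -lr -mulrA mul1r ler_wpM2l ?(ltW lam0)// ltW.
have gp j' : 0 <= Gp j' w by have [] := GpP j'.
by move: (part Gp gp) Gw1 (pSm w) (pG0 w); lra.
Qed.

End oscillation.

(** * Convergence of the wealth processes *)

Section step_approximation.
Context {R : realType} (T : R).
Hypothesis T0 : 0 < T.

Lemma cells_gt0 M : (0 < cells M)%N.
Proof. by rewrite expn_gt0. Qed.

Lemma cells_ge M : (M.+1 <= cells M)%N.
Proof. by rewrite /cells expnS leq_pmulr// expn_gt0. Qed.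

Lemma truncn_cells_le (N : nat) (t : R) : (0 < N)%N -> t \in `[0, T] ->
  (Num.truncn (N%:R / T * t) <= N)%N.
Proof.
move=> N0 /[!in_itv]/= /andP[t0 tT].
have NR : 0 < N%:R :> R by rewrite ltr0n.
have h : (Num.truncn (N%:R / T * t))%:R <= N%:R / T * t.
  by rewrite truncn_le mulr_ge0// divr_ge0// ltW.
rewrite -(ler_nat R) (le_trans h)// mulrAC ler_pdivrMr//.
by rewrite ler_wpM2l// ltW.
Qed.

Lemma within_near (g : R -> R) (x e : R) : {within `[0, +oo[, continuous g} ->
  0 <= x -> 0 < e -> \forall t \near x, 0 <= t -> `|g x - g t| < e.
Proof.
move=> /subspace_continuousP/(_ x) gx x0 e0.
have /cvgrPdist_lt/(_ e e0) : g @ within `[0, +oo[ (nbhs x) --> g x.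
  by apply: gx; rewrite /= in_itv/= x0.
rewrite /prop_near1 /= nbhs_simpl /within /= => h.
by apply: filterS h => t h t0; apply: h; rewrite /= in_itv/= t0.
Qed.

(** Around each [x] of [[0, T]], once [M] is large, the cap lies above the values of [g] and a cell
    is shorter than [r / 2], [r] being a radius of continuity at [x]. Compactness makes the
    threshold on [M] uniform. *)
Lemma step_approximation (g : R -> R) (e : R) : {within `[0, +oo[, continuous g} ->
  0 < e -> \forall M \near \oo, forall t, t \in `[0, T] ->
    `|g t - Num.min M.+1%:R
       (g ((Num.truncn ((cells M)%:R / T * t))%:R * (T / (cells M)%:R)))| <= e.
Proof.
move=> cg e0.
pose Q (M : nat) (t : R) := t \in `[0, T] -> `|g t - Num.min M.+1%:R
  (g ((Num.truncn ((cells M)%:R / T * t))%:R * (T / (cells M)%:R)))| <= e.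
have := @segment_compact R 0 T.
rewrite compact_near_coveringP => /(_ nat \oo Q _) H.
have {H} : \forall M \near \oo, `[0, T]%classic `<=` Q M; last first.
  by apply: filterS => M HM t tT; apply: HM.
apply: H => x /= /[!in_itv]/= /andP[x0 xT].
have /nbhs_ballP[r /= r0 rg] := within_near cg x0 (ltac:(lra) : 0 < e / 2).
have [M0 _ M0P] : \forall M \near \oo, g x + e / 2 <= M%:R /\ T / (r / 2) < M%:R.
  near=> M; split; last by near: M; exact: nbhs_infty_gtr.
  by apply/ltW; near: M; exact: nbhs_infty_gtr.
exists (ball x (r / 2), [set M | (M0 <= M)%N]).
  split => /=; last by exists M0.
  by apply: nbhsx_ballx; rewrite divr_gt0.
move=> [t M]/= [xt /M0P[gM TM]] tT.
set N := cells M; set s := _ * (T / N%:R).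
have NR : 0 < N%:R :> R by rewrite ltr0n cells_gt0.
move: (tT); rewrite in_itv/= => /andP[t0 _].
have ct0 : 0 <= N%:R / T * t by rewrite mulr_ge0// divr_ge0// ltW.
have s0 : 0 <= s by rewrite mulr_ge0// divr_ge0// ltW.
have tE : t = N%:R / T * t * (T / N%:R) by field; rewrite !gt_eqF.
have TN0 : 0 < T / N%:R by rewrite divr_gt0.
have st : s <= t by rewrite /s [leRHS]tE ler_wpM2r ?(ltW TN0)// truncn_le.
have ts : t - s < r / 2.
  apply: (@lt_trans _ _ (T / N%:R)).
    rewrite /s {1}tE -mulrBl gtr_pMl// ltrBlDl.
    by have := truncnS_gt (N%:R / T * t); rewrite -natr1 addrC.
  rewrite ltr_pdivrMr// mulrC -ltr_pdivrMr ?divr_gt0//.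
  rewrite (lt_le_trans TM)// ler_nat ltnW//; exact: cells_ge.
move: xt; rewrite /ball/= => xt.
have gt : `|g x - g t| < e / 2.
  by apply: rg => //; rewrite /ball/= (lt_trans xt)//; lra.
have gs : `|g x - g s| < e / 2.
  apply: rg => //; rewrite /ball/=.
  rewrite (le_lt_trans (ler_distD t _ _))// (_ : r = r / 2 + r / 2); last by lra.
  by rewrite ltrD// ger0_norm ?subr_ge0.
have gsM : g s <= M.+1%:R.
  rewrite -natr1; move: gs; rewrite ltr_norml => /andP[gs _]; lra.
rewrite (min_idPr gsM) (le_trans (ler_distD (g x) _ _))//.
rewrite (_ : e = e / 2 + e / 2); last by lra.
by rewrite lerD// ltW// distrC.
Unshelve. all: by end_near. Qed.

End step_approximation.

Section capped_path.
Context {R : realType} (T : R) (N : nat).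
Hypotheses (T0 : 0 < T) (N0 : (0 < N)%N).

(** A uniform distance of at most [e] places [y] only in the balls of radius greater than [e]; the
    excess is then sent to 0. *)
Lemma ball_lipschitz_uniform (g : skorokhod T -> R) (L e : R)
    (x y : skorokhod T) : ball_lipschitz L g -> 0 <= L -> 0 <= e ->
  (forall t, t \in `[0, T] -> `|x t - y t| <= e) -> `|g x - g y| <= L * e.
Proof.
move=> gL L0 e0 xy; apply/ler_addgt0Pr => r r0.
have L1 : 0 < L + 1 by lra.
have r1 : 0 < r / (L + 1) by rewrite divr_gt0.
have e1 : e < e + r / (L + 1) by rewrite ltrDl.
apply: (@le_trans _ _ (L * (e + r / (L + 1)))).
  apply: gL; first by rewrite (le_lt_trans e0).
  exact: uniform_skorokhod_ball xy.
rewrite mulrDr lerD2l mulrCA ger_pMr// ler_pdivrMr// mul1r; lra.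
Qed.

Definition capped_path (m : R) (s : 'I_N -> R) : skorokhod T :=
  step_path T (N%:R / T)
    (fun j => Num.min m (expR (\sum_(i < N | (i < j)%N) s i))).

Lemma capped_path_lipschitz (m : R) (s s' : 'I_N -> R) t : 0 < m ->
  t \in `[0, T] ->
  `|capped_path m s t - capped_path m s' t| <= m * \sum_(i < N) `|s i - s' i|.
Proof.
move=> m0 tT; rewrite !step_pathE//; move: (Num.truncn _) => j.
rewrite (le_trans (min_expR_lipschitz _ _ m0))// ler_wpM2l ?(ltW m0)//.
rewrite -sumrB (le_trans (ler_norm_sum _ _ _))//.
rewrite [leRHS](bigID (fun i : 'I_N => (i < j)%N))/= lerDl.
by apply: sumr_ge0.
Qed.

Lemma step_path_eq (c : R) (u v : nat -> R) :
  (forall t, t \in `[0, T] -> u (Num.truncn (c * t)) = v (Num.truncn (c * t))) ->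
  step_path T c u = step_path T c v.
Proof.
move=> uv; apply: skorokhod_ext => t; have [tT|tT] := boolP (t \in `[0, T]).
  by rewrite !step_pathE// uv.
by rewrite !skorokhod_out.
Qed.

Lemma capped_path_sum (m : R) (F : nat -> R) :
  capped_path m (fun i => F i) =
  step_path T (N%:R / T) (fun j => Num.min m (expR (\sum_(i < j) F i))).
Proof.
apply: step_path_eq => t tT; rewrite [in RHS](big_ord_widen N)//.
exact: truncn_cells_le.
Qed.

End capped_path.

Section cell_paths.
Context {R : realType} (T : R).
Hypothesis T0 : 0 < T.

Lemma block_sum_blocks d (Omega : measurableType d) (X : nat -> Omega -> R) l j w :
  block_sum X 0 (j * l) w = \sum_(i < j) block_sum X (i * l) l w.
Proof.
elim: j => [|j IH]; first by rewrite mul0n big_ord0 /block_sum big_geq.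
by rewrite big_ord_recr/= -IH mulSn addnC block_sum_split.
Qed.

Definition cell_limit (beta v : R) (M : nat) (b : R -> R) : skorokhod T :=
  step_path T ((cells M)%:R / T) (fun j => Num.min M.+1%:R
    (expR (beta * (j%:R * (T / (cells M)%:R)) +
           v * b (j%:R * (T / (cells M)%:R))))).

Lemma capped_drifted_increments (beta v : R) (M : nat) (b : R -> R) : b 0 = 0 ->
  capped_path T M.+1%:R (fun i : 'I_(cells M) => beta * (T / (cells M)%:R) +
    v * (b (i.+1%:R * (T / (cells M)%:R)) - b (i%:R * (T / (cells M)%:R)))) =
  cell_limit beta v M b.
Proof.
move=> b0; move: (cells_gt0 M); rewrite /cell_limit; move: (cells M) => N N0.
rewrite (capped_path_sum T0 N0 _ (fun i => beta * (T / N%:R) +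
    v * (b (i.+1%:R * (T / N%:R)) - b (i%:R * (T / N%:R))))).
congr step_path; apply/funext => j; congr (Num.min _ (expR _)).
move: (T / N%:R) => h; elim: j => [|j IH].
  by rewrite big_ord0 !mul0r b0 !mulr0 addr0.
by rewrite big_ord_recr/= IH -natr1; ring.
Qed.

Lemma cell_limit_near (beta v : R) (b : R -> R) (y : skorokhod T) (e : R) :
  {within `[0, +oo[, continuous b} ->
  (forall t, t \in `[0, T] -> y t = expR (beta * t + v * b t)) -> 0 < e ->
  \forall M \near \oo, ball y e (cell_limit beta v M b).
Proof.
move=> cb yE e0; have cg : {within `[0, +oo[, continuous
    (fun t => expR (beta * t + v * b t))}.
  apply/subspace_continuousP => t t0; apply: (cvg_comp _ expR); last first.
    exact: continuous_expR.
  move/subspace_continuousP : cb => /(_ t t0) cb.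
  apply: cvgD; apply: cvgM => //; [exact: cvg_cst| |exact: cvg_cst].
  exact: cvg_within.
have e2 : 0 < e / 2 by lra.
have := step_approximation T0 cg e2; apply: filterS => M HM.
apply: (@uniform_skorokhod_ball _ _ _ _ _ (e / 2)); [exact: ltW|lra|].
by move=> t tT; rewrite yE// step_pathE//; exact: HM.
Qed.

Lemma measurable_cell_limit d (Omega : measurableType d) (B : R -> Omega -> R)
    (beta v : R) (M : nat) : (forall t, measurable_fun setT (B t)) ->
  measurable_fun setT
    ((fun w => cell_limit beta v M (B ^~ w)) : Omega -> borel (skorokhod T)).
Proof.
move=> mB; apply: (@measurable_step_path _ _ _ _ _ (fun j w => Num.min M.+1%:R
    (expR (beta * (j%:R * (T / (cells M)%:R)) +
           v * B (j%:R * (T / (cells M)%:R)) w)))) => j.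
apply: measurable_minr => //; apply: measurableT_comp => //.
by apply: measurable_funD => //; exact: measurable_funM.
Qed.

End cell_paths.

Section path_convergence.
Context {R : realType} (d : nat -> measure_display)
  (Omega : forall n, measurableType (d n)) (P : forall n, probability (Omega n) R)
  (X : forall n, nat -> Omega n -> R)
  (d' : measure_display) (Omega' : measurableType d')
  (P' : probability Omega' R) (B : R -> {RV P' >-> R}) (hB : brownian_motion B).
Variables (beta v A K T : R) (Y : Omega' -> skorokhod T).
Arguments X : clear implicits.
Hypotheses (A0 : 0 <= A) (K0 : 0 <= K) (T0 : 0 < T).
Hypothesis indepX : forall n, (0 < n)%N -> indep_seq (P n) (X n).
Hypothesis momentsX : \forall n \near \oo, forall k,
  [/\ `|\int[P n]_w X n k w - beta / n%:R| <= A / Num.sqrt n%:R ^+ 3,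
      `|\int[P n]_w (X n k w ^+ 2) - v ^+ 2 / n%:R| <= A / Num.sqrt n%:R ^+ 3,
      \int[P n]_w (`|X n k w| ^+ 3) <= A / Num.sqrt n%:R ^+ 3 &
      (P n).-integrable setT (EFin \o (fun w => `|X n k w| ^+ 3))].
Hypothesis expX : forall r : R, \forall n \near \oo,
  (exists C : R, forall k w, `|X n k w| <= C) /\
  forall lambda, `|lambda| <= r -> forall k,
    \int[P n]_w expR (lambda * X n k w) <=
    expR ((`|lambda| + lambda ^+ 2) * K / n%:R).
Hypothesis YE : forall w t, t \in `[0, T] ->
  Y w t = expR (beta * t + v * B t w).

Lemma measurable_limit_path :
  measurable_fun setT (Y : Omega' -> borel (skorokhod T)).
Proof.
apply: (@measurable_borel_cvg _ _ _ _
  (fun M w => cell_limit T beta v M (fun t => B t w))).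
  by move=> M; apply: (@measurable_cell_limit _ _ _ _ B) => t.
move=> w e e0; apply: cell_limit_near => //; last exact: YE.
exact: (brownian_continuous hB).
Qed.

Let mS n a l : (0 < n)%N -> measurable_fun setT (block_sum (X n) a l).
Proof.
by move=> n0; exact: adapted_measurable (indepX n0) (@adapted_block_sum _ _ _ _ _ _).
Qed.

Lemma measurable_discrete_path n : (0 < n)%N ->
  measurable_fun setT (discrete_path (X n) T n : Omega n -> borel (skorokhod T)).
Proof.
move=> n0; apply: (@measurable_step_path _ _ _ _ _
  (fun m w => expR (block_sum (X n) 0 m w))) => m.
by apply: measurableT_comp => //; exact: mS.
Qed.

Lemma measurable_cell_path n M : (0 < n)%N ->
  measurable_fun setT (cell_path (X n) T n M : Omega n -> borel (skorokhod T)).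
Proof.
move=> n0; apply: (@measurable_step_path _ _ _ _ _
  (fun j w => Num.min M.+1%:R
    (expR (block_sum (X n) 0 (j * block_len T (cells M) n) w)))) => j.
by apply: measurable_minr => //; apply: measurableT_comp => //; exact: mS.
Qed.

Lemma cell_pathE n M w : cell_path (X n) T n M w =
  capped_path T M.+1%:R (@block_vector R d Omega X T (cells M) n w).
Proof.
rewrite (capped_path_sum T0 (cells_gt0 M) _
  (fun j => block_sum (X n) (j * block_len T (cells M) n) (block_len T (cells M) n) w)).
rewrite /cell_path; congr step_path; apply/funext => j.
by rewrite block_sum_blocks.
Qed.

Variables (g : skorokhod T -> R) (M0 L : R).
Hypotheses (gM : forall x, `|g x| <= M0) (L0 : 0 <= L) (gL : ball_lipschitz L g).

Let M00 : 0 <= M0. Proof. exact: le_trans (gM point). Qed.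

Let mg d1 (Omega1 : measurableType d1) (Z : Omega1 -> skorokhod T) :
  measurable_fun setT (Z : Omega1 -> borel (skorokhod T)) ->
  measurable_fun setT (g \o Z).
Proof.
move=> mZ; exact: measurable_continuous_comp (ball_lipschitz_continuous gL) mZ.
Qed.

Let ig d1 (Omega1 : measurableType d1) (P1 : probability Omega1 R)
    (Z : Omega1 -> skorokhod T) :
  measurable_fun setT (Z : Omega1 -> borel (skorokhod T)) ->
  P1.-integrable setT (EFin \o (g \o Z)).
Proof.
by move=> mZ; apply: (@bounded_integrable _ _ _ _ _ M0) => [|w];
  [exact: mg|exact: gM].
Qed.

(** Where [G < 1] the two paths are within [M.+1^-1], which costs [L / M.+1]; elsewhere the trivial
    bound [2 * M0] is at most [2 * M0 * G], and 50 = 2 * 25. *)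
Lemma discrete_cell_error M : \forall n \near \oo,
  `|\int[P n]_w g (discrete_path (X n) T n w) -
    \int[P n]_w g (cell_path (X n) T n M w)| <=
  (L + 50 * M0 * expR (6 * T * K)) / M.+1%:R.
Proof.
near=> n; have n0 : (0 < n)%N by near: n; exact: nbhs_infty_gt.
have [[C XC] eX] : (exists C : R, forall k w, `|X n k w| <= C) /\
  forall lambda, `|lambda| <= M.+1%:R ^+ 7 -> forall k,
    \int[P n]_w expR (lambda * X n k w) <=
    expR ((`|lambda| + lambda ^+ 2) * K / n%:R) by near: n; exact: expX.
have cl : (cells M <= block_len T (cells M) n)%N.
  by near: n; exact: block_len_near T0 (cells_gt0 M) _.
have [G [iG G0 EG GP]] := oscillation_majorant T0 K0 n0 (indepX n0) XC eX cl.
have iD := ig (P n) (measurable_discrete_path n0).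
have iC := ig (P n) (measurable_cell_path M n0).
have r0 : 0 <= M.+1%:R^-1 :> R by rewrite invr_ge0.
rewrite -RintegralB//.
have icst : (P n).-integrable setT (EFin \o (fun=> L / M.+1%:R)).
  exact: integrable_EFin_cst.
have iV : (P n).-integrable setT
    (EFin \o (fun w => L / M.+1%:R + 2 * M0 * G w)).
  by apply: integrable_EFinD => //; exact: integrable_EFinZ.
apply: (le_trans (le_normr_Rintegral_bound (integrable_EFinB iD iC) iV _)).
  move=> w /=; have [Gw|Gw] := ltP (G w) 1.
    apply: (@le_trans _ _ (L / M.+1%:R)).
      by apply: ball_lipschitz_uniform gL _ _ _ => //; exact: GP.
    by rewrite lerDl !mulr_ge0.
  rewrite (le_trans (ler_normB _ _))//.
  apply: (@le_trans _ _ (2 * M0 * G w)); last by rewrite lerDr mulr_ge0.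
  apply: (@le_trans _ _ (2 * M0)); last by rewrite ler_peMr// mulr_ge0.
  by rewrite mulr2n mulrDl mul1r lerD.
rewrite RintegralD//; last exact: integrable_EFinZ.
rewrite Rintegral_probability_cst RintegralZl// [leRHS]mulrDl lerD2l.
rewrite (_ : 50 * M0 * expR (6 * T * K) / M.+1%:R =
  2 * M0 * (25 * expR (6 * T * K) / M.+1%:R)); last by ring.
by rewrite ler_wpM2l// mulr_ge0.
Unshelve. all: by end_near. Qed.

(** [indepX], the source of measurability, assumes [0 < n]; at [n = 0] the blocks are empty and the
    vector is constant. *)
Let block_vector0 M w j : @block_vector R d Omega X T (cells M) 0 w j = 0.
Proof.
rewrite /block_vector /block_len !mul0r truncn0 /block_sum.
by rewrite big_geq// muln0.
Qed.

Lemma cell_path_cvg M : \int[P n]_w g (cell_path (X n) T n M w) @[n --> \oo] -->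
  \int[P']_w g (cell_limit T beta v M (fun t => B t w)).
Proof.
have mVn n (j : 'I_(cells M)) :
    measurable_fun setT (fun w => @block_vector R d Omega X T (cells M) n w j).
  case: n => [|n]; last exact: mS.
  by rewrite (_ : (fun _ => _) = cst 0)//; apply/funext => w; exact: block_vector0.
have mV' (j : 'I_(cells M)) :
    measurable_fun setT (fun w => brownian_vector B beta v T w j).
  apply: measurable_funD => //; apply: measurable_funM => //.
  exact: measurable_funB.
have mC' : measurable_fun setT ((fun w => capped_path T M.+1%:R
    (@brownian_vector _ _ _ P' B beta v T (cells M) w)) :
    Omega' -> borel (skorokhod T)).
  apply: (@measurable_step_path _ _ _ _ _ (fun j w => Num.min M.+1%:R
    (expR (\sum_(i < cells M | (i < j)%N) brownian_vector B beta v T w i)))) => j.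
  apply: measurable_minr => //; apply: measurableT_comp => //.
  rewrite (_ : (fun _ => _) = (fun w => \sum_(i < cells M)
    (if (i < j)%N then brownian_vector B beta v T w i else 0))); last first.
    by apply/funext => w; rewrite big_mkcond.
  by apply: measurable_sum => i; case: (i < j)%N.
have hE : \int[P']_w g (cell_limit T beta v M (fun t => B t w)) =
    \int[P']_w g (capped_path T M.+1%:R
      (@brownian_vector _ _ _ P' B beta v T (cells M) w)).
  congr fine; apply: ae_eq_integral => //.
  - by apply/measurable_EFinP; apply: mg; exact: measurable_cell_limit.
  - by apply/measurable_EFinP; exact: mg.
  (* The increments rebuild the path only from [B 0 = 0], which holds almost surely; hence an
     equality of integrals rather than of paths. *)
  - apply: filterS (brownian_start hB) => w B0w _.
    by rewrite -(capped_drifted_increments T0 _ _ _ B0w).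
rewrite hE (_ : (fun n => _) = (fun n => \int[P n]_w g (capped_path T M.+1%:R
  (@block_vector R d Omega X T (cells M) n w)))); last first.
  by apply/funext => n; apply: eq_Rintegral => w _; rewrite cell_pathE.
apply: (@spline_cvg_Rintegral _ _ _ _ _ _ _ (cells M)
  (fun n w => @block_vector R d Omega X T (cells M) n w)
  (fun w => @brownian_vector _ _ _ P' B beta v T (cells M) w)
  (fun s => g (capped_path T M.+1%:R s)) M0 (L * M.+1%:R)) => //.
- by move=> b p q C tb; exact: (block_clt hB A0 T0 (cells_gt0 M) indepX momentsX tb).
- by rewrite mulr_ge0.
- move=> s s'; rewrite -mulrA; apply: (ball_lipschitz_uniform gL) => //.
    by rewrite mulr_ge0// sumr_ge0.
  by move=> t tT; exact: capped_path_lipschitz.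
- case=> [|n].
    have c0 (w : Omega 0%N) : g (capped_path T M.+1%:R
        (@block_vector R d Omega X T (cells M) 0 w)) =
        g (capped_path T M.+1%:R (fun _ : 'I_(cells M) => 0)).
      by congr (g (capped_path _ _ _)); apply/funext => j; rewrite block_vector0.
    have mc : measurable_fun setT (fun _ : Omega 0%N =>
        g (capped_path T M.+1%:R (fun _ : 'I_(cells M) => 0))).
      exact: measurable_cst.
    by apply: eq_measurable_fun mc => w _; exact: esym (c0 w).
  apply: (eq_measurable_fun (g \o cell_path (X n.+1) T n.+1 M)) => [w _|].
    by rewrite /comp cell_pathE.
  by apply: mg; exact: measurable_cell_path.
- exact: mg mC'.
Qed.

Lemma cell_limit_cvg :
  \int[P']_w g (cell_limit T beta v M (fun t => B t w)) @[M --> \oo] -->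
  \int[P']_w g (Y w).
Proof.
apply: (@bounded_cvg_Rintegral _ _ _ _ _ _ M0) => //.
- by move=> M; apply: mg; exact: measurable_cell_limit.
- exact: mg measurable_limit_path.
- move=> w; apply/cvgrPdist_le => e e0.
  have L1 : 0 < L + 1 by rewrite ltr_wpDl.
  have e1 : 0 < e / (L + 1) by rewrite divr_gt0.
  have := cell_limit_near T0 (brownian_continuous hB w) (@YE w) e1.
  apply: filterS => M /(gL e1) h; apply: (le_trans h).
  by rewrite mulrCA ger_pMr// ler_pdivrMr// mul1r lerDl.
Qed.

(** [M] is fixed first, which is possible because the freezing error [D / M.+1] does not depend on
    [n]; only then is [n] taken large, with a threshold depending on [M]. *)
Lemma discrete_path_cvg : \int[P n]_w g (discrete_path (X n) T n w) @[n --> \oo]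
  --> \int[P']_w g (Y w).
Proof.
apply/cvgrPdist_le => e e0; have e3 : 0 < e / 3 by lra.
pose D := L + 50 * M0 * expR (6 * T * K).
have [M [YM DM]] : exists M : nat,
    `|\int[P']_w g (Y w) - \int[P']_w g (cell_limit T beta v M (fun t => B t w))|
      <= e / 3 /\ D / M.+1%:R <= e / 3.
  suff : \forall M \near \oo,
    `|\int[P']_w g (Y w) - \int[P']_w g (cell_limit T beta v M (fun t => B t w))|
      <= e / 3 /\ D / M.+1%:R <= e / 3 by move=> /filter_ex.
  near=> M; split.
    by near: M; have /cvgrPdist_le := cell_limit_cvg; exact.
  rewrite ler_pdivrMr// mulrC -ler_pdivrMr// -natr1.
  have : D / (e / 3) <= M%:R by near: M; exact: nbhs_infty_ger.
  by lra.
near=> n.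
have h1 : `|\int[P n]_w g (discrete_path (X n) T n w) -
    \int[P n]_w g (cell_path (X n) T n M w)| <= D / M.+1%:R.
  by near: n; exact: discrete_cell_error.
have h2 : `|\int[P']_w g (cell_limit T beta v M (fun t => B t w)) -
    \int[P n]_w g (cell_path (X n) T n M w)| <= e / 3.
  by near: n; have /cvgrPdist_le := @cell_path_cvg M; exact.
have {}h1 := le_trans h1 DM; move: YM h1 h2.
set a := \int[_]__ _; set b := \int[_]__ _; set p := \int[_]__ _.
set q := \int[_]__ _ => YM h1 h2.
rewrite (_ : e = e / 3 + (e / 3 + e / 3)); last by field.
rewrite (le_trans (ler_distD b _ _))// lerD// (le_trans (ler_distD q _ _))//.
by rewrite lerD// distrC.
Unshelve. all: by end_near. Qed.

End path_convergence.

Lemma wealth_process_step (R : realType) (d : measure_display)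
    (Omega : measurableType d) (P : probability Omega R) (T mu sigma f : R)
    (n : nat) (xi : nat -> {RV P >-> R}) (w : Omega) :
  wealth_process T mu sigma f n xi w = step_path T n%:R
    (fun m => \prod_(1 <= k < m.+1) (1 + f * rate mu sigma n (xi k w))).
Proof. by apply: skorokhod_ext. Qed.

Lemma measurable_wealth_process (R : realType) (d : measure_display)
    (Omega : measurableType d) (P : probability Omega R) (T mu sigma f : R)
    (n : nat) (xi : nat -> {RV P >-> R}) :
  measurable_fun setT
    (wealth_process T mu sigma f n xi : Omega -> borel (skorokhod T)).
Proof.
rewrite (_ : wealth_process T mu sigma f n xi = (fun w => step_path T n%:R
    (fun m => \prod_(1 <= k < m.+1) (1 + f * rate mu sigma n (xi k w))))).
  apply: (@measurable_step_path _ _ _ _ _ (fun m w =>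
    \prod_(1 <= k < m.+1) (1 + f * rate mu sigma n (xi k w)))) => m.
  apply: measurable_prod => k _; apply: measurable_funD => //.
  apply: measurable_funM => //; apply: measurable_funD => //.
  exact: measurable_funM.
by apply/funext => w; rewrite wealth_process_step.
Qed.

(** The exponential of a sum of logarithms is the product, at the points where clamping changes
    nothing and all factors are positive. Returns are numbered from 1 and block sums from 0, hence
    the shift. *)
Lemma wealth_process_discrete_path (R : realType) (d : measure_display)
    (Omega : measurableType d) (P : probability Omega R) (T mu sigma f C : R)
    (n : nat) (xi : nat -> {RV P >-> R}) (w : Omega) :
    (forall k, clamp C (xi k.+1 w) = xi k.+1 w) ->
    (forall k, 0 < 1 + f * rate mu sigma n (xi k.+1 w)) ->
  wealth_process T mu sigma f n xi w =
  discrete_path (fun k w => log_return mu sigma f C n (xi k.+1 w)) T n w.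
Proof.
move=> xiC rpos; rewrite wealth_process_step /discrete_path.
congr step_path; apply/funext => m.
rewrite /block_sum add0n expR_sum big_add1/=.
by apply: eq_bigr => k _; rewrite /log_return xiC lnK ?posrE.
Qed.

Theorem theorem4p1 (R : realType) (mu sigma C0 : R)
  (mu_gt0 : 0 < mu) (sigma_gt0 : 0 < sigma)
  (d : nat -> measure_display) (Omega : forall n, measurableType (d n))
  (P : forall n, probability (Omega n) R)
  (xi : forall n, nat -> {RV (P n) >-> R})
  (xi_indep : forall n, (0 < n)%N ->
    independent_RVs (P n) [set k | (0 < k)%N] (xi n))
  (xi_ident : forall n j k, (0 < n)%N -> (0 < j)%N -> (0 < k)%N ->
    same_law (xi n j) (xi n k))
  (xi_mean : forall n k, (0 < n)%N -> (0 < k)%N ->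
    ('E_(P n)[xi n k] = 0)%E)
  (xi_var : forall n k, (0 < n)%N -> (0 < k)%N ->
    ('V_(P n)[xi n k] = 1)%E)
  (xi_bound : forall n k, (0 < n)%N -> (0 < k)%N ->
    {ae P n, forall w, `|xi n k w| <= C0})
  (d' : measure_display) (Omega' : measurableType d')
  (P' : probability Omega' R) (B : R -> {RV P' >-> R})
  (hB : brownian_motion B)
  (T f : R) (T_gt0 : 0 < T) (f01 : 0 <= f <= 1) :
  cvg_in_law P (fun n => wealth_process T mu sigma f n (xi n))
    P' (limit_process T mu sigma f hB).
Proof.
have mu0 := ltW mu_gt0; have sigma0 := ltW sigma_gt0.
have C00 : 0 <= `|C0| by [].
(* Clamped at the absolute value of [C0], which is nonnegative whatever the sign of [C0]. *)
pose X n k (w : Omega n) := log_return mu sigma f `|C0| n (xi n k.+1 w).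
have mean0 n k : (0 < n)%N -> \int[P n]_w clamp `|C0| (xi n k.+1 w) = 0.
  by move=> n0; apply: Rintegral_clamp_mean (xi_bound n k.+1 n0 _) _ => //;
    exact: xi_mean.
have var1 n k : (0 < n)%N -> \int[P n]_w (clamp `|C0| (xi n k.+1 w) ^+ 2) = 1.
  by move=> n0; apply: Rintegral_clamp_var (xi_bound n k.+1 n0 _) _ _ => //;
    [exact: xi_mean|exact: xi_var].
have indepX n : (0 < n)%N -> indep_seq (P n) (X n).
  move=> n0; apply: (indep_seq_comp (measurable_log_return mu sigma f `|C0| n)).
  apply: (independent_RVs_indep_seq (e := S)) (xi_indep n n0) => //.
  by move=> i j [].
have A0 : 0 <= moment_constant mu sigma `|C0|.
  by rewrite /moment_constant addr_ge0 ?sqr_ge0// mulr_ge0// exprn_ge0// return_scale_ge0.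
pose K := `|log_drift mu sigma f| + (f * sigma) ^+ 2 +
  moment_constant mu sigma `|C0|.
have K0 : 0 <= K by rewrite addr_ge0 ?A0// addr_ge0 ?sqr_ge0.
have scale_near : \forall n \near \oo,
    (0 < n)%N /\ return_scale mu sigma `|C0| / Num.sqrt n%:R <= 2^-1.
  near=> n; split; first by near: n; exact: nbhs_infty_gt.
  by apply: ltW; near: n; apply: div_sqrt_nat_near; rewrite invr_gt0.
have momentsX : \forall n \near \oo, forall k,
  [/\ `|\int[P n]_w X n k w - log_drift mu sigma f / n%:R| <=
        moment_constant mu sigma `|C0| / Num.sqrt n%:R ^+ 3,
      `|\int[P n]_w (X n k w ^+ 2) - (f * sigma) ^+ 2 / n%:R| <=
        moment_constant mu sigma `|C0| / Num.sqrt n%:R ^+ 3,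
      \int[P n]_w (`|X n k w| ^+ 3) <=
        moment_constant mu sigma `|C0| / Num.sqrt n%:R ^+ 3 &
      (P n).-integrable setT (EFin \o (fun w => `|X n k w| ^+ 3))].
  apply: filterS scale_near => n [n0 sn] k.
  exact: (log_return_moments mu0 sigma0 C00 f01 _ (mean0 n k n0) (var1 n k n0)).
have expX (r : R) : \forall n \near \oo,
    (exists C : R, forall k w, `|X n k w| <= C) /\
    forall lambda, `|lambda| <= r -> forall k,
      \int[P n]_w expR (lambda * X n k w) <=
      expR ((`|lambda| + lambda ^+ 2) * K / n%:R).
  near=> n.
  have [n0 sn] : (0 < n)%N /\ return_scale mu sigma `|C0| / Num.sqrt n%:R <= 2^-1.
    by near: n.
  split.
    by exists (2 * (return_scale mu sigma `|C0| / Num.sqrt n%:R)) => k w;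
      exact: log_return_bound.
  move=> lambda lr k.
  apply: (log_return_expR mu0 sigma0 C00 f01 _ (mean0 n k n0) (var1 n k n0)) => //.
  have rn : (r * 2 * return_scale mu sigma `|C0|) / Num.sqrt n%:R < 6^-1.
    by near: n; apply: div_sqrt_nat_near; rewrite invr_gt0.
  rewrite (le_trans _ (ltW rn))// -!mulrA ler_wpM2r// !mulr_ge0 ?invr_ge0//.
  exact: return_scale_ge0.
have YE w t : t \in `[0, T] -> limit_process T mu sigma f hB w t =
    expR (log_drift mu sigma f * t + f * sigma * B t w).
  by move=> tT; rewrite /limit_process/= patchE mem_setE tT.
apply: cvg_in_law_lipschitz.
- by move=> n; exact: measurable_wealth_process.
- by have := measurable_limit_path hB T_gt0 YE.
move=> g M L gM L0 gL.
apply: cvg_trans (discrete_path_cvg hB A0 K0 T_gt0 indepX momentsX expX YE gM L0 gL).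
apply: near_eq_cvg; apply: filterS scale_near => n [n0 sn].
have cg := ball_lipschitz_continuous gL.
congr fine; apply: ae_eq_integral => //.
- apply/measurable_EFinP; apply: measurable_continuous_comp cg _.
  exact: measurable_discrete_path indepX _ n0.
- apply/measurable_EFinP; apply: measurable_continuous_comp cg _.
  exact: measurable_wealth_process.
(* Countably many null sets: outside their union clamping changes no variable, and the two paths
   coincide. *)
have : {ae P n, forall w, forall k, clamp `|C0| (xi n k.+1 w) = xi n k.+1 w}.
  by apply: ae_foralln => k; exact: ae_clamp (xi_bound n k.+1 n0 _).
apply: filterS => w xiC _; congr (g _)%:E; apply/esym.
apply: wealth_process_discrete_path => // k.
(* For such [n], [f] times the return is at most 1/2 in absolute value, so every factor is
   positive. *)
have := rate_bound mu0 sigma0 C00 f01 (xi n k.+1 w) n0; rewrite xiC.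
move=> /le_trans/(_ sn); rewrite ler_norml => /andP[h _]; lra.
Unshelve. all: by end_near. Qed.
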